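(* $\mathrm{CON}(\mathrm{THT}_1)$ is in NEXPTIME.
   Context: Fix a finite set $P$ of atomic propositions. THT formulas over $P$: $\varphi ::= p \mid \bot \mid \varphi\vee\varphi \mid \varphi\wedge\varphi \mid \varphi\rightarrow\varphi \mid \mathsf{X}\varphi \mid \varphi\,\mathsf{U}\,\varphi \mid \varphi\,\mathsf{R}\,\varphi$, with $\neg\varphi:=\varphi\rightarrow\bot$, $\top:=\neg\bot$, and modalities $\mathsf F\varphi$ (meaning $\top\mathsf U\varphi$) and $\mathsf G\varphi$ (meaning $\bot\mathsf R\varphi$). A THT interpretation is a pair $M=(H,T)$ of infinite words over $2^P$ with $H(i)\subseteq T(i)$ for all $i$; it is total if $H=T$. Satisfaction $M,i\models\varphi$ is defined by: - $M,i\not\models\bot$; - $M,i\models p$ iff $p\in H(i)$; - $\vee$ and $\wedge$ are interpreted as usual; - $M,i\models\varphi\rightarrow\psi$ iff for both $H'\in\{H,T\}$, either $(H',T),i\not\models\varphi$ or $(H',T),i\models\psi$; - $\mathsf X,\mathsf U,\mathsf R$ have the usual LTL clauses evaluated in $M$. $M\models\varphi$ means $M,0\models\varphi$. An equilibrium model of $\varphi$ is a total $(T,T)\models\varphi$ such that $(H,T)\not\models\varphi$ whenever $H(i)\subseteq T(i)$ for all $i$ and $H\ne T$. $\mathrm{THT}_1$ is the set of THT formulas with no nesting of temporal modalities (temporal height at most $1$; all of $\mathsf X,\mathsf U,\mathsf R,\mathsf F,\mathsf G$ allowed, no bound on implication nesting). $\mathrm{CON}(\mathrm{THT}_1)$ is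 the problem of deciding whether a given $\mathrm{THT}_1$ formula has an equilibrium model. *)

(* Defs.v *)
From mathcomp Require Import all_boot.
Set Implicit Arguments. Unset Strict Implicit. Unset Printing Implicit Defensive.

Inductive form : Type :=
  | Atom of nat
  | Bot
  | Or of form & form
  | And of form & form
  | Imp of form & form
  | Next of form
  | Until of form & form
  | Release of form & form.

Definition Neg (f : form) := Imp f Bot.
Definition Top := Neg Bot.
Definition Fin (f : form) := Until Top f.
Definition Glob (f : form) := Release Bot f.

(* A trace: position -> atom -> membership. *)
Definition trace := nat -> nat -> bool.

Definition subtrace (H T : trace) : Prop := forall i p, H i p -> T i p.

Fixpoint sat (H T : trace) (i : nat) (f : form) {struct f} : Prop :=
  match f with
  | Atom p => H i p
  | Bot => False
  | Or f g => sat H T i f \/ sat H T i g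
  | And f g => sat H T i f /\ sat H T i g
  | Imp f g => (sat H T i f -> sat H T i g) /\ (sat T T i f -> sat T T i g)
  | Next f => sat H T i.+1 f
  | Until f g => exists j, i <= j /\ sat H T j g /\
                   forall k, i <= k -> k < j -> sat H T k f
  | Release f g => forall j, i <= j -> sat H T j g \/
                   exists k, i <= k /\ k < j /\ sat H T k f
  end.

Definition equilibrium_model (T : trace) (f : form) : Prop :=
  sat T T 0 f /\
  forall H : trace, subtrace H T -> (exists i p, H i p <> T i p) -> ~ sat H T 0 f.

Fixpoint theight (f : form) : nat :=
  match f with
  | Atom _ | Bot => 0
  | Or f g | And f g | Imp f g => maxn (theight f) (theight g)
  | Next f => (theight f).+1
  | Until f g | Release f g => (maxn (theight f) (theight g)).+1
  end.

Definition THT1 (f : form) : Prop := theight f <= 1.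

Fixpoint binf (fuel n : nat) : seq bool :=
  match fuel with
  | 0 => [::]
  | fuel'.+1 => if n is 0 then [::] else odd n :: binf fuel' n./2
  end.
Definition bin (n : nat) : seq bool := binf n n.

(* self-delimiting binary code of a natural number *)
Definition enc_nat (n : nat) : seq bool :=
  flatten [seq [:: true; b] | b <- bin n] ++ [:: false].

Fixpoint enc (f : form) : seq bool :=
  match f with
  | Atom p => [:: false; false; false] ++ enc_nat p
  | Bot => [:: false; false; true]
  | Or f g => [:: false; true; false] ++ enc f ++ enc g
  | And f g => [:: false; true; true] ++ enc f ++ enc g
  | Imp f g => [:: true; false; false] ++ enc f ++ enc g
  | Next f => [:: true; false; true] ++ enc f
  | Until f g => [:: true; true; false] ++ enc f ++ enc g
  | Release f g => [:: true; true; true] ++ enc f ++ enc g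
  end.

Definition CON_THT1 (w : seq bool) : Prop :=
  exists f, w = enc f /\ THT1 f /\ exists T : trace, equilibrium_model T f.

Inductive dir := DL | DS | DR.

Record NTM := {
  state : finType;
  sym : finType;
  blank : sym;
  inp : bool -> sym;
  inp_inj : injective inp;
  blank_not_inp : forall b, inp b <> blank;
  start : state;
  acc : state;
  delta : state -> sym -> seq (state * sym * dir)
}.

(* configuration: state, reversed left part, scanned symbol, right part *)
Definition config (M : NTM) : Type :=
  (state M * seq (sym M) * sym M * seq (sym M))%type.

Definition move (M : NTM) (l : seq (sym M)) (b : sym M) (r : seq (sym M))
    (d : dir) : seq (sym M) * sym M * seq (sym M) :=
  match d with
  | DL => (behead l, head (@blank M) l, b :: r)
  | DS => (l, b, r)
  | DR => (b :: l, head (@blank M) r, behead r)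
  end.

Fixpoint lmem (A : Type) (x : A) (s : seq A) : Prop :=
  if s is y :: s' then y = x \/ lmem x s' else False.

Definition step (M : NTM) (c c' : config M) : Prop :=
  let: (q, l, a, r) := c in
  exists q' b d, lmem (q', b, d) (@delta M q a) /\
    let: (l', a', r') := move l b r d in c' = (q', l', a', r').

Fixpoint steps (M : NTM) (n : nat) (c c' : config M) : Prop :=
  match n with
  | 0 => c = c'
  | n'.+1 => exists c'', step c c'' /\ steps n' c'' c'
  end.

Definition init_config (M : NTM) (w : seq bool) : config M :=
  let t := map (@inp M) w in (@start M, [::], head (@blank M) t, behead t).

Definition accepts_within (M : NTM) (w : seq bool) (t : nat) : Prop :=
  exists n (c : config M), n <= t /\ steps n (init_config M w) c /\
    c.1.1.1 = @acc M.

Definition NEXPTIME (L : seq bool -> Prop) : Prop :=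
  exists (k : nat) (M : NTM), forall w : seq bool,
    L w <-> accepts_within M w (2 ^ ((size w).+1 ^ k)).

(* Main.v *)
(* The truth of a formula of temporal height 1 at position 0 depends only on the letters at
   positions 0 and 1 and on the order in which letters occur for the first time. Keeping these
   positions and a recurring letter as tail turns an equilibrium model into one that is constant
   from an exponentially bounded position on. Minimality of a total trace T is then witnessed by a
   finite set of rows: one row for each position, each choice of the here-letter at that position
   and each vector of "decided so far" statuses of the modalities that some H below T can reach.
   Closure of the set of rows under toggling a here-atom and under passing to the next position
   covers all H, and in the constant tail no row may have H different from T and value true.
   All this is a fixed first-order sentence on a word of exponential length (formula on the first
   row, parse tree and configurations on the others), which a Turing machine guesses and then
   evaluates by sweeps, in time polynomial in the length of the word. *)
From HB Require Import structures.
Require Import Defs.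
From mathcomp Require Import all_boot.
From mathcomp Require Import zify.
From Stdlib Require Import Classical ClassicalEpsilon.
Set Implicit Arguments. Unset Strict Implicit. Unset Printing Implicit Defensive.

(** * Sweeping machines *)

(** The obstacle is minimality, a condition on all H below T, which a nondeterministic machine
    cannot guess one by one. The certificate lists rows and asks only for closure: every H then
    traces a path through the rows, so rows beyond those of a canonical certificate do not endanger
    soundness, and soundness needs no bound on the length of the word. Letters below T are
    exponentially many, yet toggling one atom at a time makes each closure condition a statement
    about two rows. Rows of different H at one position must agree on T, hence the binary
    identifiers of positions. A path must also reach the tail, where the value conditions are
    imposed; asking that a successor outside the tail lie further right in the word enforces this
    without counting. Since the alphabet and the sentence do not depend on the formula, the machine
    only has to evaluate a fixed block of quantifiers over positions, and marks on extra tracks do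
    this in polynomial time. *)

Inductive tsym (C : Type) := TBlank | TIn of bool | TCell of C | TEnd.
Arguments TBlank {C}. Arguments TIn {C}. Arguments TEnd {C}.

Section TSymFin.
Variable C : finType.
Definition tsym_enc (s : tsym C) : option (option (bool + C)) :=
  match s with
  | TBlank => None | TEnd => Some None
  | TIn b => Some (Some (inl b)) | TCell c => Some (Some (inr c)) end.
Definition tsym_dec (s : option (option (bool + C))) : tsym C :=
  match s with
  | None => TBlank | Some None => TEnd
  | Some (Some (inl b)) => TIn b | Some (Some (inr c)) => TCell c end.
Lemma tsym_encK : cancel tsym_enc tsym_dec.
Proof. by case. Qed.
HB.instance Definition _ := Finite.copy (tsym C) (can_type tsym_encK).
End TSymFin.

Section Machines.
Variable C : finType.
Notation Sym := (tsym C).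

Definition mv (l : seq Sym) (b : Sym) (r : seq Sym) (d : dir) :
    seq Sym * Sym * seq Sym :=
  match d with
  | DL => (behead l, head TBlank l, b :: r)
  | DS => (l, b, r)
  | DR => (b :: l, head TBlank r, behead r)
  end.

(* A deterministic one-tape machine with exits in E; [ini] may be an exit. *)
Record mach (E : Type) := Mach {
  st : finType;
  ini : st + E;
  trans : st -> Sym -> Sym * dir * (st + E) }.

Definition tape := (seq Sym * Sym * seq Sym)%type.

Inductive runs (E : Type) (M : mach E) :
    nat -> st M + E -> tape -> E -> tape -> Prop :=
| runs0 e t : runs 0 (inr e) t e t
| runsS n s l a r b d x e t' : trans s a = (b, d, x) ->
    runs n x (mv l b r d) e t' -> runs n.+1 (inl s) (l, a, r) e t'.

(** The head stands on the blank left of the word. Every machine starts and stops there, so that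
    machines can be chained without repositioning. *)
Definition home (s : seq C) : tape := ([::], TBlank, map (@TCell C) s ++ [:: TEnd]).

Definition does (E : Type) (M : mach E) (s : seq C) (N : nat) (e : E) (s' : seq C) :=
  exists n, n <= N /\ runs n (ini M) (home s) e (home s').

Lemma does_le E (M : mach E) s N N' e s' : N <= N' -> does M s N e s' -> does M s N' e s'.
Proof. by move=> h [n [hn r]]; exists n; split=> //; apply: leq_trans h. Qed.

Definition ret (E : Type) (e : E) : mach E :=
  @Mach E void (inr e) (fun s _ => match s with end).

Lemma does_ret E (e : E) s N : does (ret e) s N e s.
Proof. by exists 0; split=> //; constructor. Qed.

Section Bind.
Variables (E : finType) (F : Type) (M : mach E) (K : E -> mach F).
Definition bst : finType := (st M + {e : E & st (K e)})%type.
Definition bliftK e (x : st (K e) + F) : bst + F :=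
  match x with
  | inl s => inl (inr (existT (fun e => st (K e) : Type) e s))
  | inr f => inr f end.
Definition blift (x : st M + E) : bst + F :=
  match x with
  | inl s => inl (inl s)
  | inr e => bliftK (ini (K e)) end.
Definition btr (s : bst) (a : Sym) : Sym * dir * (bst + F) :=
  match s with
  | inl s => let: (b, d, x) := trans s a in (b, d, blift x)
  | inr (existT e s) => let: (b, d, x) := trans s a in (b, d, bliftK x) end.
Definition bind : mach F := @Mach F bst (blift (ini M)) btr.

Lemma runs_bindK e n x t f t' : runs (M := K e) n x t f t' ->
  runs (M := bind) n (bliftK x) t f t'.
Proof.
elim=> [{}f {}t|{}n s l a r b d y {}f t0 h _ ih]; first exact: runs0.
by apply: runsS ih; rewrite /= h.
Qed.

Lemma runs_bind n x t e t' : runs (M := M) n x t e t' -> forall n' f t'',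
  runs (M := K e) n' (ini (K e)) t' f t'' -> runs (M := bind) (n + n') (blift x) t f t''.
Proof.
elim=> [{}e {}t|{}n s l a r b d y {}e t0 h _ ih] n' f t'' H; first exact: runs_bindK.
by rewrite addSn; apply: runsS (ih _ _ _ H); rewrite /= h.
Qed.

Lemma does_bind s N e s' N' f s'' : does M s N e s' -> does (K e) s' N' f s'' ->
  does bind s (N + N') f s''.
Proof.
move=> [n [hn H]] [n' [hn' H']]; exists (n + n'); split; first exact: leq_add.
exact: runs_bind H _ _ _ H'.
Qed.
End Bind.

Section Loop.
Variables (F : Type) (f0 : F) (M : mach (option F)).
(** [f0] is reached only if the body exits with [None] before its first step; such a loop would
    never move, so it is given some exit. *)
Definition lini : st M + F :=
  match ini M with inl s => inl s | inr (Some f) => inr f | inr None => inr f0 end.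
Definition llift (x : st M + option F) : st M + F :=
  match x with inl s => inl s | inr (Some f) => inr f | inr None => lini end.
Definition ltr (s : st M) (a : Sym) : Sym * dir * (st M + F) :=
  let: (b, d, x) := trans s a in (b, d, llift x).
Definition loop : mach F := @Mach F (st M) lini ltr.

Lemma runs_loop_exit n x t o t' : runs (M := M) n x t o t' ->
  forall f, o = Some f -> runs (M := loop) n (llift x) t f t'.
Proof.
elim=> [{}o {}t|{}n s l a r b d y {}o t0 h _ ih] f ef; first by rewrite ef; exact: runs0.
by apply: runsS (ih _ ef); rewrite /= /ltr h.
Qed.

Lemma runs_loop_next n x t o t' : runs (M := M) n x t o t' -> o = None ->
  forall n' f t'', runs (M := loop) n' lini t' f t'' ->
  runs (M := loop) (n + n') (llift x) t f t''.
Proof.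
elim=> [{}o {}t|{}n s l a r b d y {}o t0 h _ ih] eo n' f t'' H; first by rewrite eo.
by rewrite addSn; apply: runsS (ih eo _ _ _ H); rewrite /= /ltr h.
Qed.

Lemma lliftI : llift (ini M) = lini.
Proof. by rewrite /llift /lini; case E: (ini M) => [|[]]; rewrite /lini ?E. Qed.

Lemma does_loop_exit s N f s' : does M s N (Some f) s' -> does loop s N f s'.
Proof.
move=> [n [hn H]]; exists n; split=> //.
by rewrite /= -lliftI; apply: runs_loop_exit H _ _.
Qed.

Lemma does_loop_next s N s' N' f s'' : does M s N None s' -> does loop s' N' f s'' ->
  does loop s (N + N') f s''.
Proof.
move=> [n [hn H]] [n' [hn' H']]; exists (n + n'); split; first exact: leq_add.
by rewrite /= -lliftI; apply: runs_loop_next H _ _ _ _ H'.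
Qed.
End Loop.

Section Pass.
Variables (Q : finType) (q0 : Q) (g : Q -> C -> Q * C).

Fixpoint scan (q : Q) (s : seq C) : Q * seq C :=
  match s with
  | [::] => (q, [::])
  | c :: s' => let: (q1, c1) := g q c in let: (q2, s2) := scan q1 s' in (q2, c1 :: s2)
  end.

(* None: at home; Some (true, q): sweeping right; Some (false, q): returning *)
Definition ptr (s : option (bool * Q)) (a : Sym) : Sym * dir * (option (bool * Q) + Q) :=
  match s, a with
  | None, _ => (a, DR, inl (Some (true, q0)))
  | Some (true, q), TCell c => let: (q', c') := g q c in (TCell c', DR, inl (Some (true, q')))
  | Some (true, q), _ => (a, DL, inl (Some (false, q)))
  | Some (false, q), TCell _ => (a, DL, inl (Some (false, q)))
  | Some (false, q), _ => (a, DS, inr q)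
  end.
Definition pass : mach Q := @Mach Q (option (bool * Q)) (inl None) ptr.

(** The trailing [TBlank] is the home cell, pushed onto the left part by the first move of the
    sweep; popping it leaves the left part empty, so the final tape is literally [home]. *)
Lemma runs_back q s l : exists n, n <= (size s).+2 /\
  runs (M := pass) n (inl (Some (false, q)))
    (behead (map (@TCell C) s ++ [:: TBlank]), head TBlank (map (@TCell C) s ++ [:: TBlank]),
     map (@TCell C) l ++ [:: TEnd])
    q (home (catrev s l)).
Proof.
elim: s l => [|c s ih] l /=.
  by exists 1; split=> //; apply: runsS => //; exact: runs0.
have [n [hn H]] := ih (c :: l).
by exists n.+1; split; [lia | apply: runsS].
Qed.

Lemma runs_go s q p : exists n, n <= (size s).*2 + size p + 3 /\
  forall q' s', scan q s = (q', s') ->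
  runs (M := pass) n (inl (Some (true, q)))
    (map (@TCell C) p ++ [:: TBlank], head TBlank (map (@TCell C) s ++ [:: TEnd]),
     behead (map (@TCell C) s ++ [:: TEnd]))
    q' (home (catrev p s')).
Proof.
elim: s q p => [|c s ih] q p /=.
  have [n [hn H]] := runs_back q p [::].
  exists n.+1; split; first by lia.
  move=> _ _ [<- <-]; apply: runsS; first by [].
  refine H.
case E: (g q c) => [q1 c1]; have [n [hn H]] := ih q1 (c1 :: p).
exists n.+1; split; first by move: hn => /=; lia.
case E2: (scan q1 s) => [q2 s2] q' s' [<- <-].
apply: runsS; first by rewrite /= E.
exact: H _ _ E2.
Qed.

Lemma does_pass s q' s' : scan q0 s = (q', s') -> does pass s ((size s).*2 + 4) q' s'.
Proof.
move=> E; have [n [hn H]] := runs_go s q0 [::]; exists n.+1; split; first by move: hn => /=; lia.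
apply: runsS; first by [].
have := H _ _ E; exact.
Qed.
End Pass.

(** Lets an accepting run of unknown length be compared with the bounded run of a decider. *)
Lemma runs_det E (M : mach E) n x t e t' : runs (M := M) n x t e t' ->
  forall n' e' t'', runs (M := M) n' x t e' t'' -> e' = e.
Proof.
elim=> [{}e {}t|{}n s l a r b d y {}e t0 h _ ih] n' e' t'' H.
  by inversion H.
inversion H as [|n1 s1 l1 a1 r1 b1 d1 x1 e1 t1 h1 H1]; subst.
by move: H1; move: h1; rewrite h => -[<- <- <-]; exact: ih.
Qed.

End Machines.

(** * Guessing a certificate and checking it *)

Section ToNTM.
Variables (C : finType) (cin : C -> option bool) (M : mach C bool).

(* None: guessing; Some None: returning home; the rest runs [M], exits included. *)
Definition nstate : finType := (option (option (st M + bool)))%type.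

(** Each input bit is overwritten by a cell that projects to it, then cells that project to no bit
    are appended until the machine chooses to write [TEnd]. The guessed word thus still contains the
    input. *)
Definition ndelta (q : nstate) (a : tsym C) : seq (nstate * tsym C * dir) :=
  match q, a with
  | None, TIn b => [seq (None : nstate, TCell c, DR) | c <- enum C & cin c == Some b]
  | None, TBlank => (Some None : nstate, TEnd, DL)
      :: [seq (None : nstate, TCell c, DR) | c <- enum C & cin c == None]
  | None, _ => [::]
  | Some None, TCell _ => [:: (Some None : nstate, a, DL)]
  | Some None, TBlank => [:: (Some (Some (ini M)) : nstate, a, DS)]
  | Some None, _ => [::]
  | Some (Some (inl s)), _ => let: (b, d, x) := trans s a in [:: (Some (Some x) : nstate, b, d)]
  | Some (Some (inr _)), _ => [::]
  end.

Lemma TIn_inj : injective (@TIn C). Proof. by move=> ? ? []. Qed.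
Lemma TBlank_TIn b : @TIn C b <> TBlank. Proof. by []. Qed.

Definition ntm : NTM := @Build_NTM nstate (tsym C) TBlank (@TIn C) TIn_inj TBlank_TIn
  None (Some (Some (inr true))) ndelta.

Lemma lmem_map (T : eqType) (U : Type) (f : T -> U) x s :
  lmem x (map f s) <-> exists2 c, c \in s & f c = x.
Proof.
elim: s => [|y s ih] /=; first by split=> // -[].
split; first case=> [h|/ih[c cs h]].
- by exists y; rewrite ?mem_head.
- by exists c; rewrite ?inE ?cs ?orbT.
by case=> c; rewrite inE => /orP[/eqP->|cs] h; [left | right; apply/ih; exists c].
Qed.

Lemma stepP (q q' : nstate) l a r t' :
  @step ntm (q, l, a, r) (q', t'.1.1, t'.1.2, t'.2) <->
  exists b d, lmem (q', b, d) (ndelta q a) /\ t' = mv l b r d.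
Proof.
case: t' => [[l' a'] r'] /=; split.
  move=> [q1 [b [d [h]]]].
  have -> : move (M := ntm) l b r d = mv l b r d by case: d {h}.
  by case E: (mv l b r d) => [[l1 a1] r1] [-> -> -> ->]; exists b, d.
move=> [b [d [h E]]]; exists q', b, d; split=> //.
have -> : move (M := ntm) l b r d = mv l b r d by case: d {h E}.
by rewrite -E.
Qed.

Lemma steps_cat (N : NTM) n n' (c1 c2 c3 : config N) :
  steps n c1 c2 -> steps n' c2 c3 -> steps (n + n') c1 c3.
Proof.
elim: n c1 => [|n ih] c1 /=; first by move=> ->.
by move=> [c [h1 h2]] h3; exists c; split=> //; exact: ih.
Qed.

Definition cfg (q : nstate) (t : tape C) : config ntm := (q, t.1.1, t.1.2, t.2).

Lemma stepsS q q' n l a r c b d : lmem (q', b, d) (ndelta q a) ->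
  steps n (cfg q' (mv l b r d)) c -> steps n.+1 (cfg q (l, a, r)) c.
Proof.
move=> h1 h2; exists (cfg q' (mv l b r d)); split=> //.
by apply/stepP; exists b, d.
Qed.

Lemma stepsSE q n l a r c : steps n.+1 (cfg q (l, a, r)) c ->
  exists q' b d, lmem (q', b, d) (ndelta q a) /\ steps n (cfg q' (mv l b r d)) c.
Proof.
move=> [[[[q' l'] a'] r'] [h1 h2]].
have /= /(_ h1) [b [d [h3 h4]]] := proj1 (stepP q q' l a r (l', a', r')).
by exists q', b, d; split=> //; rewrite -h4.
Qed.

Lemma steps_runs n x t e t' : runs (M := M) n x t e t' ->
  steps n (cfg (Some (Some x)) t) (cfg (Some (Some (inr e))) t').
Proof.
elim=> [//|{}n s l a r b d y {}e t0 h _ ih].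
by apply: stepsS ih; rewrite /= h; left.
Qed.

Lemma runs_steps n x t c : steps n (cfg (Some (Some x)) t) c ->
  c.1.1.1 = acc ntm -> exists n' t', runs (M := M) n' x t true t'.
Proof.
elim: n x t => [|n ih] x [[l a] r].
  by move=> <- /= [->]; exists 0, (l, a, r); constructor.
case: x => [s|e] /stepsSE [q' [b [d [/= h1 h2]]]] ec; last by [].
move: h1 => /=; case E: (trans s a) => [[b1 d1] y] /= [[eq eb ed]|//]; subst.
by have [n' [t' H]] := ih _ _ h2 ec; exists n'.+1, t'; apply: runsS E H.
Qed.

(** Unlike in a sweep, the head has not yet visited the blank left of the word, so it is the default
    of [head] that supplies it. *)
Definition back_tape (p s : seq C) : tape C :=
  (behead (map (@TCell C) p), head TBlank (map (@TCell C) p), map (@TCell C) s ++ [:: TEnd]).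

Lemma steps_back p s : steps (size p).+1 (cfg (Some None) (back_tape p s))
  (cfg (Some (Some (ini M))) (home (catrev p s))).
Proof.
elim: p s => [|c p ih] s; rewrite /back_tape; apply: stepsS; try by left.
  by [].
exact: (ih (c :: s)).
Qed.

Lemma back_steps n p s c : steps n (cfg (Some None) (back_tape p s)) c ->
  c.1.1.1 = acc ntm -> exists n',
  steps n' (cfg (Some (Some (ini M))) (home (catrev p s))) c.
Proof.
elim: n p s => [|n ih] p s; first by move=> /= E; rewrite -E.
case: p => [|x p] /stepsSE [q' [b [d [/= [[<- <- <-]|//] h2]]]] ec; first by exists n.
exact: (ih p (x :: s)).
Qed.

Definition guess_tape (p : seq C) (w : seq bool) : tape C :=
  (map (@TCell C) p, head TBlank (map (@TIn C) w), behead (map (@TIn C) w)).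

Lemma steps_guess p w k s : map cin s = map Some w ++ nseq k None ->
  steps (size s).+1 (cfg None (guess_tape p w)) (cfg (Some None) (back_tape (catrev s p) [::])).
Proof.
elim: s w p k => [|c s ih] [|b w] p k hs; rewrite /guess_tape.
- by apply: stepsS; [left|].
- by [].
- have [ec es] : cin c = None /\ map cin s = nseq k.-1 None by case: k hs => //= k [].
  apply: (@stepsS _ None _ _ _ _ _ (TCell c) DR); last exact: (ih [::] (c :: p) _ es).
  by right; apply/lmem_map; exists c => //; rewrite mem_filter ec eqxx mem_enum.
have [ec es] : cin c = Some b /\ map cin s = map Some w ++ nseq k None by case: hs.
apply: (@stepsS _ None _ _ _ _ _ (TCell c) DR); last exact: (ih w (c :: p) k es).
by apply/lmem_map; exists c => //; rewrite mem_filter ec eqxx mem_enum.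
Qed.

Lemma guess_steps n p w e : steps n (cfg None (guess_tape p w)) e ->
  e.1.1.1 = acc ntm -> exists n' s k, map cin s = map Some w ++ nseq k None /\
  steps n' (cfg (Some None) (back_tape (catrev s p) [::])) e.
Proof.
elim: n p w => [|n ih] p w; first by move=> /= E; rewrite -E.
case: w => [|b w] /stepsSE [q' [b1 [d [/= h h2]]]] ec.
  case: h => [[? ? ?]|]; first by subst; exists n, [::], 0; split.
  move=> /lmem_map [c]; rewrite mem_filter => /andP[/eqP hc _] [? ? ?]; subst.
  have [n' [s [k [h3 h4]]]] := ih (c :: p) [::] h2 ec.
  by exists n', (c :: s), k.+1; split=> //=; rewrite hc h3.
move: h => /lmem_map [c]; rewrite mem_filter => /andP[/eqP hc _] [? ? ?]; subst.
have [n' [s [k [h3 h4]]]] := ih (c :: p) w h2 ec.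
by exists n', (c :: s), k; split=> //=; rewrite hc h3.
Qed.

Lemma ntm_accepts w k s N s' : map cin s = map Some w ++ nseq k None ->
  does M s N true s' -> accepts_within ntm w ((size s).+1 + (size s).+1 + N).
Proof.
move=> hs [n [hn H]].
exists ((size s).+1 + (size s).+1 + n), (cfg (Some (Some (inr true))) (home s')).
split; first by rewrite leq_add2l.
split=> //; apply: steps_cat (steps_runs H).
apply: steps_cat (steps_guess [::] hs) _.
have -> : (size s).+1 = (size (catrev s [::])).+1 by rewrite -/(rev s) size_rev.
have := steps_back (catrev s [::]) [::].
by rewrite -/(rev s) -/(rev (rev s)) revK.
Qed.

Lemma accepts_ntm w N : accepts_within ntm w N ->
  exists s k, map cin s = map Some w ++ nseq k None /\
  exists n t, runs (M := M) n (ini M) (home s) true t.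
Proof.
move=> [n [c [_ [h ec]]]].
have [n1 [s [k [hs h1]]]] := guess_steps (p := [::]) h ec.
have [n2] := back_steps h1 ec; rewrite -/(rev s) -/(rev (rev s)) revK => h2.
by exists s, k; split=> //; exact: runs_steps h2 ec.
Qed.
End ToNTM.

Lemma leq_expnl2 a b e : a <= b -> a ^ e <= b ^ e.
Proof. by case: e => // e h; rewrite leq_exp2r. Qed.

(** Only one certificate for each word of the language has to be short: a machine that accepts has
    guessed a valid certificate, whatever its length. *)
Lemma NEXPTIME_of_certificates (C : finType) (cin : C -> option bool) (M : mach C bool)
    (P : seq C -> Prop) (L : seq bool -> Prop) (a d : nat) :
  (forall s, exists b s', does M s ((size s + 2) ^ d) b s' /\ (b <-> P s)) ->
  (forall w, L w <-> exists s k, map cin s = map Some w ++ nseq k None /\ P s) ->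
  (forall w, L w -> 0 < size w /\ exists s k, [/\ map cin s = map Some w ++ nseq k None, P s
     & size s <= 2 ^ (a * (size w) ^ a)]) ->
  NEXPTIME L.
Proof.
move=> dec LP small; pose k := a + (a + 3) * (d + 2).
exists k, (ntm cin M) => w; split; last first.
  move=> /accepts_ntm [s [j [hs [n [t R]]]]]; apply/LP; exists s, j; split=> //.
  have [b [s' [[n' [_ R']] <-]]] := dec s.
  exact: runs_det R _ _ _ R'.
move=> /small [w0 [s [j [hs Ps hB]]]].
have [b [s' [D bP]]] := dec s; have Eb : b = true by apply/bP.
rewrite Eb in D; have [n [c [hn hc]]] := ntm_accepts hs D.
exists n, c; split=> //; apply: leq_trans hn _.
set B := size s in hB *; set m := size w in hB w0 *.
(* Guessing and returning cost [B.+1] steps each; two extra factors [B + 2] absorb them. *)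
have h1 : (B.+1 + B.+1 + (B + 2) ^ d) <= (B + 2) ^ (d + 2).
  rewrite expnD expnS expn1 mulnDr muln2 -addnn.
  have : 0 < (B + 2) ^ d by rewrite expn_gt0 addn2.
  move: ((B + 2) ^ d) => x hx; nia.
apply: leq_trans h1 _.
have h2 : B + 2 <= 2 ^ (a * m ^ a + 2).
  rewrite expnD; have : 0 < 2 ^ (a * m ^ a) by rewrite expn_gt0.
  move: hB; move: (2 ^ (a * m ^ a)) => y; nia.
apply: leq_trans (leq_expnl2 _ h2) _.
rewrite -expnM leq_exp2l //.
have m1 : a * m ^ a + 2 <= (a + 2) * m.+1 ^ a.
  have : m ^ a <= m.+1 ^ a by apply: leq_expnl2.
  have : 0 < m.+1 ^ a by rewrite expn_gt0.
  move: (m ^ a) (m.+1 ^ a) => u v; nia.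
(* Since [w] is non-empty, [m.+1] is at least 2, so a power of it can absorb the constant factor. *)
have h3 : (a + 2) * (d + 2) <= m.+1 ^ ((a + 3) * (d + 2)).
  apply: leq_trans (ltnW (ltn_expl _ (isT : 1 < 2))) _.
  apply: (@leq_trans (2 ^ ((a + 3) * (d + 2)))).
    by rewrite leq_exp2l // leq_mul2r; apply/orP; right; lia.
  exact: leq_expnl2.
rewrite /k expnD; apply: leq_trans (leq_mul m1 (leqnn _)) _.
by rewrite -mulnA mulnCA leq_mul2l h3 orbT.
Qed.

(** * First-order sentences over words *)

Definition upd (e : nat -> nat) (x v : nat) : nat -> nat :=
  fun y => if eqn y x then v else e y.

Inductive bop := BAnd | BOr | BImp.
Definition bopf (o : bop) (a b : bool) :=
  match o with BAnd => a && b | BOr => a || b | BImp => a ==> b end.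
Definition bopP (o : bop) (a b : Prop) :=
  match o with BAnd => a /\ b | BOr => a \/ b | BImp => a -> b end.

Section FO.
Variables (D : finType) (d0 : D) (Kv : nat).

(* First-order formulas over the positions of a word on D; [FRead x y n K] continues with the
   letter at position n + x + y (d0 beyond the end); [FQ true] is universal, [FQ false] existential. *)
Inductive fo :=
| FB of bool
| FRead of nat & nat & nat & (D -> fo)
| FEq of nat & nat & nat & nat
| FLe of nat & nat & nat & nat
| FBin of bop & fo & fo
| FQ of bool & nat & fo.

Fixpoint holds (c : seq D) (e : nat -> nat) (f : fo) : Prop :=
  match f with
  | FB b => b
  | FRead x y n K => holds c e (K (nth d0 c (n + (e x + e y))))
  | FEq x y n z => n + (e x + e y) = e z
  | FLe x y n z => n + (e x + e y) <= e z
  | FBin o f g => bopP o (holds c e f) (holds c e g)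
  | FQ true x f => forall v, v < size c -> holds c (upd e x v) f
  | FQ false x f => exists v, v < size c /\ holds c (upd e x v) f
  end.

Fixpoint wf (L : seq nat) (f : fo) : Prop :=
  match f with
  | FB _ => True
  | FRead x y _ K => [/\ x \in L, y \in L & forall d, wf L (K d)]
  | FEq x y _ z | FLe x y _ z => [/\ x \in L, y \in L & z \in L]
  | FBin _ f g => wf L f /\ wf L g
  | FQ _ x f => [/\ x < Kv, x \notin L & wf (x :: L) f]
  end.

(** One track of marks per variable, and two scratch tracks, [Kv] and [Kv.+1], for sums of
    positions. *)
Let K := Kv.+2.
Definition marks : finType := {ffun 'I_K -> bool}.
Definition fcell : finType := (D * marks)%type.

Definition getm (m : marks) (k : nat) := [exists i : 'I_K, (val i == k) && m i].
Definition setm (m : marks) (k : nat) (b : bool) : marks :=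
  [ffun i => if val i == k then b else m i].

Lemma get_setm m k b k' : k < K -> getm (setm m k b) k' = if k' == k then b else getm m k'.
Proof.
move=> hk; apply/existsP/idP.
  move=> [i /andP[/eqP <-]]; rewrite ffunE; case: ifP => // _ h.
  by apply/existsP; exists i; rewrite eqxx.
case: eqP => [->|/eqP ne] h.
  by exists (Ordinal hk); rewrite ffunE eqxx.
case/existsP: h => i /andP[/eqP ei h]; exists i.
by rewrite ffunE ei eqxx (negbTE ne).
Qed.

Let x0 : fcell := (d0, [ffun => false]).
Definition mk (s : seq fcell) i k := getm (nth x0 s i).2 k.

Lemma foldl_take_ind (Q : Type) (nx : Q -> fcell -> Q) q0 s (I : nat -> Q -> Prop) :
  I 0 q0 -> (forall i q, i < size s -> I i q -> I i.+1 (nx q (nth x0 s i))) ->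
  forall i, i <= size s -> I i (foldl nx q0 (take i s)).
Proof.
move=> h0 hS; elim=> [|i ih] hi; first by rewrite take0.
by rewrite (take_nth x0 hi) foldl_rcons; apply: hS => //; apply: ih; apply: ltnW.
Qed.

Lemma foldl_ind_size (Q : Type) (nx : Q -> fcell -> Q) q0 s (I : nat -> Q -> Prop) :
  I 0 q0 -> (forall i q, i < size s -> I i q -> I i.+1 (nx q (nth x0 s i))) ->
  I (size s) (foldl nx q0 s).
Proof. by move=> h0 hS; rewrite -{2}(take_size s); apply: foldl_take_ind. Qed.

Definition tpass (Q : finType) (q0 : Q) (nx : Q -> fcell -> Q) : mach fcell Q :=
  pass q0 (fun q x => (nx q x, x)).
Definition wpass (u : nat) (Q : finType) (q0 : Q) (nx : Q -> fcell -> Q)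
    (wr : Q -> fcell -> bool) : mach fcell Q :=
  pass q0 (fun q x => (nx q x, (x.1, setm x.2 u (wr q x)))).

Lemma tpass_spec (Q : finType) (q0 : Q) nx s :
  does (tpass q0 nx) s ((size s).*2 + 4) (foldl nx q0 s) s.
Proof.
apply: does_pass.
by elim: s q0 => //= x s ih q; rewrite ih.
Qed.

Lemma wpass_spec u (Q : finType) (q0 : Q) nx wr s : u < K -> exists s',
  [/\ does (wpass u q0 nx wr) s ((size s).*2 + 4) (foldl nx q0 s) s',
      map fst s' = map fst s & forall i k, i < size s ->
      mk s' i k = if k == u then wr (foldl nx q0 (take i s)) (nth x0 s i) else mk s i k].
Proof.
move=> hu.
have [s' [h1 h2 h3]] : exists s', [/\ scan (fun q x => (nx q x, (x.1, setm x.2 u (wr q x)))) q0 s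
   = (foldl nx q0 s, s'),
   map fst s' = map fst s & forall i k, i < size s ->
      mk s' i k = if k == u then wr (foldl nx q0 (take i s)) (nth x0 s i) else mk s i k].
  elim: s q0 => [|x s ih] q /=; first by exists [::].
  have [s' [h1 h2 h3]] := ih (nx q x).
  exists ((x.1, setm x.2 u (wr q x)) :: s'); split; first by rewrite h1.
    by rewrite /= h2.
  by case=> [|i] k hi /=; [rewrite /mk /= get_setm | exact: h3].
by exists s'; split=> //; apply: does_pass.
Qed.

Section Word.
Variable c : seq D.
Let B := size c.
Let W := B + 2.

(** A value of [B] or more leaves its track empty; this is how sums that run past the end of the
    word are represented. *)
Definition good (L : seq nat) (e : nat -> nat) (s : seq fcell) : Prop :=
  map fst s = c /\ forall k i, k \in L -> i < B -> mk s i k = (e k == i).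

Lemma good_size L e s : good L e s -> size s = B.
Proof. by move=> [h _]; rewrite /B -h size_map. Qed.

Lemma good_sub L L' e e' s : good L e s -> {subset L' <= L} -> {in L', e =1 e'} -> good L' e' s.
Proof.
move=> [h1 h2] sub ee; split=> // k i kL hi.
by rewrite -ee // h2 // sub.
Qed.

Lemma W2 : 1 < W. Proof. by rewrite /W addn2. Qed.
(** With costs measured as powers of [W], sequential composition just adds exponents, plus one. The
    degree of the final polynomial can therefore be computed by recursion on the sentence. *)
Lemma W_bind a b : W ^ a + W ^ b <= W ^ (a + b).+1.
Proof.
have := W2; move: W => w hw; rewrite expnS expnD.
have : 0 < w ^ a by rewrite expn_gt0; lia.
have : 0 < w ^ b by rewrite expn_gt0; lia.
move: (w ^ a) (w ^ b) => x y hx hy.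
apply: leq_trans (leq_mul hw (leqnn (x * y))).
by rewrite mul2n -addnn leq_add ?leq_pmull ?leq_pmulr.
Qed.

Definition doesW (E : Type) (M : mach fcell E) s a (e : E) s' := does M s (W ^ a) e s'.

Lemma doesW_le E (M : mach fcell E) s a b e s' : a <= b -> doesW M s a e s' -> doesW M s b e s'.
Proof. by move=> h; apply: does_le; rewrite leq_exp2l // W2. Qed.

Lemma doesW_bind (E : finType) F (M : mach fcell E) (N : E -> mach fcell F) s a e s' b f s'' :
  doesW M s a e s' -> doesW (N e) s' b f s'' -> doesW (bind M N) s (a + b).+1 f s''.
Proof. by move=> h1 h2; apply: does_le (does_bind h1 h2); apply: W_bind. Qed.

Lemma doesW_ret E (e : E) s a : doesW (ret _ e) s a e s.
Proof. exact: does_ret. Qed.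

Lemma passW L e s E (M : mach fcell E) f s' : good L e s ->
  does M s ((size s).*2 + 4) f s' -> doesW M s 2 f s'.
Proof.
move=> g; apply: does_le; rewrite (good_size g) /W -muln2; nia.
Qed.

(** The index of [Inv] counts the iterations still allowed; it starts below [W], so a loop costs one
    more factor [W]. *)
Lemma doesW_loop (F : Type) (f0 : F) (M : mach fcell (option F)) a
    (Inv : nat -> seq fcell -> Prop) (post : F -> seq fcell -> Prop) :
  (forall n s, Inv n s ->
     (exists f s', doesW M s a (Some f) s' /\ post f s') \/
     (exists n' s', [/\ n = n'.+1, doesW M s a None s' & Inv n' s'])) ->
  forall n s, n < W -> Inv n s -> exists f s', doesW (loop f0 M) s a.+1 f s' /\ post f s'.
Proof.
move=> h n s hn hI.
suff [f [s' [h1 h2]]] : exists f s', does (loop f0 M) s (n.+1 * W ^ a) f s' /\ post f s'.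
  exists f, s'; split=> //; apply: does_le h1.
  by rewrite expnS leq_mul2r hn orbT.
elim: n s {hn} hI => [|n ih] s hI.
  case: (h _ _ hI) => [[f [s' [h1 h2]]]|[n' [s' [//]]]].
  by exists f, s'; split=> //; rewrite mul1n; apply: does_loop_exit.
case: (h _ _ hI) => [[f [s' [h1 h2]]]|[n' [s' [[<-] h1 /ih [f [s'' [h2 h3]]]]]]].
  exists f, s'; split=> //; apply: does_le (does_loop_exit _ h1).
  by rewrite mulSn leq_addr.
by exists f, s''; split=> //; rewrite mulSn; apply: does_loop_next h1 h2.
Qed.

Definition mcopy u x := wpass u tt (fun q _ => q) (fun _ y => getm y.2 x).
Definition mset0 u := wpass u true (fun _ _ => false) (fun q _ => q).
(** Writing into each cell the mark of the previous one shifts the mark to the right; the final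
    state tells whether it has just fallen off the end. *)
Definition minc u := wpass u false (fun _ y => getm y.2 u) (fun q _ => q).
Definition msame u v := tpass false (fun q y => q || (getm y.2 u && getm y.2 v)).
Definition mle u v := tpass (false, false)
  (fun q y => let a := q.1 || getm y.2 u in (a, q.2 || (a && getm y.2 v))).
Definition mread u := tpass d0 (fun q y => if getm y.2 u then y.1 else q).

Lemma updE e x v y : upd e x v y = if y == x then v else e y.
Proof. by []. Qed.

Lemma mcopyP L e s u x : u < K -> x \in L -> good L e s ->
  exists s', doesW (mcopy u x) s 2 tt s' /\ good (u :: L) (upd e u (e x)) s'.
Proof.
move=> hu hx g; have [s' [h1 h2 h3]] := wpass_spec tt (fun q _ => q) (fun _ y => getm y.2 x) s hu.
exists s'; split; first by apply: (passW g); case: (foldl _ _ _) h1.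
move: (g) => [g1 g2]; split; first by rewrite h2.
move=> k i; rewrite inE updE => hk hi; rewrite h3 ?(good_size g) //.
by case: eqP hk => [_ _|_ /= kL]; rewrite -?/(mk s i x) g2.
Qed.

Lemma mset0P L e s u : u < K -> good L e s ->
  exists b s', doesW (mset0 u) s 2 b s' /\ good (u :: L) (upd e u 0) s'.
Proof.
move=> hu g; have [s' [h1 h2 h3]] := wpass_spec true (fun _ _ => false) (fun q _ => q) s hu.
eexists; exists s'; split; first exact: (passW g) h1.
move: (g) => [g1 g2]; split; first by rewrite h2.
move=> k i; rewrite inE updE => hk hi; rewrite h3 ?(good_size g) //.
case: eqP hk => [_ _|_ /= kL]; last by rewrite g2.
have hi' : i <= size s by rewrite (good_size g) ltnW.
exact: (@foldl_take_ind _ _ _ _ (fun i q => q = (0 == i))).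
Qed.

Lemma mincP L e s u : u < K -> u \in L -> 0 < B -> good L e s ->
  exists s', doesW (minc u) s 2 ((e u).+1 == B) s' /\ good L (upd e u (e u).+1) s'.
Proof.
move=> hu uL B0 g.
have [s' [h1 h2 h3]] := wpass_spec false (fun _ y => getm y.2 u) (fun q _ => q) s hu.
move: (g) => [g1 g2]; have sB := good_size g.
have H i : i <= size s -> foldl (fun _ y => getm y.2 u) false (take i s) = ((e u).+1 == i).
  apply: (@foldl_take_ind _ _ _ _ (fun i q => q = ((e u).+1 == i))) => // {}i q hi _.
  by rewrite -/(mk s i u) g2 // -sB.
exists s'; split.
  by apply: (passW g); rewrite -sB -H // take_size.
split; first by rewrite h2.
move=> k i kL hi; rewrite h3 ?sB // updE.
by case: eqP => [_|_]; [rewrite H // sB ltnW | rewrite g2].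
Qed.

(** Two tracks can meet in a cell only if their common value lies inside the word, hence the bound
    on [e v]. *)
Lemma msameP L e s u v : u \in L -> v \in L -> e v < B -> good L e s ->
  doesW (msame u v) s 2 (e u == e v) s.
Proof.
move=> uL vL hv g; apply: (passW g).
move: (g) => [g1 g2]; have sB := good_size g.
have -> : (e u == e v) = foldl (fun q y => q || (getm y.2 u && getm y.2 v)) false s.
  rewrite (_ : (e u == e v) = (e u == e v) && (e v < size s)); last by rewrite sB hv andbT.
  apply: (@foldl_ind_size _ _ _ _ (fun i q => (e u == e v) && (e v < i) = q)).
    by rewrite ltn0 andbF.
  move=> i q hi <-; rewrite -/(mk s i u) -/(mk s i v) !g2 -?sB //.
  by rewrite ltnS leq_eqVlt; case: (ltngtP (e v) i) => h; case: (ltngtP (e u) (e v)) => h';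
    rewrite ?andbF ?andbT ?orbF //; lia.
exact: tpass_spec.
Qed.

Lemma mleP L e s u v : u \in L -> v \in L -> e v < B -> good L e s ->
  exists q, doesW (mle u v) s 2 (q, e u <= e v) s.
Proof.
move=> uL vL hv g; exists (e u < B).
move: (g) => [g1 g2]; have sB := good_size g; apply: (passW g).
have -> : (e u < B, e u <= e v) = foldl (fun q y => let a := q.1 || getm y.2 u in (a, q.2 || (a && getm y.2 v))) (false, false) s.
  rewrite (_ : (e u <= e v) = (e u <= e v) && (e v < size s)); last by rewrite sB hv andbT.
  rewrite -sB.
  apply: (@foldl_ind_size _ _ _ _ (fun i q => (e u < i, (e u <= e v) && (e v < i)) = q)).
    by rewrite !ltn0 andbF.
  move=> i q hi <- /=; rewrite -/(mk s i u) -/(mk s i v) !g2 -?sB //.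
  by congr (_, _); lia.
exact: tpass_spec.
Qed.

Lemma mreadP L e s u : u \in L -> good L e s -> doesW (mread u) s 2 (nth d0 c (e u)) s.
Proof.
move=> uL g; move: (g) => [g1 g2]; have sB := good_size g; apply: (passW g).
have -> : nth d0 c (e u) = foldl (fun q y => if getm y.2 u then y.1 else q) d0 s.
  have : (if e u < size s then nth d0 c (e u) else d0) =
    foldl (fun q y => if getm y.2 u then y.1 else q) d0 s.
    apply: (@foldl_ind_size _ _ _ _ (fun i q => (if e u < i then nth d0 c (e u) else d0) = q)) => //.
    move=> i q hi <- /=; rewrite -/(mk s i u) g2 -?sB //.
    rewrite ltnS leq_eqVlt; case: eqP => [->|_] //=.
    by rewrite -g1 (nth_map x0).
  by case: ltnP => // h <-; rewrite nth_default // -/B -sB.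
exact: tpass_spec.
Qed.

Lemma good_eq L e e' s : good L e s -> {in L, e =1 e'} -> good L e' s.
Proof. by move=> g h; apply: good_sub g _ h. Qed.

Let u := Kv.
Let v := Kv.+1.
Lemma uK : u < K. Proof. by rewrite /u /K; lia. Qed.
Lemma vK : v < K. Proof. by rewrite /v /K; lia. Qed.

Definition msum_body y : mach fcell (option unit) :=
  bind (msame v y) (fun b => if b then ret _ (Some tt) else
    bind (minc v) (fun _ => bind (minc u) (fun _ => ret _ None))).
Fixpoint mincs n : mach fcell unit :=
  if n is n'.+1 then bind (minc u) (fun _ => mincs n') else ret _ tt.
Definition msum x y n : mach fcell unit :=
  bind (mcopy u x) (fun _ => bind (mset0 v) (fun _ =>
    bind (loop tt (msum_body y)) (fun _ => mincs n))).

Definition fresh_uv (L : seq nat) := (u \notin L) && (v \notin L).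

Lemma mincsP L e s n : u \in L -> 0 < B -> good L e s ->
  exists s', doesW (mincs n) s (n * 3) tt s' /\ good L (upd e u (e u + n)) s'.
Proof.
move=> uL B0; elim: n e s => [|n ih] e s g /=.
  exists s; split; first exact: doesW_ret.
  by apply: good_eq g _ => k kL; rewrite updE addn0; case: eqP => [->|].
have [s' [h1 g1]] := mincP uK uL B0 g; have [s'' [h2 g2]] := ih _ _ g1.
exists s''; split; first exact: doesW_bind h1 h2.
apply: good_eq g2 _ => k kL; rewrite !updE eqxx addSnnS.
by case: eqP.
Qed.

Lemma msumP L e s x y n : fresh_uv L -> x \in L -> y \in L -> e y < B -> good L e s ->
  exists s', doesW (msum x y n) s (n * 3 + 20) tt s' /\
    good (u :: L) (upd e u (n + (e x + e y))) s'.
Proof.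
rewrite [n + (_ + _)]addnC; move=> /andP[uL vL] xL yL hy g.
have B0 : 0 < B by apply: leq_trans hy.
have neq k : k \in L -> (k == u = false) * (k == v = false).
  by move=> kL; split; apply/eqP => ek; move: uL vL; rewrite -ek kL.
have uv : (v == u) = false by rewrite /u /v; lia.
have vu : (u == v) = false by rewrite eq_sym.
have [s1 [h1 g1]] := mcopyP uK xL g.
have [b [s2 [h2 g2]]] := mset0P vK g1.
(* [u] runs upwards from [e x] while [v] counts from 0 to [e y]; [m] increments are still to
   come. *)
pose Inv m s := exists j, j + m = e y /\
  good [:: v, u & L] (upd (upd e u (e x + j)) v j) s.
pose post (_ : unit) s := good [:: v, u & L] (upd (upd e u (e x + e y)) v (e y)) s.
have I0 : Inv (e y) s2.
  exists 0; split=> //; apply: good_eq g2 _ => k _; by rewrite !updE addn0.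
have step m t : Inv m t ->
     (exists f s', doesW (msum_body y) t 10 (Some f) s' /\ post f s') \/
     (exists n' s', [/\ m = n'.+1, doesW (msum_body y) t 10 None s' & Inv n' s']).
  move=> [j [hj gj]].
  have S := @msameP [:: v, u & L] _ t v y _ _ _ gj.
  have {S} := S _ _ _; rewrite !updE eqxx (neq y yL).1 (neq y yL).2 !inE eqxx yL !orbT.
  move=> /(_ isT isT hy) S.
  case: eqP S => [ej|nej] S.
    left; exists tt, t; split; last by rewrite /post -ej.
    by apply: (@doesW_le _ _ _ (2 + 0).+1) => //; apply: doesW_bind S _; exact: doesW_ret.
  right; case: m hj => [|m] hj; first by case: nej; rewrite -hj addn0.
  have [s3 [h3 g3]] := mincP vK (mem_head v (u :: L)) B0 gj.
  have uin : u \in [:: v, u & L] by rewrite !inE eqxx orbT.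
  have [s4 [h4 g4]] := mincP uK uin B0 g3.
  exists m, s4; split=> //.
    apply: (@doesW_le _ _ _ (2 + (2 + (2 + 0).+1).+1).+1) => //.
    apply: doesW_bind S _; apply: doesW_bind h3 _; apply: doesW_bind h4 _; exact: doesW_ret.
  exists j.+1; split; first by rewrite -hj addSnnS.
  apply: good_eq g4 _ => k; rewrite !inE !updE !eqxx vu.
  by case: (eqVneq k v) => [->|nv]; rewrite ?uv ?vu //=; case: (eqVneq k u) => [->|nu]; rewrite ?uv ?addnS.
have hW : e y < W by rewrite /W; lia.
have [[] [s3 [h3 g3]]] := doesW_loop tt step hW I0.
have uin : u \in [:: v, u & L] by rewrite !inE eqxx orbT.
have [s4 [h4 g4]] := mincsP n uin B0 g3.
exists s4; split.
  apply: (@doesW_le _ _ _ (2 + (2 + (11 + n * 3).+1).+1).+1); first lia.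
  by apply: doesW_bind h1 _; apply: doesW_bind h2 _; apply: doesW_bind h3 _.
apply: good_sub g4 _ _ => k; rewrite !inE; first by case/orP => ->; rewrite ?orbT.
by rewrite !updE eqxx vu; case: (eqVneq k u) => [->|nu] //= kL; rewrite (neq k kL).2.
Qed.
End Word.

(** * Compilation of first-order sentences into machines *)

Fixpoint kexp (f : fo) : nat :=
  match f with
  | FB _ => 0
  | FRead _ _ n F => n * 3 + 30 + \max_(d : D) kexp (F d)
  | FEq _ _ n _ | FLe _ _ n _ => n * 3 + 30
  | FBin _ f g => kexp f + kexp g + 3
  | FQ _ _ f => kexp f + 20
  end.

(** [q] is the verdict when no position decides: true for a universal quantifier, false for an
    existential one. The first position with the other verdict ends the search. The body runs before
    the end of the word is tested, so the word must be non-empty. *)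
Definition mQ (q : bool) x (M : mach fcell bool) : mach fcell bool :=
  bind (mset0 x) (fun _ => loop q
    (bind M (fun b => if b == q then
         bind (minc x) (fun o => ret _ (if o then Some q else None))
       else ret _ (Some (~~ q))))).

Fixpoint comp (f : fo) : mach fcell bool :=
  match f with
  | FB b => ret _ b
  | FRead x y n F => bind (msum x y n) (fun _ => bind (mread Kv) (fun d => comp (F d)))
  | FEq x y n z => bind (msum x y n) (fun _ => msame Kv z)
  | FLe x y n z => bind (msum x y n) (fun _ => bind (mle Kv z) (fun q => ret _ q.2))
  | FBin o f g => bind (comp f) (fun b => bind (comp g) (fun b' => ret _ (bopf o b b')))
  | FQ q x f => mQ q x (comp f)
  end.

Lemma bopPf o (a b : bool) A B : (a <-> A) -> (b <-> B) -> (bopf o a b <-> bopP o A B).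
Proof.
move=> [h1 h2] [h3 h4]; case: o => /=.
- by split=> [/andP[/h1 ? /h3]|[/h2 -> /h4 ->]].
- by split=> [/orP[/h1|/h3]|[/h2 ->|/h4 ->]]; rewrite ?orbT //; [left|right].
- by split=> [/implyP h /h2 /h /h3|h] //; apply/implyP => /h1 /h /h4.
Qed.

(** Variables lie below [Kv], so the scratch tracks are outside [L]: each operation may spoil them
    and still re-establish [good c L e]. *)
Lemma compP c f : forall L e s, wf L f -> {in L, forall k, k < Kv} ->
  {in L, forall k, e k < size c} -> 0 < size c -> good c L e s ->
  exists b s', [/\ doesW c (comp f) s (kexp f) b s', good c L e s' & b <-> holds c e f].
Proof.
have fr (L : seq nat) : {in L, forall k, k < Kv} -> fresh_uv L.
  by move=> h; apply/andP; split; apply/negP => /h; rewrite ?ltnn // ltnNge leqnSn.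
have back (L : seq nat) (e : nat -> nat) s w : {in L, forall k, k < Kv} -> good c (Kv :: L) (upd e Kv w) s -> good c L e s.
  move=> h g; apply: good_sub g _ _ => [k kL|k kL]; first by rewrite inE kL orbT.
  by rewrite updE; case: eqP => // ek; move: (h _ kL); rewrite ek ltnn.
have out (L : seq nat) (k : nat) : {in L, forall k, k < Kv} -> k \in L -> (k == Kv) = false.
  by move=> h /h; case: eqP => // ->; rewrite ltnn.
elim: f => [b|x y n F ih|x y n z|x y n z|o f ihf g ihg|q x f ih] L e s /=.
- by move=> _ _ _ _ g; exists b, s; split=> //; exact: doesW_ret.
- move=> [xL yL wF] LK Le c0 g.
  have [s1 [h1 g1]] := msumP n (fr _ LK) xL yL (Le _ yL) g.
  have := mreadP (mem_head _ _) g1; rewrite updE eqxx => h2.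
  have [b [s2 [h3 g3 hb]]] := ih (nth d0 c (n + (e x + e y))) L e s1 (wF _) LK Le c0 (back _ _ _ _ LK g1).
  exists b, s2; split=> //.
  apply: doesW_le; last (apply: doesW_bind h1 _; apply: doesW_bind h2 _; exact: h3).
  have : kexp (F (nth d0 c (n + (e x + e y)))) <= \max_(d : D) kexp (F d).
    exact: (leq_bigmax (F := fun d => kexp (F d))).
  lia.
- move=> [xL yL zL] LK Le c0 g.
  have [s1 [h1 g1]] := msumP n (fr _ LK) xL yL (Le _ yL) g.
  have zL' : z \in Kv :: L by rewrite inE zL orbT.
  have := @msameP _ _ _ _ _ _ (mem_head _ _) zL' _ g1.
  rewrite !updE eqxx (out L z LK zL) => /(_ (Le _ zL)) h2.
  exists (n + (e x + e y) == e z), s1; split; [|exact: back g1|by split=> /eqP].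
  by apply: doesW_le; last (apply: doesW_bind h1 _; exact: h2); lia.
- move=> [xL yL zL] LK Le c0 g.
  have [s1 [h1 g1]] := msumP n (fr _ LK) xL yL (Le _ yL) g.
  have zL' : z \in Kv :: L by rewrite inE zL orbT.
  have := @mleP _ _ _ _ _ _ (mem_head _ _) zL' _ g1.
  rewrite !updE eqxx (out L z LK zL) => /(_ (Le _ zL)) [q h2].
  exists (n + (e x + e y) <= e z), s1; split; [|exact: back g1|by []].
  apply: (@doesW_le _ _ _ _ _ _ _ _ _ _); last (apply: doesW_bind h1 _; apply: doesW_bind h2 _; exact: (doesW_ret _ _ _ 0)); lia.
- move=> [wf1 wg] LK Le c0 g0.
  have [b [s1 [h1 g1 hb]]] := ihf L e s wf1 LK Le c0 g0.
  have [b' [s2 [h2 g2 hb']]] := ihg L e s1 wg LK Le c0 g1.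
  exists (bopf o b b'), s2; split=> //; last exact: bopPf.
  apply: (@doesW_le _ _ _ _ _ _ _ _ _ _); last (apply: doesW_bind h1 _; apply: doesW_bind h2 _; exact: (doesW_ret _ _ _ 0)); lia.
move=> [xK xL wF] LK Le c0 g.
have xK2 : x < K by rewrite /K; lia.
have [b0 [s1 [h1 g1]]] := mset0P xK2 g.
(* All positions before [j] have returned [q], and [m] positions remain after [j]. *)
pose Inv m s := exists j, [/\ j + m.+1 = size c, good c (x :: L) (upd e x j) s &
   forall i, i < j -> if q then holds c (upd e x i) f else ~ holds c (upd e x i) f].
pose post (b : bool) s := good c L e s /\ (b <-> holds c e (FQ q x f)).
have bk s' j : good c (x :: L) (upd e x j) s' -> good c L e s'.
  move=> g'; apply: good_sub g' _ _ => [k kL|k kL]; first by rewrite inE kL orbT.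
  by rewrite updE; case: eqP => // ek; move: xL; rewrite -ek kL.
have step m t : Inv m t ->
   (exists b s', doesW c (bind (comp f) (fun b => if b == q then
         bind (minc x) (fun o => ret _ (if o then Some q else None))
       else ret _ (Some (~~ q)))) t (kexp f + 6) (Some b) s' /\ post b s') \/
   (exists n' s', [/\ m = n'.+1, doesW c (bind (comp f) (fun b => if b == q then
         bind (minc x) (fun o => ret _ (if o then Some q else None))
       else ret _ (Some (~~ q)))) t (kexp f + 6) None s' & Inv n' s']).
  move=> [j [hj gj H]].
  have LK' : {in x :: L, forall k, k < Kv} by move=> k; rewrite inE => /orP[/eqP->|/LK].
  have Le' : {in x :: L, forall k, upd e x j k < size c}.
    by move=> k; rewrite inE updE; case: eqP => [_ _|_ /Le //]; lia.
  have [b [s2 [h2 g2 hb]]] := ih _ _ _ wF LK' Le' c0 gj.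
  case: (eqVneq b q) => [eb|nb]; last first.
    left; exists (~~ q), s2; split.
      apply: (@doesW_le _ _ _ _ (kexp f + 0).+1); first by lia.
      by apply: doesW_bind h2 _; rewrite (negbTE nb); exact: doesW_ret.
    split; first exact: bk g2.
    move: nb hb; rewrite /=; case: (q) => /=.
      case: b {h2} => // _ [_ hb]; split=> // /(_ j) hq; apply/negP/negP; apply: hb; apply: hq; lia.
    by case: b {h2} => // _ [hb _]; split=> // _; exists j; split; [lia | exact: hb].
  have [s3 [h3 g3]] := mincP xK2 (mem_head _ _) c0 g2.
  have H' i : i < j.+1 -> if q then holds c (upd e x i) f else ~ holds c (upd e x i) f.
    rewrite ltnS leq_eqVlt => /orP[/eqP ->|/H //].
    by rewrite eb in hb; case: (q) hb => -[hb1 hb2]; [apply: hb1|move/hb2].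
  rewrite updE eqxx in h3.
  have g3' : good c (x :: L) (upd e x j.+1) s3.
    by apply: good_eq g3 _ => k _; rewrite !updE eqxx; case: eqP.
  have D3 : doesW c (bind (comp f) (fun b => if b == q then
         bind (minc x) (fun o => ret _ (if o then Some q else None))
       else ret _ (Some (~~ q)))) t (kexp f + 6) (if j.+1 == size c then Some q else None) s3.
    apply: (@doesW_le _ _ _ _ (kexp f + (2 + 0).+1).+1); first by lia.
    apply: doesW_bind h2 _; rewrite eb eqxx; apply: doesW_bind h3 _; exact: doesW_ret.
  case: m hj => [|m] hj.
    left; exists q, s3; split; first by move: D3; rewrite -hj addn1 eqxx.
    split; first exact: bk g3'.
    move: H'; rewrite /=; case: (q) => H'.
      by split=> // _ i hi; apply: H'; rewrite -hj in hi; lia.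
    by split=> // -[i [hi /H']]; case; rewrite -hj in hi; lia.
  right; exists m, s3; split=> //; first by move: D3; case: eqP => // ?; lia.
  by exists j.+1; split=> //; lia.
have I0 : Inv (size c).-1 s1 by exists 0; split=> //; rewrite prednK.
have hW : (size c).-1 < size c + 2 by lia.
have [b [s2 [h2 [g2 hb]]]] := doesW_loop q step hW I0.
exists b, s2; split=> //.
by apply: (@doesW_le _ _ _ _ (2 + (kexp f + 6).+1).+1); [lia | apply: doesW_bind h1 h2].
Qed.

(** On the empty word a quantifier loop would still evaluate its body once, so emptiness is tested
    first and rejected. *)
Definition mne : mach fcell bool := tpass false (fun _ _ => true).

Lemma comp_decides (f : fo) : wf [::] f -> forall s, exists b s',
  does (bind mne (fun b => if b then comp f else ret _ false)) s ((size s + 2) ^ (kexp f + 3)) b s'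
  /\ (b <-> map fst s <> [::] /\ holds (map fst s) (fun _ => 0) f).
Proof.
move=> wff s; set c := map fst s.
have g : good c [::] (fun _ => 0) s by split.
have sc : size c = size s by rewrite size_map.
have h1 : doesW c mne s 2 (0 < size s) s.
  apply: (passW g); have -> : (0 < size s) = foldl (fun _ _ => true) false s.
    by elim: (s) => //= x s'; case: s' => //= y s''.
  exact: tpass_spec.
rewrite -sc -/(doesW c _ _ _) in h1 *.
case: (posnP (size c)) h1 => [c0|c0] h1.
  exists false, s; split.
    apply: (@doesW_le c _ _ _ (2 + 0).+1); first lia.
    by apply: doesW_bind h1 _; exact: doesW_ret.
  by split=> // -[]; case; apply: size0nil.
have [b [s' [h2 _ hb]]] := @compP c f [::] (fun _ => 0) s wff (fun k => ltac:(by [])) (fun k => ltac:(by [])) c0 g.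
exists b, s'; split.
  apply: (@doesW_le c _ _ _ (2 + kexp f).+1); first lia.
  by apply: doesW_bind h1 _.
rewrite hb; split=> [h|[]//]; split=> // c1.
by move: c0; rewrite c1.
Qed.
End FO.

Theorem NEXPTIME_of_fo (D : finType) (d0 : D) (Kv : nat) (din : D -> option bool) (f : fo D)
    (L : seq bool -> Prop) (a : nat) :
  wf Kv [::] f ->
  (forall w, L w <-> exists c k, [/\ map din c = map Some w ++ nseq k None, c <> [::] &
     holds d0 c (fun _ => 0) f]) ->
  (forall w, L w -> 0 < size w /\ exists c k, [/\ map din c = map Some w ++ nseq k None,
     holds d0 c (fun _ => 0) f & size c <= 2 ^ (a * (size w) ^ a)]) ->
  NEXPTIME L.
Proof.
move=> wff LP small.
pose lift (c : seq D) : seq (fcell D Kv) := [seq (d, [ffun => false]) | d <- c].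
have liftK c : map fst (lift c) = c by rewrite -map_comp map_id_in.
have lift_in c : map (fun x : fcell D Kv => din x.1) (lift c) = map din c by rewrite -map_comp.
apply: (NEXPTIME_of_certificates (C := fcell D Kv) (cin := fun x => din x.1) (a := a)
  (comp_decides d0 wff)) => [w|w /small [w0 [c [k [h1 h2 h3]]]]].
  rewrite LP; split.
    move=> [c [k [h1 h2 h3]]]; exists (lift c), k.
    by rewrite lift_in liftK.
  move=> [s [k [h1 [h2 h3]]]]; exists (map fst s), k; split=> //.
  by rewrite -map_comp.
split=> //; exists (lift c), k; rewrite lift_in liftK size_map; split=> //; split=> //.
by move=> c0; move: h1; rewrite c0; case: (w) w0.
Qed.

(** * Truth values and statuses *)

(* Worlds: [true] is the there-world, [false] the here-world. *)
Definition tr (H T : trace) (w : bool) : trace := if w then T else H.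

(* HT value of a Boolean combination whose leaves (atoms and modalities) have the values [lf]. *)
Fixpoint ev (lf : bool -> form -> bool) (w : bool) (g : form) : bool :=
  match g with
  | Bot => false
  | Or a b => ev lf w a || ev lf w b
  | And a b => ev lf w a && ev lf w b
  | Imp a b => (ev lf w a ==> ev lf w b) && (ev lf true a ==> ev lf true b)
  | _ => lf w g
  end.

Definition lf1 (H T : trace) (i : nat) (w : bool) (g : form) : bool :=
  if g is Atom p then tr H T w i p else false.

Definition updA (s : bool * bool) (a : bool) := if s.1 then s else (true, a).
Definition updX (s : bool * bool) (a : bool) :=
  if s.1 then s else if s.2 then (true, a) else (false, true).
(** While the status is undecided, its second component is the value the modality has if no decision
    ever comes: false for Until, true for Release. The value is thus eventually correct in either
    case. *)
Definition updU (s : bool * bool) (a b : bool) :=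
  if s.1 then s else if b then (true, true) else if a then (false, false) else (true, false).
Definition updR (s : bool * bool) (a b : bool) :=
  if s.1 then s else if b then (if a then (true, true) else (false, true)) else (true, false).

(* Status (decided?, current value) of a leaf evaluated at position 0 after reading a prefix; an
   undecided [Next] has status (false, false) before position 0 and (false, true) before position 1. *)
Definition updL (lf : bool -> form -> bool) (w : bool) (g : form) (s : bool * bool) :=
  match g with
  | Atom p => updA s (lf w (Atom p))
  | Next a => updX s (ev lf w a)
  | Until a b => updU s (ev lf w a) (ev lf w b)
  | Release a b => updR s (ev lf w a) (ev lf w b)
  | _ => s
  end.

Fixpoint stt (H T : trace) (w : bool) (g : form) (i : nat) : bool * bool :=
  if i is i'.+1 then updL (lf1 H T i') w g (stt H T w g i') else (false, false).

Definition lf0 (H T : trace) (i : nat) (w : bool) (g : form) : bool := (stt H T w g i.+1).2.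

Lemma theight_max a b n : maxn a b <= n -> a <= n /\ b <= n.
Proof. by rewrite geq_max => /andP. Qed.

Lemma tr_true H T : tr H T true = T. Proof. by []. Qed.

Lemma sat_ev H T i w g : theight g = 0 -> sat (tr H T w) T i g <-> ev (lf1 H T i) w g.
Proof.
elim: g w => //= [a iha b ihb|a iha b ihb|a iha b ihb] w /eqP;
  rewrite -leqn0 => /theight_max[]; rewrite !leqn0 => /eqP ha /eqP hb.
- by rewrite iha // ihb //; split=> [[->|->]|/orP//]; rewrite ?orbT.
- by rewrite iha // ihb //; split=> [[-> ->]|/andP//].
rewrite iha // ihb // (iha true) // (ihb true) //; split.
  by move=> [h1 h2]; apply/andP; split; apply/implyP.
by case/andP => /implyP h1 /implyP h2.
Qed.

Section Limits.
Variables H T : trace.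

Lemma stt_atom w p i : stt H T w (Atom p) i.+1 = (true, tr H T w 0 p).
Proof. by elim: i => //= i ->. Qed.

Lemma stt_next w a i : stt H T w (Next a) i.+2 = (true, ev (lf1 H T 1) w a).
Proof. by elim: i => //= i ->. Qed.

Lemma stt_until w a b i : theight (Until a b) <= 1 ->
  if (stt H T w (Until a b) i).1 then (stt H T w (Until a b) i).2 <-> sat (tr H T w) T 0 (Until a b)
  else (stt H T w (Until a b) i).2 = false /\
       forall k, k < i -> ev (lf1 H T k) w a /\ ~~ ev (lf1 H T k) w b.
Proof.
rewrite /= ltnS => /theight_max[]; rewrite !leqn0 => /eqP ha /eqP hb.
elim: i => [|i] //=; set s := stt _ _ _ _ i; rewrite /updU.
case hd: s.1; first by rewrite hd.
move=> [hw h].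
case eb: (ev _ w b) => /=.
  split=> // _; exists i; split=> //; split; first by apply/sat_ev.
  by move=> k _ /h[? _]; apply/sat_ev.
case ea: (ev _ w a) => /=.
  split=> // k; rewrite ltnS leq_eqVlt => /orP[/eqP ->|/h//]; by rewrite ea eb.
split=> // -[j [_ [/(sat_ev H T j w hb) hj hk]]].
case: (ltngtP j i) => [/h|ij|ij]; first by rewrite hj => -[].
  by have /(sat_ev H T i w ha) := hk i isT ij; rewrite ea.
by rewrite ij eb in hj.
Qed.

(** The undecided value is [0 < i] because all statuses start as [(false, false)]; Release takes its
    default value true only with the first letter. *)
Lemma stt_release w a b i : theight (Release a b) <= 1 ->
  if (stt H T w (Release a b) i).1 then (stt H T w (Release a b) i).2 <-> sat (tr H T w) T 0 (Release a b)
  else (stt H T w (Release a b) i).2 = (0 < i) /\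
       forall k, k < i -> ~~ ev (lf1 H T k) w a /\ ev (lf1 H T k) w b.
Proof.
rewrite /= ltnS => /theight_max[]; rewrite !leqn0 => /eqP ha /eqP hb.
elim: i => [|i] //=; set s := stt _ _ _ _ i; rewrite /updR.
case hd: s.1; first by rewrite hd.
move=> [hw h].
case eb: (ev _ w b) => /=; last first.
  split=> // /(_ i isT) [/(sat_ev H T i w hb)|[k [_ [/h hk /(sat_ev H T k w ha)]]]]; first by rewrite eb.
  by case: hk => /negbTE ->.
case ea: (ev _ w a) => /=.
  split=> // _ j _; case: (leqP j i) => ij.
    left; apply/(sat_ev H T j w hb); move: ij; rewrite leq_eqVlt => /orP[/eqP ->|/h[]] //.
  by right; exists i; split=> //; split=> //; apply/sat_ev.
by split=> // k; rewrite ltnS leq_eqVlt => /orP[/eqP ->|/h//]; rewrite ea eb.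
Qed.

Definition is_leaf (g : form) :=
  match g with Atom _ | Next _ | Until _ _ | Release _ _ => true | _ => false end.

(** Whether a modality is ever decided is settled classically, so [i0] is not effective. A never
    decided Until has no witness; a never decided Release has its right argument everywhere. *)
Lemma stt_limit w g : is_leaf g -> theight g <= 1 -> exists i0, forall i, i0 <= i ->
  (stt H T w g i).2 <-> sat (tr H T w) T 0 g.
Proof.
case: g => //= [p _ _|a _|a b _ hg|a b _ hg].
- by exists 1; case=> // i _; rewrite stt_atom.
- rewrite ltnS leqn0 => /eqP ha.
  by exists 2; case=> // -[] // i _; rewrite stt_next sat_ev.
- case: (classic (exists i1, (stt H T w (Until a b) i1).1)) => [[i1 h1]|nh].
    exists i1 => i hi.
    have -> : stt H T w (Until a b) i = stt H T w (Until a b) i1.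
      elim: i hi => [|i ih]; first by rewrite leqn0 => /eqP ->.
      rewrite leq_eqVlt => /orP[/eqP ->//|/ih /= ->].
      by rewrite {1}/updU h1.
    by have := stt_until w i1 hg; rewrite h1.
  have nd i : (stt H T w (Until a b) i).1 = false by apply/negP => h; apply: nh; exists i.
  exists 0 => i _; have := stt_until w i hg; rewrite nd => -[-> _].
  split=> // -[j [_ [/(sat_ev H T j w) hb _]]].
  have := stt_until w j.+1 hg; rewrite nd => -[_ /(_ j (ltnSn j))].
  by move: hg; rewrite /= ltnS => /theight_max[_]; rewrite leqn0 => /eqP /hb -> [].
case: (classic (exists i1, (stt H T w (Release a b) i1).1)) => [[i1 h1]|nh].
  exists i1 => i hi.
  have -> : stt H T w (Release a b) i = stt H T w (Release a b) i1.
    elim: i hi => [|i ih]; first by rewrite leqn0 => /eqP ->.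
    rewrite leq_eqVlt => /orP[/eqP ->//|/ih /= ->].
    by rewrite {1}/updR h1.
  by have := stt_release w i1 hg; rewrite h1.
have nd i : (stt H T w (Release a b) i).1 = false by apply/negP => h; apply: nh; exists i.
exists 1; case=> // i _; have := stt_release w i.+1 hg; rewrite nd => -[-> _].
split=> // _ j _; left.
have := stt_release w j.+1 hg; rewrite nd => -[_ /(_ j (ltnSn j))] [_].
by move: hg; rewrite /= ltnS => /theight_max[_]; rewrite leqn0 => /eqP hb; rewrite sat_ev.
Qed.

Lemma ev_limit g : theight g <= 1 -> exists i0, forall i w, i0 <= i ->
  ev (lf0 H T i) w g <-> sat (tr H T w) T 0 g.
Proof.
have leaf l : is_leaf l -> theight l <= 1 -> exists i0, forall i w, i0 <= i ->
  ev (lf0 H T i) w l <-> sat (tr H T w) T 0 l.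
  move=> lg hg; have [i1 h1] := stt_limit true lg hg; have [i2 h2] := stt_limit false lg hg.
  exists (maxn i1 i2) => i w; rewrite geq_max => /andP[l1 l2].
  have -> : ev (lf0 H T i) w l = (stt H T w l i.+1).2 by case: l lg {hg h1 h2}.
  by case: w; [apply: h1 | apply: h2]; lia.
elim: g => [p|_|a iha b ihb|a iha b ihb|a iha b ihb|a _|a _ b _|a _ b _]; try exact: leaf.
- by exists 0.
- move=> /= /theight_max[/iha[i1 h1] /ihb[i2 h2]]; exists (maxn i1 i2) => i w.
  rewrite geq_max => /andP[l1 l2]; rewrite -(h1 i w l1) -(h2 i w l2).
  by split=> [/orP//|[->|->]]; rewrite ?orbT.
- move=> /= /theight_max[/iha[i1 h1] /ihb[i2 h2]]; exists (maxn i1 i2) => i w.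
  rewrite geq_max => /andP[l1 l2]; rewrite -(h1 i w l1) -(h2 i w l2).
  by split=> [/andP//|[-> ->]].
move=> /= /theight_max[/iha[i1 h1] /ihb[i2 h2]]; exists (maxn i1 i2) => i w.
rewrite geq_max => /andP[l1 l2].
have := h1 i true l1; have := h2 i true l2; rewrite tr_true => <- <-.
rewrite -(h1 i w l1) -(h2 i w l2); split; first by case/andP => /implyP ? /implyP.
by move=> [h3 h4]; apply/andP; split; apply/implyP.
Qed.

End Limits.

Lemma eq_ev lf lf' w g : (forall w g, lf w g = lf' w g) -> ev lf w g = ev lf' w g.
Proof. by move=> e; elim: g w => //= a iha b ihb w; rewrite ?iha ?ihb ?(iha true) ?(ihb true). Qed.

Lemma eq_lf1 H T H' T' i i' w g : H i =1 H' i' -> T i =1 T' i' -> lf1 H T i w g = lf1 H' T' i' w g.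
Proof. by move=> h1 h2; case: g => //= p; case: w; rewrite /= ?h1 ?h2. Qed.

Lemma eq_updL lf lf' w g s : (forall w g, lf w g = lf' w g) -> updL lf w g s = updL lf' w g s.
Proof. by move=> e; case: g => //= *; rewrite ?e ?(eq_ev _ _ e). Qed.

Lemma eq_stt H T H' T' w g i : (forall k, k < i -> H k =1 H' k) -> (forall k, k < i -> T k =1 T' k) ->
  stt H T w g i = stt H' T' w g i.
Proof.
elim: i => //= i ih h1 h2; rewrite ih; try by move=> k hk; auto.
by apply: eq_updL => w' g'; apply: eq_lf1; auto.
Qed.

(** A letter that left a status undecided leaves it undecided when repeated. Positivity of [i0]
    serves Next, which waits for the letter at position 1. *)
Lemma stt_const H T w g i0 : (forall k, i0 <= k -> H k =1 H i0) -> (forall k, i0 <= k -> T k =1 T i0) ->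
  0 < i0 -> forall k, i0 <= k -> stt H T w g k.+1 = stt H T w g i0.+1.
Proof.
move=> h1 h2 i0p k hk; rewrite -(subnK hk); elim: (k - i0) => // n ih.
rewrite addSn [LHS]/= -/(stt H T w g (n + i0).+1) ih.
rewrite (@eq_updL _ (lf1 H T i0)); last first.
  by move=> w' g'; apply: eq_lf1; [apply: h1|apply: h2]; lia.
case: g {ih} => // [p|a|a b|a b].
- by rewrite stt_atom.
- by case: i0 {h1 h2 hk} i0p => // i0 _; rewrite stt_next.
- rewrite [stt _ _ _ _ i0.+1]/=; case: (stt _ _ _ _ i0) => [[] z] //=; rewrite /updU /=.
  by case: (ev _ w b) => //=; case: (ev _ w a).
rewrite [stt _ _ _ _ i0.+1]/=; case: (stt _ _ _ _ i0) => [[] z] //=; rewrite /updR /=.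
by case: (ev _ w b) => //=; case: (ev _ w a).
Qed.

Lemma ev_const H T w f i0 : (forall k, i0 <= k -> H k =1 H i0) -> (forall k, i0 <= k -> T k =1 T i0) ->
  0 < i0 -> theight f <= 1 -> ev (lf0 H T i0) w f <-> sat (tr H T w) T 0 f.
Proof.
move=> h1 h2 i0p hf; have [i1 h] := ev_limit H T hf.
rewrite -(h (maxn i0 i1) w (leq_maxr _ _)).
rewrite (@eq_ev _ (lf0 H T (maxn i0 i1))) // => w' g'.
by rewrite /lf0 (stt_const _ _ h1 h2 i0p (leq_maxl _ _)).
Qed.

Fixpoint atoms (f : form) : seq nat :=
  match f with
  | Atom p => [:: p]
  | Bot => [::]
  | Next f => atoms f
  | Or f g | And f g | Imp f g | Until f g | Release f g => atoms f ++ atoms g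
  end.

Lemma sat_atoms f H T H' T' i : (forall k p, p \in atoms f -> H k p = H' k p) ->
  (forall k p, p \in atoms f -> T k p = T' k p) -> sat H T i f <-> sat H' T' i f.
Proof.
have sub (s1 s2 : seq nat) (X Y : trace) : (forall k p, p \in s1 ++ s2 -> X k p = Y k p) ->
  (forall k p, p \in s1 -> X k p = Y k p) /\ (forall k p, p \in s2 -> X k p = Y k p).
  by move=> h; split=> k p hp; apply: h; rewrite mem_cat hp ?orbT.
elim: f H T H' T' i => [p|//|a iha b ihb|a iha b ihb|a iha b ihb|a ih|a iha b ihb|a iha b ihb] H T H' T' i /=.
- by move=> h _; rewrite h ?mem_head.
- move=> /sub[h1 h2] /sub[h3 h4].
  by rewrite (iha H T H' T') // (ihb H T H' T').
- move=> /sub[h1 h2] /sub[h3 h4].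
  by rewrite (iha H T H' T') // (ihb H T H' T').
- move=> /sub[h1 h2] /sub[h3 h4].
  by rewrite (iha H T H' T') // (ihb H T H' T') // (iha T T T' T') // (ihb T T T' T').
- by move=> h1 h2; apply: ih.
- move=> /sub[h1 h2] /sub[h3 h4]; split=> -[j [ij [hb ha]]]; exists j; split=> //; split.
  + by apply/(ihb H T H' T').
  + by move=> k k1 k2; apply/(iha H T H' T') => //; apply: ha.
  + by apply/(ihb H T H' T').
  + by move=> k k1 k2; apply/(iha H T H' T') => //; apply: ha.
move=> /sub[h1 h2] /sub[h3 h4]; split=> h j ij; case: (h j ij) => [hb|[k [k1 [k2 ha]]]].
- by left; apply/(ihb H T H' T').
- by right; exists k; split=> //; split=> //; apply/(iha H T H' T').
- by left; apply/(ihb H T H' T').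
- by right; exists k; split=> //; split=> //; apply/(iha H T H' T').
Qed.

(** Erasing the atoms foreign to [f] does not affect its satisfaction, so minimality forces them to
    be false. *)
Lemma equilibrium_outside f T : equilibrium_model T f -> forall i p, p \notin atoms f -> T i p = false.
Proof.
move=> [s h] i p np; apply/negP => Tp.
pose H : trace := fun k q => T k q && (q \in atoms f).
apply: (h H).
- by move=> k q /andP[].
- by exists i, p; rewrite /H Tp (negbTE np).
apply/(@sat_atoms f H T T T) => // k q hq; by rewrite /H hq andbT.
Qed.

(** * Small models *)

Definition same_letter (H T H' T' : trace) i k := H i =1 H' k /\ T i =1 T' k.

(* Every prefix of the second word ending in the letter of i can be matched in the first word. *)
Definition sim (H T H' T' : trace) := forall i, exists k, same_letter H T H' T' i k /\
  forall k', k' < k -> exists i', i' < i /\ same_letter H T H' T' i' k'.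

Lemma sat_same_letter H T H' T' i k a : theight a = 0 -> same_letter H T H' T' i k ->
  sat H T i a <-> sat H' T' k a.
Proof.
move=> ha [h1 h2]; rewrite (sat_ev H T i false ha) (sat_ev H' T' k false ha).
by rewrite (@eq_ev _ (lf1 H' T' k)) // => w g; apply: eq_lf1.
Qed.

(** A witness of Until consists of a prefix, and [sim] carries prefixes over. The failure of Release
    is witnessed by a prefix too, so Release travels in the opposite direction. *)
Lemma until_sim H T H' T' a b : theight a = 0 -> theight b = 0 -> sim H T H' T' ->
  sat H T 0 (Until a b) -> sat H' T' 0 (Until a b).
Proof.
move=> ha hb s [j [_ [sb sa]]]; have [k [m h]] := s j.
exists k; split=> //; split; first exact/(sat_same_letter hb m).
by move=> k' _ /h[i' [hi m']]; apply/(sat_same_letter ha m')/sa.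
Qed.

Lemma release_sim H T H' T' a b : theight a = 0 -> theight b = 0 -> sim H T H' T' ->
  sat H' T' 0 (Release a b) -> sat H T 0 (Release a b).
Proof.
move=> ha hb s h j _; have [k [m hk]] := s j.
case: (h k isT) => [sb|[k' [_ [/hk[i' [hi m']] sa]]]]; first by left; apply/(sat_same_letter hb m).
by right; exists i'; split=> //; split=> //; apply/(sat_same_letter ha m').
Qed.

Lemma sat_sim f H T H' T' : THT1 f -> sim H T H' T' -> sim H' T' H T ->
  same_letter H T H' T' 0 0 -> same_letter H T H' T' 1 1 -> sat H T 0 f <-> sat H' T' 0 f.
Proof.
have tt H1 T1 H2 T2 : sim H1 T1 H2 T2 -> sim T1 T1 T2 T2.
  move=> s i; have [k [[_ m] h]] := s i; exists k; split=> // k' /h [i' [hi [_ m']]].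
  by exists i'.
rewrite /THT1; elim: f H T H' T' => [p|//|a iha b ihb|a iha b ihb|a iha b ihb|a _|a _ b _|a _ b _] H T H' T' /=.
- by move=> _ _ _ [h _] _; rewrite h.
- by move=> /theight_max[ha hb] *; rewrite (iha H T H' T') // (ihb H T H' T').
- by move=> /theight_max[ha hb] *; rewrite (iha H T H' T') // (ihb H T H' T').
- move=> /theight_max[ha hb] s1 s2 m0 m1; rewrite (iha H T H' T') // (ihb H T H' T') //.
  have [? ?] : same_letter T T T' T' 0 0 /\ same_letter T T T' T' 1 1.
    by case: m0 m1 => _ ? [_ ?]; split; split.
  by rewrite (iha T T T' T') ?(ihb T T T' T') //; exact: tt.
- by rewrite ltnS leqn0 => /eqP ha _ _ _ m1; apply: sat_same_letter.
- rewrite ltnS => /theight_max[]; rewrite !leqn0 => /eqP ha /eqP hb s1 s2 _ _.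
  by split=> h; [apply: (until_sim ha hb s1)|apply: (until_sim ha hb s2)].
rewrite ltnS => /theight_max[]; rewrite !leqn0 => /eqP ha /eqP hb s1 s2 _ _.
by split=> h; [apply: (release_sim ha hb s2)|apply: (release_sim ha hb s1)].
Qed.

(** * Compressing a word along a map of positions *)

Definition pull (k : nat -> nat) (H : trace) : trace := fun i => H (k i).

Section Kappa.
Variable kappa : nat -> nat.
Hypothesis k0 : kappa 0 = 0.
Hypothesis k1 : kappa 1 = 1.
Hypothesis surj : forall k, exists i, kappa i = k.
Hypothesis growth : forall i k, k < kappa i -> exists i', i' < i /\ kappa i' = k.

(** By [growth], new values of [kappa] appear in increasing order. Positions before the least
    preimage of k are thus mapped strictly below k, which gives the second of the two
    similarities. *)
Lemma sat_pull f H T : THT1 f -> sat (pull kappa H) (pull kappa T) 0 f <-> sat H T 0 f.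
Proof.
move=> hf; apply: sat_sim => //.
- move=> i; exists (kappa i); split=> // k /growth[i' [hi <-]]; by exists i'.
- move=> k.
  have ex : exists i, kappa i == k by have [i <-] := surj k; exists i.
  exists (ex_minn ex); case: ex_minnP => i /eqP <- mi; split=> // i' hi.
  have := mi i'; exists (kappa i'); split=> //.
  case: (ltngtP (kappa i') (kappa i)) => // [/growth[i2 [h1 h2]]|h2].
    by have /(_ i2) := mi; rewrite h2 eqxx => /(_ isT); lia.
  by move: (mi i'); rewrite h2 eqxx => /(_ isT); lia.
- by split=> p; rewrite /pull k0.
- by split=> p; rewrite /pull k1.
Qed.

(** [kappa] goes from the original word to the compressed one, so each [H] below the compressed
    trace has a pullback below the original, and a counterexample to minimality can be pulled
    back. *)
Lemma equilibrium_pull f T T' : THT1 f -> (forall i, T i =1 T' (kappa i)) ->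
  equilibrium_model T f -> equilibrium_model T' f.
Proof.
move=> hf TT [s h].
have ext H : sat H T 0 f <-> sat H (pull kappa T') 0 f.
  by apply: sat_atoms => // k p _; rewrite TT.
have extT : sat T T 0 f <-> sat (pull kappa T') (pull kappa T') 0 f.
  by apply: sat_atoms => // k p _; rewrite TT.
split; first by apply/(sat_pull _ _ hf)/extT.
move=> H sub [k [p ne]] sH.
apply: (h (pull kappa H)).
- by move=> i q; rewrite TT; apply: sub.
- by have [i ki] := surj k; exists i, p; rewrite TT /pull ki.
by apply/ext/(sat_pull _ _ hf).
Qed.
End Kappa.

Lemma fin_bound (X : finType) (P : X -> nat -> Prop) :
  (forall x n n', n <= n' -> P x n -> P x n') -> (forall x, exists n, P x n) ->
  exists n, forall x, P x n.
Proof.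
move=> mono ex.
suff [n h] : exists n, forall x, x \in enum X -> P x n.
  by exists n => x; apply: h; rewrite mem_enum.
elim: (enum X) => [|x s [n h]]; first by exists 0.
have [n' h'] := ex x; exists (maxn n n') => y; rewrite inE => /orP[/eqP ->|/h].
  by apply: mono h'; exact: leq_maxr.
by apply: mono; exact: leq_maxl.
Qed.

(** * Keeping first occurrences and a recurring letter *)

Section Shrink.
Variables (X : finType) (l : nat -> X).

Lemma recurring : exists y, forall n, exists i, n <= i /\ l i = y.
Proof.
apply: NNPP => h.
have [n hn] : exists n, forall y, forall i, n <= i -> l i <> y.
  apply: fin_bound => [y n n' le h' i hi|y]; first by apply: h'; apply: leq_trans hi.
  apply: NNPP => h'; apply: h; exists y => n; apply: NNPP => h2; apply: h'.
  by exists n => i hi e; apply: h2; exists i.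
exact: (hn (l n) n).
Qed.

Lemma all_seen : exists M, 1 < M /\ forall i, exists i', i' < M /\ l i' = l i.
Proof.
have [n hn] : exists n, forall y, (exists i, l i = y) -> exists i, i < n /\ l i = y.
  apply: fin_bound => [y n n' le h /h[i [hi e]]|y].
    by exists i; split=> //; apply: leq_trans le.
  case: (classic (exists i, l i = y)) => [[i e]|]; last by exists 0.
  by exists i.+1 => _; exists i.
exists n.+2; split=> // i.
have [|i' [h1 h2]] := hn (l i); first by exists i.
by exists i'; split=> //; lia.
Qed.

Variables (y : X) (M : nat).
Hypothesis M1 : 1 < M.
Hypothesis y_rec : forall n, exists i, n <= i /\ l i = y.
Hypothesis seen : forall i, exists i', i' < M /\ l i' = l i.

Definition first_occ i := ~~ has (fun i' => l i' == l i) (iota 0 i).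
(** The positions to keep. Repetitions of [y] are kept only from [M] on, where all letters have been
    seen: before [M] this leaves at most two positions plus one for each letter, and from [M] on
    only copies of [y]. *)
Definition fresh i := [|| i < 2, (M <= i) && (l i == y) | first_occ i].
Definition cnt i := count fresh (iota 0 i).
Definition focc i := find (fun i' => l i' == l i) (iota 0 i.+1).
(** A dropped position takes the new index of the first occurrence of its letter, a kept position
    that precedes it, so no new index is skipped. *)
Definition kap i := if fresh i then cnt i else cnt (focc i).

Lemma cntS i : cnt i.+1 = cnt i + fresh i.
Proof. by rewrite /cnt -addn1 iotaD count_cat /= add0n addn0. Qed.

Lemma cnt_mono i j : i <= j -> cnt i <= cnt j.
Proof.
move=> h; rewrite -(subnK h); elim: (j - i) => // n ih.
by rewrite addSn cntS; apply: leq_trans ih (leq_addr _ _).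
Qed.

Lemma cnt_fresh_lt i j : fresh i -> i < j -> cnt i < cnt j.
Proof. by move=> fi /cnt_mono; rewrite cntS fi addn1. Qed.

Lemma cnt_inj i j : fresh i -> fresh j -> cnt i = cnt j -> i = j.
Proof.
move=> fi fj e; case: (ltngtP i j) => // h.
  by have := cnt_fresh_lt fi h; rewrite e ltnn.
by have := cnt_fresh_lt fj h; rewrite e ltnn.
Qed.

Lemma cnt_growth i k : k < cnt i -> exists i', [/\ i' < i, fresh i' & cnt i' = k].
Proof.
elim: i => // i ih; rewrite cntS; case fi: (fresh i).
  rewrite addn1 ltnS leq_eqVlt => /orP[/eqP ->|/ih[i' [h1 h2 h3]]]; first by exists i.
  by exists i'; split=> //; lia.
by rewrite addn0 => /ih[i' [h1 h2 h3]]; exists i'; split=> //; lia.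
Qed.

Lemma foccP i : [/\ focc i <= i, l (focc i) = l i & fresh (focc i)].
Proof.
have hh : has (fun i' => l i' == l i) (iota 0 i.+1).
  by apply/hasP; exists i => //; rewrite mem_iota add0n /=.
have lt : focc i < i.+1 by move: hh; rewrite has_find size_iota.
have := nth_find 0 hh; rewrite -/(focc i) nth_iota // add0n => /eqP e.
split=> //; apply/or3P/Or33; apply/hasP => -[j]; rewrite mem_iota add0n /= => hj /eqP ej.
have := before_find 0 hj; rewrite nth_iota ?add0n ?ej ?e ?eqxx //.
by apply: leq_trans hj _; apply: ltnW.
Qed.

Lemma kap_fresh i : exists j, [/\ j <= i, l j = l i, fresh j & kap i = cnt j].
Proof.
rewrite /kap; case fi: (fresh i); first by exists i.
by exists (focc i); have [? ? ?] := foccP i.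
Qed.

Lemma kap_growth i k : k < kap i -> exists i', i' < i /\ kap i' = k.
Proof.
have [j [ji _ fj ->]] := kap_fresh i => /cnt_growth[i' [h1 h2 h3]].
by exists i'; split; [lia | rewrite /kap h2].
Qed.

Lemma cnt_unbounded k : exists i, k < cnt i.
Proof.
elim: k => [|k [i hi]]; first by exists 1.
have [j [hj ej]] := y_rec (maxn i M); exists j.+1.
have fj : fresh j by apply/or3P/Or32; rewrite ej eqxx andbT; lia.
rewrite cntS fj addn1 ltnS; apply: leq_trans hi _; apply: cnt_mono; lia.
Qed.

Lemma kap_surj k : exists i, kap i = k.
Proof.
have [i /cnt_growth[i' [_ h2 h3]]] := cnt_unbounded k.
by exists i'; rewrite /kap h2.
Qed.

Lemma pos_ex k : exists i, fresh i && (cnt i == k).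
Proof.
have [i /cnt_growth[i' [_ h2 h3]]] := cnt_unbounded k.
by exists i'; rewrite h2 h3 eqxx.
Qed.
Definition pos k := ex_minn (pos_ex k).
Lemma posP k : fresh (pos k) /\ cnt (pos k) = k.
Proof. by rewrite /pos; case: ex_minnP => i /andP[h /eqP]. Qed.

Lemma pos_kap i : l (pos (kap i)) = l i.
Proof.
have [j [_ e fj ->]] := kap_fresh i; have [f c] := posP (cnt j).
by rewrite (cnt_inj f fj c).
Qed.

Lemma pos_tail k : cnt M <= k -> l (pos k) = y.
Proof.
move=> hk; have [f c] := posP k.
have hM : M <= pos k.
  by rewrite leqNgt; apply/negP => h; have := cnt_fresh_lt f h; rewrite c; lia.
case/or3P: f => [|/andP[_ /eqP//]|]; first by lia.
have [i' [h1 h2]] := seen (pos k).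
by case/hasP; exists i'; [rewrite mem_iota; lia | rewrite h2].
Qed.

Lemma cntM_ge2 : 1 < cnt M.
Proof. by apply: (@leq_trans (cnt 2)) => //; apply: cnt_mono. Qed.

Lemma uniq_first n : uniq (map l (filter first_occ (iota 0 n))).
Proof.
elim: n => // n ih; rewrite -addn1 iotaD filter_cat map_cat cat_uniq ih /= add0n.
case f: (first_occ n) => //=; rewrite orbF andbT; apply/mapP => -[i].
rewrite mem_filter => /andP[_ hi] e; case/hasP: f; exists i => //.
by rewrite e.
Qed.

Lemma cnt_le_card : cnt M <= #|X| + 2.
Proof.
rewrite /cnt (leq_trans (n := count (fun i => i < 2) (iota 0 M) + count first_occ (iota 0 M))) //.
  have : all (fun i => i < M) (iota 0 M) by apply/allP => i; rewrite mem_iota.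
  elim: (iota 0 M) => //= i s ih /andP[hi /ih].
  have -> : fresh i = (i < 2) || first_occ i by rewrite /fresh [M <= i]leqNgt hi.
  case: (i < 2); case: (first_occ i) => /=; lia.
rewrite addnC leq_add //.
  rewrite -size_filter -(size_map l) cardE; apply: uniq_leq_size (uniq_first M) _ => x _.
  by rewrite mem_enum.
case: M M1 => // -[] // m _ /=.
suff -> : count (fun i => i < 2) (iota 2 m) = 0 by [].
by apply/eqP; rewrite -leqn0 leqNgt -has_count; apply/hasP => -[i]; rewrite mem_iota; lia.
Qed.
End Shrink.

(* Keep positions 0 and 1, the first occurrences of letters, and a recurring letter as constant tail. *)
Theorem small_equilibrium f : THT1 f -> (exists T, equilibrium_model T f) ->
  exists T n, [/\ equilibrium_model T f, 0 < n, forall k, n <= k -> T k =1 T n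
    & n <= 2 ^ size (atoms f) + 2].
Proof.
move=> hf [T hT].
(* By [equilibrium_outside] a letter is determined by its bits at the atoms of [f], which is where
   the bound on [n] comes from. *)
pose X : finType := (size (atoms f)).-tuple bool.
pose l i : X := [tuple of [seq T i p | p <- in_tuple (atoms f)]].
have lE i j : l i = l j -> T i =1 T j.
  move=> e p; case: (boolP (p \in atoms f)) => hp; last first.
    by rewrite !(equilibrium_outside hT _ hp).
  have /eq_in_map h : [seq T i q | q <- atoms f] = [seq T j q | q <- atoms f].
    by have := congr1 val e.
  exact: h.
have [y y_rec] := recurring l; have [M [M1 seen]] := all_seen l.
pose kp := kap l y M; pose T' : trace := fun k => T (pos M1 y_rec k).
have TT i : T i =1 T' (kp i) by move=> p; rewrite /T' /kp (lE _ _ (pos_kap M1 y_rec i)).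
have kg := @kap_growth _ l y M M1.
have k00 : kp 0 = 0 by [].
have k11 : kp 1 = 1 by [].
exists T', (cnt l y M M); split.
- exact: (equilibrium_pull k00 k11 (kap_surj M1 y_rec) kg hf TT hT).
- by apply: leq_trans (cntM_ge2 l y M1).
- move=> k hk p; rewrite /T'; apply: lE.
  by rewrite !(pos_tail M1 y_rec seen).
- by have := cnt_le_card l y M1; rewrite card_tuple card_bool.
Qed.

(** * The certificate conditions *)

(* Per-world data of a column in a configuration row: letter bit, value, status before, status after. *)
Record wdata := WData { la : bool; va : bool; s0 : bool * bool; s1 : bool * bool }.

Record cell := Cell {
  rs : bool;    (* row start *)
  isin : bool;
  bit : bool;
  tok : bool;   (* start of a subformula *)
  lev : bool;   (* below a modality *)
  self : bool; en : bool;
  conf : bool;  (* configuration row *)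
  fin : bool;   (* constant tail of the trace *)
  da : bool;    (* H and T already differ, this position included *)
  db : bool;    (* H and T already differ, this position excluded *)
  idI : bool; idJ : bool; (* bit of the identifier of this position / of the next one *)
  wH : wdata; wT : wdata }.

Definition wd (w : bool) (c : cell) := if w then wT c else wH c.

Definition wdata_enc (w : wdata) := (la w, va w, s0 w, s1 w).
Definition wdata_dec x := let: (a, b, c, d) := x in WData a b c d.
Lemma wdata_encK : cancel wdata_enc wdata_dec. Proof. by case. Qed.
HB.instance Definition _ := Finite.copy wdata (can_type wdata_encK).

Definition cell_enc (c : cell) :=
  (rs c, isin c, bit c, tok c, lev c, self c, en c, conf c, fin c, da c, db c, idI c, idJ c, wH c, wT c).
Definition cell_dec x :=
  let: (a, b, c, d, e, f, g, h, i, j, k, l, m, n, o) := x in Cell a b c d e f g h i j k l m n o.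
Lemma cell_encK : cancel cell_enc cell_dec. Proof. by case. Qed.
HB.instance Definition _ := Finite.copy cell (can_type cell_encK).

Definition wdata0 := WData false false (false, false) (false, false).
Definition cell0 := Cell false false false false false false false false false false false false false wdata0 wdata0.

Definition allw (P : bool -> bool) := P true && P false.
Lemma allwP (P : bool -> bool) : reflect (forall w, P w) (allw P).
Proof. by apply: (iffP andP) => [[? ?] []|h]. Qed.

Definition cin (c : cell) : option bool := if isin c then Some (bit c) else None.

(* Opcode of a token from its three bits; 8 + bit for a position that does not start a token. *)
Definition code (x0 x1 x2 : cell) : nat :=
  if tok x0 then 4 * bit x0 + 2 * bit x1 + bit x2 else 8 + bit x0.

Definition parse_ok (x0 x1 x2 x3 : cell) : bool :=
  match code x0 x1 x2 with
  | 0 => isin x2 && ~~ tok x3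
  | 1 => isin x2
  | 2 | 3 | 4 => isin x2 && tok x3 && (lev x3 == lev x0)
  | 5 | 6 | 7 => isin x2 && ~~ lev x0 && tok x3 && lev x3
  | 8 => isin x0
  | _ => [&& isin x0, isin x1, ~~ tok x2 & bit x2 || bit x1]
  end.

Definition is_binary (n : nat) := [|| n == 2, n == 3, n == 4, n == 6 | n == 7].

(* Local conditions on a configuration row at a token: [x] at the token, [y] at its first argument,
   [y'] at its second argument. *)
Definition cond1 (n : nat) (lv : bool) (x y : cell) : bool :=
  match n with
  | 0 => (la (wH x) ==> la (wT x)) && allw (fun w => if lv then va (wd w x) == la (wd w x)
         else (s1 (wd w x) == updA (s0 (wd w x)) (la (wd w x))) && (va (wd w x) == (s1 (wd w x)).2))
  | 1 => allw (fun w => ~~ va (wd w x))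
  | 5 => allw (fun w => (s1 (wd w x) == updX (s0 (wd w x)) (va (wd w y))) && (va (wd w x) == (s1 (wd w x)).2))
  | _ => true
  end.
Definition cond2 (n : nat) (x y y' : cell) : bool :=
  allw (fun w => let a := va (wd w y) in let b := va (wd w y') in
  match n with
  | 2 => va (wd w x) == a || b
  | 3 => va (wd w x) == a && b
  | 4 => va (wd w x) == (a ==> b) && (va (wT y) ==> va (wT y'))
  | 6 => (s1 (wd w x) == updU (s0 (wd w x)) a b) && (va (wd w x) == (s1 (wd w x)).2)
  | 7 => (s1 (wd w x) == updR (s0 (wd w x)) a b) && (va (wd w x) == (s1 (wd w x)).2)
  | _ => true
  end).

Definition conf_start (t b : cell) := tok t ==> allw (fun w => s0 (wd w b) == (false, false)).
Definition conf_next (t a b : cell) :=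
  (idI b == idJ a) && (tok t ==> allw (fun w => s0 (wd w b) == s1 (wd w a))).
Definition conf_same (t a b : cell) :=
  (idI b == idI a) && (tok t ==> allw (fun w => s0 (wd w b) == s0 (wd w a))).
Definition conf_twin (t a b : cell) := (idJ b == idJ a) && (tok t ==> (la (wT b) == la (wT a))).

(* The certificate conditions on a word [c] with header column [z]: the row starting at position x
   has entry [c (j + x)] in column j <= z, row 0 being the annotated input. *)
Section Cert.
Variables (cc : nat -> cell) (B z : nat).

(** The parse tree is a set of spans, one row for each: [self] marks the first column and [en] the
    column after the last. A row is any position carrying [rs], read relative to that position. *)
Definition Erel (j k : nat) := exists v, v < B /\ [&& rs (cc v), self (cc (j + v)) & en (cc (k + v))].

Definition allC (P : nat -> Prop) := forall j, j < B -> j <= z -> P j.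
Definition exC (P : nat -> Prop) := exists j, j < B /\ (j <= z /\ P j).
Definition crow (x : nat) := rs (cc x) && conf (cc (z + x)).
Definition allR (P : nat -> Prop) := forall x, x < B -> crow x -> P x.
Definition exR (P : nat -> Prop) := exists x, x < B /\ (crow x /\ P x).

Definition atom_at (j : nat) := code (cc j) (cc j.+1) (cc j.+2) == 0.

(** Equality of atom numbers, tested bit by bit at equal offsets; the end of the code at [a] is
    taken from the parse tree. *)
Definition sameid (a b : nat) := allC (fun k => Erel a k -> allC (fun o => allC (fun p =>
  o + a = p -> p < k -> bit (cc p) == bit (cc (o + b))))).

Definition C_root := (tok (cc 0) && ~~ lev (cc 0)) /\ Erel 0 z.
Definition C_parse := allC (fun j => allC (fun k => Erel j k ->
  parse_ok (cc j) (cc j.+1) (cc j.+2) (cc j.+3) /\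
  let n := code (cc j) (cc j.+1) (cc j.+2) in
  ((n == 0) || (n == 5) -> Erel j.+3 k) /\
  (n == 1 -> j.+3 = k) /\ (n == 8 -> j.+1 = k) /\ (n == 9 -> Erel j.+2 k) /\
  (is_binary n -> exC (fun l => Erel j.+3 l /\ (Erel l k /\ (tok (cc l) && (lev (cc l) == lev (cc j.+3)))))))).
Definition C_init := exR (fun x => allC (fun j => conf_start (cc j) (cc (j + x)))).
Definition C_cond1 := allR (fun x => allC (fun j => 
  cond1 (code (cc j) (cc j.+1) (cc j.+2)) (lev (cc j)) (cc (j + x)) (cc (j.+3 + x)))).
Definition C_cond2 := allR (fun x => allC (fun j => allC (fun l => Erel j.+3 l ->
  cond2 (code (cc j) (cc j.+1) (cc j.+2)) (cc (j + x)) (cc (j.+3 + x)) (cc (l + x))))).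
(** Only atoms of T may be toggled, which keeps H below T. The new row has read the same prefix, so
    [s0] and [db] are unchanged, and all columns of the same atom flip together. *)
Definition C_toggle := allR (fun x => allC (fun a => atom_at a && la (wT (cc (a + x))) ->
  exR (fun y => db (cc (z + y)) == db (cc (z + x)) /\ allC (fun j => conf_same (cc j) (cc (j + x)) (cc (j + y)) /\
    (atom_at j -> sameid a j /\ (la (wH (cc (j + y))) == ~~ la (wH (cc (j + x)))) \/
                  (sameid a j -> false) /\ la (wH (cc (j + y))) == la (wH (cc (j + x)))))))).
(** Moving right outside the tail forces a path of successors into the tail within a word of finite
    length; the implication on [fin] keeps it there. *)
Definition C_next := allR (fun x => exR (fun y =>
  ((fin (cc (z + x)) ==> fin (cc (z + y))) && (db (cc (z + y)) == da (cc (z + x)))) /\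
  (fin (cc (z + x)) \/ x < y) /\
  allC (fun j => conf_next (cc j) (cc (j + x)) (cc (j + y))))).
(** Equal identifiers stand for the same position: whatever H the rows belong to, they agree on T,
    on the tail and on the next position, so all H are compared with one T. *)
Definition C_twin := allR (fun x => allR (fun y => allC (fun j => idI (cc (j + y)) == idI (cc (j + x))) ->
  fin (cc (z + y)) == fin (cc (z + x)) /\ allC (fun j => conf_twin (cc j) (cc (j + x)) (cc (j + y))))).
Definition C_diff := allR (fun x => (db (cc (z + x)) ==> da (cc (z + x))) /\
  allC (fun j => atom_at j && (la (wH (cc (j + x))) != la (wT (cc (j + x)))) ==> da (cc (z + x)))).
Definition C_atoms := allR (fun x => allC (fun a => allC (fun b => atom_at a && atom_at b -> sameid a b ->
  (la (wH (cc (a + x))) == la (wH (cc (b + x)))) && (la (wT (cc (a + x))) == la (wT (cc (b + x))))))).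
(** [da] separates rows in which H has already left T, where the formula must be false in the
    here-world, from rows that may still belong to T itself. *)
Definition C_fin := allR (fun x => fin (cc (z + x)) ==>
  va (wT (cc (0 + x))) && (da (cc (z + x)) ==> ~~ va (wH (cc (0 + x))))).

Definition Cert := C_root /\ C_parse /\ C_init /\ C_cond1 /\ C_cond2 /\ C_toggle /\ C_next /\ C_twin
  /\ C_diff /\ C_atoms /\ C_fin.
End Cert.

(* Variable 0 is the position 0 and variable 1 the header column. *)
Notation "A ~> B" := (FBin BImp A B) (at level 99, right associativity, B at level 200).
Notation "A /& B" := (FBin BAnd A B) (at level 80, right associativity).
Notation "A |& B" := (FBin BOr A B) (at level 85, right associativity).
Notation cfo := (fo cell).

Definition fAllC x (f : cfo) := FQ true x (FLe cell 0 x 0 1 ~> f).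
Definition fExC x (f : cfo) := FQ false x (FLe cell 0 x 0 1 /& f).
Definition rd x y n (K : cell -> cfo) := FRead x y n K.
Definition fCrow x := rd 0 x 0 (fun a => rd 1 x 0 (fun b => FB cell (rs a && conf b))).
Definition fAllR x (f : cfo) := FQ true x (fCrow x ~> f).
Definition fExR x (f : cfo) := FQ false x (fCrow x /& f).
Definition fE j n k := FQ false 11 (rd 0 11 0 (fun a => rd j 11 n (fun b => rd k 11 0 (fun c =>
  FB cell [&& rs a, self b & en c])))).
Definition fAtom j (K : bool -> cfo) :=
  rd 0 j 0 (fun a => rd 0 j 1 (fun b => rd 0 j 2 (fun c => K (code a b c == 0)))).
Definition fSameid a b := fAllC 3 (fE a 0 3 ~> fAllC 9 (fAllC 10 (FEq cell 9 a 0 10 ~> FLe cell 0 10 1 3 ~>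
  rd 0 10 0 (fun x => rd 9 b 0 (fun y => FB cell (bit x == bit y)))))).

Definition f_root := rd 0 0 0 (fun a => FB cell (tok a && ~~ lev a)) /& fE 0 0 1.
Definition f_parse := fAllC 2 (fAllC 3 (fE 2 0 3 ~>
  rd 0 2 0 (fun a => rd 0 2 1 (fun b => rd 0 2 2 (fun c => rd 0 2 3 (fun d =>
  let n := code a b c in
  FB cell (parse_ok a b c d) /&
  (FB cell ((n == 0) || (n == 5)) ~> fE 2 3 3) /&
  (FB cell (n == 1) ~> FEq cell 0 2 3 3) /&
  (FB cell (n == 8) ~> FEq cell 0 2 1 3) /&
  (FB cell (n == 9) ~> fE 2 2 3) /&
  (FB cell (is_binary n) ~> fExC 4 (fE 2 3 4 /& fE 4 0 3 /&
     rd 0 4 0 (fun l => rd 0 2 3 (fun d => FB cell (tok l && (lev l == lev d)))))))))))).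
Definition f_init := fExR 5 (fAllC 2 (rd 0 2 0 (fun t => rd 2 5 0 (fun b => FB cell (conf_start t b))))).
Definition rdcode j (K : nat -> cfo) :=
  rd 0 j 0 (fun a => rd 0 j 1 (fun b => rd 0 j 2 (fun c => K (code a b c)))).
Definition f_cond1 := fAllR 5 (fAllC 2 (rdcode 2 (fun n => rd 0 2 0 (fun a =>
  rd 2 5 0 (fun x => rd 2 5 3 (fun y => FB cell (cond1 n (lev a) x y))))))).
Definition f_cond2 := fAllR 5 (fAllC 2 (fAllC 4 (fE 2 3 4 ~> rdcode 2 (fun n =>
  rd 2 5 0 (fun x => rd 2 5 3 (fun y => rd 4 5 0 (fun y' => FB cell (cond2 n x y y')))))))).
Definition rdz x (K : cell -> cfo) := rd 1 x 0 K.
Definition f_toggle := fAllR 5 (fAllC 7 (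
  fAtom 7 (fun t => rd 7 5 0 (fun x => FB cell (t && la (wT x)))) ~>
  fExR 6 (rdz 6 (fun h' => rdz 5 (fun h => FB cell (db h' == db h))) /&
    fAllC 2 (rd 0 2 0 (fun t => rd 2 5 0 (fun x => rd 2 6 0 (fun y => FB cell (conf_same t x y)))) /&
      (fAtom 2 (fun t => FB cell t) ~>
        (fSameid 7 2 /& rd 2 6 0 (fun y => rd 2 5 0 (fun x => FB cell (la (wH y) == ~~ la (wH x))))) |&
        ((fSameid 7 2 ~> FB cell false) /& rd 2 6 0 (fun y => rd 2 5 0 (fun x => FB cell (la (wH y) == la (wH x)))))))))).
Definition f_next := fAllR 5 (fExR 6 (
  rdz 5 (fun h => rdz 6 (fun h' => FB cell ((fin h ==> fin h') && (db h' == da h)))) /&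
  (rdz 5 (fun h => FB cell (fin h)) |& FLe cell 0 5 1 6) /&
  fAllC 2 (rd 0 2 0 (fun t => rd 2 5 0 (fun x => rd 2 6 0 (fun y => FB cell (conf_next t x y))))))).
Definition f_twin := fAllR 5 (fAllR 6 (
  fAllC 2 (rd 2 6 0 (fun y => rd 2 5 0 (fun x => FB cell (idI y == idI x)))) ~>
  (rdz 6 (fun h' => rdz 5 (fun h => FB cell (fin h' == fin h))) /&
   fAllC 2 (rd 0 2 0 (fun t => rd 2 5 0 (fun x => rd 2 6 0 (fun y => FB cell (conf_twin t x y)))))))).
Definition f_diff := fAllR 5 (rdz 5 (fun h => FB cell (db h ==> da h)) /&
  fAllC 2 (fAtom 2 (fun t => rd 2 5 0 (fun x => rdz 5 (fun h =>
     FB cell (t && (la (wH x) != la (wT x)) ==> da h)))))).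
Definition f_atoms := fAllR 5 (fAllC 7 (fAllC 8 (
  fAtom 7 (fun t => fAtom 8 (fun t' => FB cell (t && t'))) ~> fSameid 7 8 ~>
  rd 7 5 0 (fun x => rd 8 5 0 (fun y => FB cell ((la (wH x) == la (wH y)) && (la (wT x) == la (wT y)))))))).
Definition f_fin := fAllR 5 (rdz 5 (fun h => rd 0 5 0 (fun x =>
  FB cell (fin h ==> va (wT x) && (da h ==> ~~ va (wH x)))))).

Definition f_cert := f_root /& f_parse /& f_init /& f_cond1 /& f_cond2 /& f_toggle /& f_next /& f_twin
  /& f_diff /& f_atoms /& f_fin.

(** The equation v + v = v pins variable 0 to position 0; variable 1 is pinned to the first cell
    outside the input. *)
Definition f_main : cfo := FQ false 0 (FEq cell 0 0 0 0 /& FQ false 1 (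
  rd 0 1 0 (fun a => FB cell (~~ isin a)) /&
  FQ true 2 (FLe cell 0 2 1 1 ~> rd 0 2 0 (fun a => FB cell (isin a))) /& f_cert)).

Definition env z := upd (upd (fun _ => 0) 0 0) 1 z.
Lemma certE c z : holds cell0 c (env z) f_cert = Cert (nth cell0 c) (size c) z.
Proof. reflexivity. Qed.

Lemma wf_main : wf 12 [::] f_main.
Proof. by rewrite /f_main /=; repeat split. Qed.

(** * Parsing and values *)

Definition encb (s : seq bool) : seq bool := flatten [seq [:: true; b] | b <- s] ++ [:: false].

Definition bval (s : seq bool) : nat := foldr (fun (b : bool) n => b + n.*2) 0 s.

Lemma bval_eq0 s : last true s -> bval s = 0 -> s = [::].
Proof.
elim: s => //= b s ih h /eqP; rewrite addn_eq0 double_eq0 => /andP[/eqP b0 /eqP e].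
have s0 : s = [::] by apply: ih => //; case: s h {e} => //= ? ? ->.
by rewrite s0 /= in h; rewrite h in b0.
Qed.

Lemma binf_bval s fuel : last true s -> bval s <= fuel -> binf fuel (bval s) = s.
Proof.
elim: s fuel => [|b s ih] fuel h; first by case: fuel.
have h' : last true s by case: s h {ih} => //= ? ? ->.
have pos : 0 < bval (b :: s) by rewrite lt0n; apply/negP => /eqP /(bval_eq0 h).
case: fuel => [|fuel] hf; first by move: pos; rewrite ltnNge hf.
move: pos => /=; case E: (b + (bval s).*2) => [//|n] _; rewrite -E.
congr (_ :: _); first by rewrite oddD odd_double addbF; case: (b).
have -> : (b + (bval s).*2)./2 = bval s by rewrite half_bit_double.
by apply: ih => //; move: hf => /=; lia.
Qed.

(** Bits come least significant first, so a canonical numeral is one that does not end in false; the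
    default true of [last] admits the empty string for 0. *)
Lemma bin_surj s : last true s -> exists n, bin n = s.
Proof. by move=> h; exists (bval s); apply: binf_bval. Qed.

Definition asb (P : Prop) : bool := if excluded_middle_informative P then true else false.
Lemma asbP P : reflect P (asb P).
Proof. by rewrite /asb; case: excluded_middle_informative => h; constructor. Qed.

Lemma chain (P : nat -> Prop) (R : nat -> nat -> Prop) x0 : P x0 ->
  (forall x, P x -> exists y, P y /\ R x y) ->
  exists rho : nat -> nat, rho 0 = x0 /\ forall i, P (rho i) /\ R (rho i) (rho i.+1).
Proof.
move=> p0 h.
pose nx (x : {x | P x}) : {y : nat | P y /\ R (sval x) y} :=
  constructive_indefinite_description _ (h _ (svalP x)).
pose nx' x : {x | P x} := exist _ (sval (nx x)) (svalP (nx x)).1.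
pose rho i := iter i nx' (exist _ x0 p0).
exists (fun i => sval (rho i)); split=> // i; split; first exact: svalP.
exact: (svalP (nx (rho i))).2.
Qed.

Section Cert.
Variables (cc : nat -> cell) (B z : nat).
Hypothesis zB : z < B.
Hypothesis inE' : forall j, isin (cc j) = (j < z).
Notation Erel := (Erel cc B).

Definition occ (s : seq bool) (j : nat) := forall o, o < size s -> bit (cc (o + j)) = nth false s o.

Lemma occ_cat s t j : occ (s ++ t) j <-> occ s j /\ occ t (size s + j).
Proof.
split=> [h|[h1 h2] o].
  split=> o ho; first by rewrite h ?nth_cat ?ho // size_cat ltn_addr.
  have := h (size s + o); rewrite size_cat ltn_add2l => /(_ ho).
  by rewrite nth_cat ltnNge leq_addr /= addKn => <-; congr (bit (cc _)); lia.
rewrite size_cat nth_cat => hs; case: ltnP => ho; first exact: h1.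
by rewrite -h2; [congr (bit (cc _)); lia | lia].
Qed.

Lemma occ_cons b s j : occ (b :: s) j <-> bit (cc j) = b /\ occ s j.+1.
Proof.
rewrite -cat1s occ_cat /= add1n; split=> -[h1 h2]; split=> //.
  exact: (h1 0).
by case.
Qed.

Lemma encb_cons b s : encb (b :: s) = [:: true, b & encb s]. Proof. by []. Qed.

Lemma occ_encb_inj s s' j : occ (encb s) j -> occ (encb s') j -> s = s'.
Proof.
elim: s s' j => [|b s ih] [|b' s'] j //; rewrite ?encb_cons.
- by rewrite /encb /= !occ_cons => -[-> _] [].
- by rewrite /encb /= !occ_cons => -[-> _] [].
rewrite !occ_cons => -[_ [-> h1]] [_ [-> h2]]; congr (_ :: _); exact: ih h1 h2.
Qed.

Definition cd j := code (cc j) (cc j.+1) (cc j.+2).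

(* The columns [j, k) spell [g], at level [lv], with the certified parse tree. *)
Fixpoint node (g : form) (lv : bool) (j k : nat) : Prop :=
  [/\ tok (cc j), lev (cc j) = lv, k <= z & j < k] /\
  match g with
  | Atom p => [/\ cd j = 0, occ (enc_nat p) j.+3, k = size (enc_nat p) + j.+3 & Erel j k]
  | Bot => cd j = 1 /\ k = j.+3
  | Or a b => cd j = 2 /\ exists l, [/\ Erel j.+3 l, node a lv j.+3 l & node b lv l k]
  | And a b => cd j = 3 /\ exists l, [/\ Erel j.+3 l, node a lv j.+3 l & node b lv l k]
  | Imp a b => cd j = 4 /\ exists l, [/\ Erel j.+3 l, node a lv j.+3 l & node b lv l k]
  | Next a => [/\ cd j = 5, lv = false & node a true j.+3 k]
  | Until a b => [/\ cd j = 6, lv = false & exists l, [/\ Erel j.+3 l, node a true j.+3 l & node b true l k]]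
  | Release a b => [/\ cd j = 7, lv = false & exists l, [/\ Erel j.+3 l, node a true j.+3 l & node b true l k]]
  end.

Lemma nodeE g lv j k : node g lv j k -> [/\ tok (cc j), lev (cc j) = lv, k <= z & j < k].
Proof. by case: g => [p||a b|a b|a b|a|a b|a b] []. Qed.

Lemma node_le g lv j k : node g lv j k -> j < B /\ j <= z.
Proof. by move=> /nodeE[_ _ h1 h2]; split; lia. Qed.

Hypothesis parse : C_parse cc B z.

Lemma ltn3 j : j < j.+3. Proof. exact: leqW. Qed.

(** Induction on the remaining length [z - j]. Subformulas and suffixes of numerals are decoded
    together, because [Erel] contains spans of both kinds. *)
Lemma parse_node n j k : z - j < n -> j <= z -> k <= z -> Erel j k -> j < k /\
  (if tok (cc j) then exists g, node g (lev (cc j)) j k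
   else exists s, [/\ last true s, occ (encb s) j & k = size (encb s) + j]).
Proof.
elim: n j k => // n ih j k hn jz kz E.
have jB : j < B by lia.
have kB : k < B by lia.
have := parse jB jz kB kz E; rewrite -/(cd j) /= => -[ok [h05 [h1 [h8 [h9 hb]]]]].
case t: (tok (cc j)); last first.
  have isj : isin (cc j) by move: ok; rewrite /parse_ok /code t; case: (bit (cc j)) => //= /and4P[].
  have lj : j < z by rewrite -inE'.
  case b0: (bit (cc j)).
    have c9 : cd j = 9 by rewrite /cd /code t b0.
    move: ok; rewrite /parse_ok -/(cd j) c9 => /and4P[_ i1 t2 b12].
    have j1B : j.+1 < B by lia.
    have l1 : j.+1 < z by rewrite -inE'.
    have [||||lt] := ih j.+2 k; [clear -hn jz l1; lia | clear -l1; lia | exact: kz | by apply: h9; rewrite c9 |].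
    rewrite (negbTE t2) => -[s [hs1 hs2 hs3]]; split; first by clear -lt; lia.
    exists (bit (cc j.+1) :: s); split.
    - move: hs1 hs2 b12; case: (s) => //=; rewrite /encb /= occ_cons => _ [-> _]; by case: (bit _).
    - by rewrite encb_cons !occ_cons.
    - by rewrite hs3 encb_cons /= !addnS.
  have c8 : cd j = 8 by rewrite /cd /code t b0.
  split; first by rewrite -h8 ?c8.
  by exists [::]; split=> //; [rewrite /encb /= occ_cons; split=> // | rewrite /= -h8 ?c8].
have bits : cd j = 4 * bit (cc j) + 2 * bit (cc j.+1) + bit (cc j.+2) by rewrite /cd /code t.
have i2 : isin (cc j.+2).
  move: ok; rewrite /parse_ok -/(cd j) bits.
  by case: (bit (cc j)); case: (bit (cc j.+1)); case: (bit (cc j.+2)) => //= /andP[] // /andP[] // /andP[].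
have l2 : j.+2 < z by rewrite -inE'.
have c7 : cd j <= 7 by rewrite bits; case: (bit (cc j)); case: (bit (cc j.+1)); case: (bit (cc j.+2)).
have ihn a b : j < a -> a <= z -> b <= z -> Erel a b -> a < b /\ (tok (cc a) -> exists g, node g (lev (cc a)) a b).
  by move=> ? ? ? Eab; have [||||? h] := ih a b => //; [lia | split=> // ta; rewrite ta in h].
have bin_ (lv : bool) : is_binary (cd j) -> tok (cc j.+3) -> lev (cc j.+3) = lv -> exists a b l,
    [/\ Erel j.+3 l, node a lv j.+3 l & node b lv l k] /\ j < k.
  move=> /hb[l [lB [lz [E1 [E2 /andP[tl /eqP ll]]]]]] t3 lv3.
  have [lt1 /(_ t3) [a na]] := ihn j.+3 l (ltn3 j) l2 lz E1.
  have [lt2 /(_ tl) [b nb]] := ihn l k (ltn_trans (ltn3 j) lt1) lz kz E2.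
  by exists a, b, l; rewrite -lv3 -{2}ll; split; [split | clear -lt1 lt2; lia].
move: ok; rewrite /parse_ok -/(cd j) => ok.
have fin_ (C : j < k) P : P -> [/\ tok (cc j), lev (cc j) = lev (cc j), k <= z & j < k] /\ P by [].
case c: (cd j) c7 ok => [|[|[|[|[|[|[|[|//]]]]]]]] _ ok.
- case/andP: ok => _ t3; have E3 : Erel j.+3 k by apply: h05; rewrite c.
  have [||||lt] := ih j.+3 k; [clear -hn jz l2; lia | exact: l2 | exact: kz | exact: E3 |].
  rewrite (negbTE t3) => -[s [hs1 hs2 hs3]]; have [p ep] := bin_surj hs1.
  have jk : j < k by clear -lt; lia.
  split=> //; exists (Atom p); apply: fin_ => //.
  by rewrite /enc_nat ep; split.
- by have e : j.+3 = k by [apply: h1; rewrite c]; split; [lia | exists Bot; apply: fin_ => //; lia].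
- case/andP: ok => /andP[_ t3] /eqP l3.
  have [|||a [b [l [h jk]]]] := bin_ (lev (cc j)) => //; first by rewrite c.
  by split=> //; exists (Or a b); apply: fin_ => //; split=> //; exists l.
- case/andP: ok => /andP[_ t3] /eqP l3.
  have [|||a [b [l [h jk]]]] := bin_ (lev (cc j)) => //; first by rewrite c.
  by split=> //; exists (And a b); apply: fin_ => //; split=> //; exists l.
- case/andP: ok => /andP[_ t3] /eqP l3.
  have [|||a [b [l [h jk]]]] := bin_ (lev (cc j)) => //; first by rewrite c.
  by split=> //; exists (Imp a b); apply: fin_ => //; split=> //; exists l.
- case/andP: ok => /andP[/andP[_ lj] t3] l3; have E3 : Erel j.+3 k by apply: h05; rewrite c.
  have [lt /(_ t3) [a]] := ihn j.+3 k (ltn3 j) l2 kz E3.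
  rewrite l3 => na.
  have jk : j < k by clear -lt; lia.
  by split=> //; exists (Next a); apply: fin_ => //; split=> //; apply: negbTE.
- case/andP: ok => /andP[/andP[_ lj] t3] l3.
  have [|||a [b [l [h jk]]]] := bin_ true => //; first by rewrite c.
  by split=> //; exists (Until a b); apply: fin_ => //; split=> //; [apply: negbTE | exists l].
case/andP: ok => /andP[/andP[_ lj] t3] l3.
have [|||a [b [l [h jk]]]] := bin_ true => //; first by rewrite c.
by split=> //; exists (Release a b); apply: fin_ => //; split=> //; [apply: negbTE | exists l].
Qed.

Lemma cd_bits j n : tok (cc j) -> cd j = n -> n < 8 ->
  [/\ bit (cc j) = (3 < n), bit (cc j.+1) = (1 < n %% 4) & bit (cc j.+2) = odd n].
Proof.
rewrite /cd /code => -> <-.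
by case: (bit (cc j)); case: (bit (cc j.+1)); case: (bit (cc j.+2)).
Qed.

Lemma node_enc g lv j k : node g lv j k -> occ (enc g) j /\ k = size (enc g) + j.
Proof.
have pre j' n b0 b1 b2 s : tok (cc j') -> cd j' = n -> n < 8 -> b0 = (3 < n) -> b1 = (1 < n %% 4) ->
   b2 = odd n -> occ s j'.+3 -> occ ([:: b0; b1; b2] ++ s) j'.
  move=> t e n8 -> -> -> h; have [? ? ?] := cd_bits t e n8.
  by rewrite /= !occ_cons.
have two j' l k' a b : (occ a j' /\ l = size a + j') -> (occ b l /\ k' = size b + l) ->
   occ (a ++ b) j' /\ k' = size (a ++ b) + j'.
  move=> [h1 e1] [h2 e2]; split; last by rewrite size_cat; lia.
  by apply/occ_cat; rewrite -e1.
elim: g lv j k => [p||a iha b ihb|a iha b ihb|a iha b ihb|a ih|a iha b ihb|a iha b ihb] lv j k /= [[t _ _ _]].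
- by move=> [c o -> _]; split; [apply: (pre _ _ _ _ _ _ t c) | lia].
- by move=> [c ->]; split=> //; apply: (pre _ _ _ _ _ [::] t c).
- move=> [c [l [_ /iha h1 /ihb h2]]]; have [o e] := two _ _ _ _ _ h1 h2.
  by split; [apply: (pre _ _ _ _ _ _ t c) | rewrite e; lia].
- move=> [c [l [_ /iha h1 /ihb h2]]]; have [o e] := two _ _ _ _ _ h1 h2.
  by split; [apply: (pre _ _ _ _ _ _ t c) | rewrite e; lia].
- move=> [c [l [_ /iha h1 /ihb h2]]]; have [o e] := two _ _ _ _ _ h1 h2.
  by split; [apply: (pre _ _ _ _ _ _ t c) | rewrite e; lia].
- move=> [c _ /ih[o e]].
  by split; [apply: (pre _ _ _ _ _ _ t c) | rewrite e; lia].
- move=> [c _ [l [_ /iha h1 /ihb h2]]]; have [o e] := two _ _ _ _ _ h1 h2.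
  by split; [apply: (pre _ _ _ _ _ _ t c) | rewrite e; lia].
move=> [c _ [l [_ /iha h1 /ihb h2]]]; have [o e] := two _ _ _ _ _ h1 h2.
by split; [apply: (pre _ _ _ _ _ _ t c) | rewrite e; lia].
Qed.

Lemma node_theight g lv j k : node g lv j k -> theight g <= ~~ lv.
Proof.
elim: g lv j k => [p||a iha b ihb|a iha b ihb|a iha b ihb|a ih|a iha b ihb|a iha b ihb] lv j k //= [_].
- by move=> [_ [l [_ /iha ? /ihb]]]; rewrite geq_max => ->; rewrite andbT.
- by move=> [_ [l [_ /iha ? /ihb]]]; rewrite geq_max => ->; rewrite andbT.
- by move=> [_ [l [_ /iha ? /ihb]]]; rewrite geq_max => ->; rewrite andbT.
- by move=> [_ -> /ih].
- by move=> [_ -> [l [_ /iha ? /ihb]]]; rewrite ltnS geq_max => ->; rewrite andbT.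
- by move=> [_ -> [l [_ /iha ? /ihb]]]; rewrite ltnS geq_max => ->; rewrite andbT.
Qed.

Lemma bin_inj : injective bin.
Proof.
have H fuel n : n <= fuel -> bval (binf fuel n) = n.
  elim: fuel n => [|fuel ih] [|n] //= h.
  by rewrite ih ?odd_double_half // ; have := odd_double_half n.+1; lia.
by move=> a b e; rewrite -(H a a) // -/(bin a) e H.
Qed.

Lemma atom_at_node p lv j k : node (Atom p) lv j k -> atom_at cc j.
Proof. by move=> /= [_ [c _ _ _]]; apply/eqP. Qed.

(** Number codes are self-delimiting, so all spans that start at an atom end at the same column;
    [sameid] may therefore quantify over every recorded end. *)
Lemma node_atom_end p lv j k k' : node (Atom p) lv j k -> k' <= z -> Erel j k' -> k' = k.
Proof.
move=> n kz E; have [jB jz] := node_le n.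
have [h1] := @parse_node (z - j).+1 j k' (ltnSn _) jz kz E.
have [t _ _ _] := nodeE n; rewrite t => -[g ng].
move: n ng => /= [_ [c o -> _]].
case: g => /= [q||a b|a b|a b|a|a b|a b] [_]; rewrite ?c.
- move=> [_ o' -> _]; have /bin_inj -> // := occ_encb_inj o o'.
all: by case.
Qed.

Lemma sameidP a b p q la_ ka lb kb : node (Atom p) la_ a ka -> node (Atom q) lb b kb ->
  sameid cc B z a b <-> p = q.
Proof.
move=> na nb; have [oa ea] := node_enc na; have [ob eb] := node_enc nb.
have [_ _ kz ak] := nodeE na; have [_ _ kbz bk] := nodeE nb.
have Ea : Erel a ka by move: na => /= [_ []].
split=> [h|epq].
  have o : occ (enc (Atom p)) b.
    move=> o ho; rewrite -oa //; symmetry; apply/eqP.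
    rewrite ea in ak kz Ea.
    apply: (h (size (enc (Atom p)) + a) _ _ Ea o _ _ (o + a)); lia.
  apply: bin_inj; apply: (@occ_encb_inj _ _ b.+3).
    by move: o; rewrite /= !occ_cons => -[_ [_ []]].
  by move: ob; rewrite /= !occ_cons => -[_ [_ []]].
move=> k kB kz' Ek o oB oz r rB rz <- lt.
rewrite (node_atom_end na kz' Ek) ea in lt.
have lt' : o < size (enc (Atom p)) by lia.
by rewrite oa // ob // -?epq.
Qed.

Section Row.
Variables (x : nat) (H T : trace) (i : nat).
Hypothesis xB : x < B.
Hypothesis xr : crow cc z x.
Hypothesis c1 : C_cond1 cc B z.
Hypothesis c2 : C_cond2 cc B z.
Hypothesis letters : forall p lv j k w, node (Atom p) lv j k -> la (wd w (cc (j + x))) = tr H T w i p.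
Hypothesis before : forall g j k w, is_leaf g -> node g false j k ->
  s0 (wd w (cc (j + x))) = stt H T w g i.

Let K1 j (h : j < B) (hz : j <= z) := c1 xB xr h hz.
Let K2 j l (h : j < B) (hz : j <= z) (hl : l < B) (hlz : l <= z) := c2 xB xr h hz hl hlz.

Lemma row_val1 g j k w : node g true j k -> va (wd w (cc (j + x))) = ev (lf1 H T i) w g.
Proof.
elim: g j k w => [p||a iha b ihb|a iha b ihb|a iha b ihb|a ih|a iha b ihb|a iha b ihb] j k w n;
  have [jB jz] := node_le n; have [_ lv kz _] := nodeE n; have := K1 jB jz; rewrite lv -/(cd j); move: (n) => /= [_].
- by move=> [-> _ _ _] /andP[_ /allwP /(_ w) /eqP ->]; apply: letters n.
- by move=> [-> _] /allwP /(_ w) /negbTE.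
- move=> [c [l [El na nb]]] _; have [lB lz] := node_le nb.
  have := K2 jB jz lB lz El; rewrite -/(cd j) c => /allwP /(_ w) /eqP ->.
  by rewrite (iha _ _ w na) (ihb _ _ w nb).
- move=> [c [l [El na nb]]] _; have [lB lz] := node_le nb.
  have := K2 jB jz lB lz El; rewrite -/(cd j) c => /allwP /(_ w) /eqP ->.
  by rewrite (iha _ _ w na) (ihb _ _ w nb).
- move=> [c [l [El na nb]]] _; have [lB lz] := node_le nb.
  have := K2 jB jz lB lz El; rewrite -/(cd j) c => /allwP /(_ w) /eqP ->.
  rewrite (iha _ _ w na) (ihb _ _ w nb).
  have e1 := iha _ _ true na; have e2 := ihb _ _ true nb.
  by rewrite /= in e1 e2; rewrite e1 e2.
- by case.
- by case.
- by case.
Qed.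

(** At the top level a leaf takes its value from the status after the current letter, hence from the
    prefix up to and including position [i]; arguments of modalities see only the letter at [i]. *)
Lemma row_val0 g j k w : node g false j k ->
  va (wd w (cc (j + x))) = ev (lf0 H T i) w g /\
  (is_leaf g -> s1 (wd w (cc (j + x))) = stt H T w g i.+1).
Proof.
elim: g j k w => [p||a iha b ihb|a iha b ihb|a iha b ihb|a ih|a iha b ihb|a iha b ihb] j k w n;
  have [jB jz] := node_le n; have [_ lv kz _] := nodeE n; have := K1 jB jz; rewrite lv -/(cd j); move: (n) => /= [_].
- move=> [-> _ _ _] /andP[_ /allwP /(_ w) /andP[/eqP e /eqP ->]].
  have e' : s1 (wd w (cc (j + x))) = stt H T w (Atom p) i.+1.
    by rewrite e (before w _ n) // (letters w n).
  by rewrite e'.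
- by move=> [-> _] /allwP /(_ w) /negbTE.
- move=> [c [l [El na nb]]] _; have [lB lz] := node_le nb.
  have := K2 jB jz lB lz El; rewrite -/(cd j) c => /allwP /(_ w) /eqP ->.
  by rewrite (proj1 (iha _ _ w na)) (proj1 (ihb _ _ w nb)).
- move=> [c [l [El na nb]]] _; have [lB lz] := node_le nb.
  have := K2 jB jz lB lz El; rewrite -/(cd j) c => /allwP /(_ w) /eqP ->.
  by rewrite (proj1 (iha _ _ w na)) (proj1 (ihb _ _ w nb)).
- move=> [c [l [El na nb]]] _; have [lB lz] := node_le nb.
  have := K2 jB jz lB lz El; rewrite -/(cd j) c => /allwP /(_ w) /eqP ->.
  rewrite (proj1 (iha _ _ w na)) (proj1 (ihb _ _ w nb)).
  have [e1 _] := iha _ _ true na; have [e2 _] := ihb _ _ true nb.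
  by rewrite /= in e1 e2; rewrite e1 e2.
- move=> [-> _ na] /allwP /(_ w) /andP[/eqP e /eqP ->].
  have e' : s1 (wd w (cc (j + x))) = stt H T w (Next a) i.+1.
    by rewrite e (before w _ n) // (row_val1 w na).
  by rewrite e'.
- move=> [c _ [l [El na nb]]] _; have [lB lz] := node_le nb.
  have := K2 jB jz lB lz El; rewrite -/(cd j) c => /allwP /(_ w) /andP[/eqP e /eqP ->].
  have e' : s1 (wd w (cc (j + x))) = stt H T w (Until a b) i.+1.
    by rewrite e (before w _ n) // (row_val1 w na) (row_val1 w nb).
  by rewrite e'.
- move=> [c _ [l [El na nb]]] _; have [lB lz] := node_le nb.
  have := K2 jB jz lB lz El; rewrite -/(cd j) c => /allwP /(_ w) /andP[/eqP e /eqP ->].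
  have e' : s1 (wd w (cc (j + x))) = stt H T w (Release a b) i.+1.
    by rewrite e (before w _ n) // (row_val1 w na) (row_val1 w nb).
  by rewrite e'.
Qed.
End Row.
End Cert.

(** * Soundness *)

Section Soundness.
Variables (cc : nat -> cell) (B : nat) (w : seq bool).
Notation z := (size w).
Hypothesis zB : z < B.
Hypothesis inE' : forall j, isin (cc j) = (j < z).
Hypothesis bitE : forall j, j < z -> bit (cc j) = nth false w j.
Hypothesis cert : Cert cc B z.
Notation node := (node cc B z).

Let parse : C_parse cc B z := proj1 (proj2 cert).

Lemma root_node : exists f, node f false 0 z.
Proof.
move: cert => [[/andP[t l] E] _].
have [_] := @parse_node cc B z zB inE' parse z.+1 0 z ltac:(lia) isT (leqnn _) E.
by rewrite t (negbTE l).
Qed.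

Lemma root_enc f : node f false 0 z -> w = enc f.
Proof.
move=> n; have [o e] := node_enc zB n; rewrite addn0 in e.
apply: (@eq_from_nth _ false); first by [].
by move=> i hi; rewrite -bitE // -o ?addn0 // -e.
Qed.

Variable f : form.
Hypothesis nf : node f false 0 z.

Definition row (x : nat) := x < B /\ crow cc z x.
Definition succ (x y : nat) := [/\ fin (cc (z + x)) -> fin (cc (z + y)),
  fin (cc (z + x)) \/ x < y, db (cc (z + y)) = da (cc (z + x)) &
  forall j, j <= z -> conf_next (cc j) (cc (j + x)) (cc (j + y))].

Lemma row_succ x : row x -> exists y, row y /\ succ x y.
Proof.
move: cert => [_ [_ [_ [_ [_ [_ [nx _]]]]]]] [xB xr].
have [y [yB [yr [/andP[/implyP h1 /eqP h2] [h3 h4]]]]] := nx x xB xr.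
exists y; split; first by [].
by split=> // j jz; apply: h4 => //; lia.
Qed.

Variable rho : nat -> nat.
Hypothesis rho_row : forall i, row (rho i).
Hypothesis rho_succ : forall i, succ (rho i) (rho i.+1).
Hypothesis rho0 : forall j, j <= z -> conf_start (cc j) (cc (j + rho 0)).

(** T is read off along one fixed path; by [C_twin] any row with the same identifier gives the same
    letters. *)
Definition cert_trace : trace := fun i p =>
  asb (exists lv j k, node (Atom p) lv j k /\ la (wT (cc (j + rho i)))).

(** Before the tail the rows move strictly right, so i <= rho i, and a path that never met [fin]
    would leave the word. *)
Lemma rho_fin : exists n, forall i, n <= i -> fin (cc (z + rho i)).
Proof.
have [n hn] : exists n, fin (cc (z + rho n)).
  apply: NNPP => h.
  have g i : i <= rho i.
    elim: i => // i ih; have [_ [hf|hl] _ _] := rho_succ i; last by lia.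
    by case: h; exists i.
  by have [/(leq_trans _)] := rho_row B; move=> /(_ B.+1) h2 _; have := g B; have [] := rho_row B; lia.
exists n => i hi; rewrite -(subnK hi); elim: (i - n) => // m ih.
by rewrite addSn; have [h _ _ _] := rho_succ (m + n); apply: h.
Qed.

Definition same (x y : nat) := forall j, j <= z -> idI (cc (j + y)) == idI (cc (j + x)).

Lemma twin x y : row x -> row y -> same x y -> fin (cc (z + y)) = fin (cc (z + x)) /\
  forall j, j <= z -> conf_twin (cc j) (cc (j + x)) (cc (j + y)).
Proof.
move: cert => [_ [_ [_ [_ [_ [_ [_ [tw _]]]]]]]] [xB xr] [yB yr] s.
have [/eqP h1 h2] := tw x xB xr y yB yr (fun j _ hz => s j hz).
by split=> // j jz; apply: h2 => //; lia.
Qed.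

Lemma atom_same x p lv j k lv' j' k' : row x -> node (Atom p) lv j k -> node (Atom p) lv' j' k' ->
  la (wH (cc (j + x))) = la (wH (cc (j' + x))) /\ la (wT (cc (j + x))) = la (wT (cc (j' + x))).
Proof.
move: cert => [_ [_ [_ [_ [_ [_ [_ [_ [_ [at_ _]]]]]]]]]] [xB xr] n n'.
have [jB jz] := node_le zB n; have [jB' jz'] := node_le zB n'.
have := at_ x xB xr j jB jz j' jB' jz'; rewrite (atom_at_node n) (atom_at_node n') => /(_ isT).
have s : sameid cc B z j j' by apply/(sameidP zB inE' parse n n').
by move=> /(_ s) /andP[/eqP ? /eqP].
Qed.

Lemma T_letter i x p lv j k : row x -> same (rho i) x -> node (Atom p) lv j k ->
  la (wT (cc (j + x))) = cert_trace i p.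
Proof.
move=> rx sx n; have [jB jz] := node_le zB n.
have [_ /(_ j jz)] := twin (rho_row i) rx sx; rewrite /conf_twin.
have [-> _ _ _] := nodeE n => /andP[_ /eqP ->].
apply/idP/asbP => [h|[lv' [j' [k' [n' h]]]]]; first by exists lv, j, k.
by rewrite (atom_same (rho_row i) n n').2.
Qed.

Section Run.
Variable H : trace.
Hypothesis sub : subtrace H cert_trace.

(* What a row knows about (H, cert_trace) before reading the letter of H at position i. *)
Definition pre_run (i x : nat) := [/\ row x, same (rho i) x,
  forall g j k v, is_leaf g -> node g false j k -> s0 (wd v (cc (j + x))) = stt H cert_trace v g i &
  (exists i' p, i' < i /\ H i' p <> cert_trace i' p) -> db (cc (z + x))].

Definition run (i x : nat) := pre_run i x /\
  forall p lv j k, node (Atom p) lv j k -> la (wH (cc (j + x))) = H i p.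

Lemma atom_unique p q lv j k lv' k' : node (Atom p) lv j k -> node (Atom q) lv' j k' -> p = q.
Proof.
move=> n n'; apply/(sameidP zB inE' parse n n') => k1 _ _ _ o _ _ r _ _ <- _.
exact: eqxx.
Qed.

Lemma toggle i y p lv j k : pre_run i y -> node (Atom p) lv j k -> la (wH (cc (j + y))) <> H i p ->
  exists y', pre_run i y' /\ forall q lv' j' k', node (Atom q) lv' j' k' ->
    la (wH (cc (j' + y'))) = if p == q then ~~ la (wH (cc (j' + y))) else la (wH (cc (j' + y))).
Proof.
move=> [ry sy st df] n ne; have [jB jz] := node_le zB n; move: (ry) => [yB yr].
move: cert => [_ [_ [_ [c1 [_ [tg _]]]]]].
(* If the bits disagree, the atom is in the letter of the row or in H at [i]; either way it is in T,
   by [C_cond1] or by [sub]. *)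
have laT : la (wT (cc (j + y))).
  rewrite (T_letter ry sy n).
  have := c1 y yB yr j jB jz; have /= [_ [c _ _ _]] := n; rewrite -/(cd cc j) c => /andP[].
  rewrite (T_letter ry sy n) => hT _; move: ne hT (@sub i p).
  by case: (la _); case: (H i p) => //= _ _ -> .
have := tg y yB yr j jB jz; rewrite (atom_at_node n) laT => /(_ isT).
move=> [y' [yB' [yr' [/eqP dbE hj]]]]; exists y'; split.
  split=> //.
  - move=> j' jz'; have [|/andP[/eqP -> _] _] := hj j' _ jz'; first by lia.
    exact: sy.
  - move=> g j' k' v lg ng; rewrite -(st _ _ _ v lg ng).
    have [jB' jz'] := node_le zB ng; have [t _ _ _] := nodeE ng.
    have [/andP[_ h] _] := hj j' jB' jz'; move: h; rewrite t.
    by move=> /allwP /(_ v) /eqP.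
  - by rewrite dbE.
move=> q lv' j' k' n'; have [jB' jz'] := node_le zB n'.
have [_ /(_ (atom_at_node n'))] := hj j' jB' jz'.
case: (eqVneq p q) => [epq|/eqP epq] [[s /eqP //]|[s /eqP //]].
  by have := s (proj2 (sameidP zB inE' parse n n') epq).
by case: epq; apply/(sameidP zB inE' parse n n').
Qed.

(** Columns are corrected from left to right. A toggle changes only the columns of one atom, and by
    [atom_same] all of these were wrong, so nothing already correct is spoiled. *)
Lemma fix_letters i x : pre_run i x -> exists y, run i y.
Proof.
move=> px.
have fix_ m : exists y, pre_run i y /\ forall p lv j k, j < m ->
    node (Atom p) lv j k -> la (wH (cc (j + y))) = H i p.
  elim: m => [|m [y [py hy]]]; first by exists x.
  case: (classic (exists p lv k, node (Atom p) lv m k /\ la (wH (cc (m + y))) <> H i p)); last first.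
    move=> h; exists y; split=> // p lv j k; rewrite ltnS leq_eqVlt => /orP[/eqP ->|].
      by move=> n; apply: NNPP => ne; apply: h; exists p, lv, k.
    by move=> lt n; apply: hy lt n.
  move=> [p [lv [k [n ne]]]]; have [y' [py' hy']] := toggle py n ne.
  exists y'; split=> // q lv' j' k' lt n'; rewrite (hy' _ _ _ _ n').
  case: eqP => epq.
    have ry : row y by case: py.
    rewrite -epq in n' *; rewrite (atom_same ry n' n).1; move: ne.
    by case: (la _); case: (H i p).
  move: lt; rewrite ltnS leq_eqVlt => /orP[/eqP e|lt]; last exact: hy lt n'.
  by case: epq; rewrite e in n'; apply: atom_unique n n'.
have [y [py hy]] := fix_ B; exists y; split=> // p lv j k n.
by have [jB _] := node_le zB n; apply: hy n.
Qed.

Lemma run_letters i x : run i x -> forall p lv j k v, node (Atom p) lv j k ->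
  la (wd v (cc (j + x))) = tr H cert_trace v i p.
Proof.
move=> [[rx sx _ _] h] p lv j k [] n; last exact: h n.
exact: T_letter n.
Qed.

Lemma run_diff i x : run i x -> (exists i' p, i' <= i /\ H i' p <> cert_trace i' p) -> da (cc (z + x)).
Proof.
move=> rx [i' [p [hi ne]]]; have [[[xB xr] sx _ df] hH] := rx.
move: cert => [_ [_ [_ [_ [_ [_ [_ [_ [df_ _]]]]]]]]].
have [/implyP h1 h2] := df_ x xB xr.
move: hi; rewrite leq_eqVlt => /orP[/eqP ei|lt]; last first.
  by apply: h1; apply: df; exists i', p.
subst i'; have Tp : cert_trace i p.
  by move: ne (@sub i p); case: (H i p); case: (cert_trace i p) => // _ /(_ isT).
have [lv [j [k [n _]]]] := elimT (asbP _) Tp.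
have [jB jz] := node_le zB n.
have := h2 j jB jz; rewrite (atom_at_node n) (hH _ _ _ _ n).
by rewrite (T_letter (conj xB xr) sx n); move/eqP: ne => ->.
Qed.

(** The successor of a row carries the right statuses but an arbitrary here-letter, which
    [fix_letters] adjusts to H. Its identifier agrees with that of the path [rho] by [C_twin]. *)
Lemma run_ex i : exists x, run i x.
Proof.
elim: i => [|i [x rx]].
  apply: (@fix_letters 0 (rho 0)); split.
  - exact: rho_row.
  - by move=> j _.
  - move=> g j k v _ n; have [jB jz] := node_le zB n; have [t _ _ _] := nodeE n.
    by have := rho0 jz; rewrite /conf_start t => /allwP /(_ v) /eqP.
  - by move=> [i' [p []]].
have [[rwx sx st df] hH] := rx; have [y [ry [f1 f2 f3 f4]]] := row_succ rwx.
apply: (@fix_letters i.+1 y); split=> //.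
- move=> j jz; have /andP[/eqP -> _] := f4 j jz.
  have [_ /(_ j jz) /andP[/eqP -> _]] := twin (rho_row i) rwx sx.
  have [_ _ _ /(_ j jz) /andP[/eqP -> _]] := rho_succ i.
  exact: eqxx.
- move=> g j k v lg n; have [jB jz] := node_le zB n; have [t _ _ _] := nodeE n.
  have /andP[_] := f4 j jz; rewrite t => /allwP /(_ v) /eqP ->.
  move: cert => [_ [_ [_ [c1 [c2 _]]]]]; move: rwx => [xB xr].
  exact: (row_val0 zB xB xr c1 c2 (run_letters rx) st v n).2.
- by move=> h; rewrite f3; apply: run_diff rx _.
Qed.

Lemma run_value i x v : run i x -> va (wd v (cc (0 + x))) = ev (lf0 H cert_trace i) v f.
Proof.
move=> rx; have [[[xB xr] sx st df] hH] := rx.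
move: cert => [_ [_ [_ [c1 [c2 _]]]]].
exact: (row_val0 zB xB xr c1 c2 (run_letters rx) st v nf).1.
Qed.

Lemma run_sat : (exists i p, H i p <> cert_trace i p) -> ~ sat H cert_trace 0 f.
Proof.
move=> [i' [p ne]] s; have hf := node_theight nf.
have [i0 h] := ev_limit H cert_trace hf; have [n hn] := rho_fin.
(* Late enough for three things: the difference has been read, the value of [f] has reached its
   limit, and the row lies in the tail. *)
set i := maxn i' (maxn i0 n); have [x rx] := run_ex i.
have [[[xB xr] sx _ _] _] := rx.
have fx : fin (cc (z + x)).
  by rewrite (twin (rho_row i) (conj xB xr) sx).1; apply: hn; rewrite /i; lia.
have dx : da (cc (z + x)) by apply: (run_diff rx); exists i', p; split=> //; rewrite /i; lia.
have [_ [_ [_ [_ [_ [_ [_ [_ [_ [_ cf]]]]]]]]]] := cert.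
have := cf x xB xr; rewrite fx dx => /andP[_].
rewrite -/(wd false (cc (0 + x))) (run_value false rx) => /negP; apply.
by apply/h => //; rewrite /i; lia.
Qed.

Lemma run_satT : sat cert_trace cert_trace 0 f.
Proof.
have hf := node_theight nf.
have [i0 h] := ev_limit H cert_trace hf; have [n hn] := rho_fin.
set i := maxn i0 n; have [x rx] := run_ex i.
have [[[xB xr] sx _ _] _] := rx.
have fx : fin (cc (z + x)).
  by rewrite (twin (rho_row i) (conj xB xr) sx).1; apply: hn; rewrite /i; lia.
have [_ [_ [_ [_ [_ [_ [_ [_ [_ [_ cf]]]]]]]]]] := cert.
have := cf x xB xr; rewrite fx => /andP[+ _].
rewrite -/(wd true (cc (0 + x))) (run_value true rx) => v.
by apply/(h i true) => //; rewrite /i; lia.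
Qed.

End Run.

Lemma equilibrium_T : equilibrium_model cert_trace f.
Proof.
by split; [apply: (@run_satT cert_trace) => // | move=> H sub; apply: run_sat].
Qed.
End Soundness.

Theorem Cert_sound cc B w : size w < B -> (forall j, isin (cc j) = (j < size w)) ->
  (forall j, j < size w -> bit (cc j) = nth false w j) -> Cert cc B (size w) -> CON_THT1 w.
Proof.
move=> zB inE' bitE cert; have [f nf] := root_node zB inE' cert.
exists f; split; first exact: root_enc nf.
split; first by have := node_theight nf.
have [_ [_ [[x [xB [xr x0]]] _]]] := cert.
have rx : row cc B w x by [].
have [rho [rho0 h]] := chain rx (row_succ zB cert).
exists (cert_trace cc B w rho); apply: (equilibrium_T zB inE' cert nf) => [i|i|j jz].
- exact: (h i).1.
- exact: (h i).2.
by rewrite rho0; apply: x0 => //; lia.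
Qed.

(** * Completeness *)

(* The subformula of g whose code starts at offset j of [enc g], with its level. *)
Fixpoint look (g : form) (lv : bool) (j : nat) {struct g} : option (form * bool) :=
  if j is j'.+3 then
    match g with
    | Atom _ | Bot => None
    | Or a b | And a b | Imp a b =>
        if j' < size (enc a) then look a lv j' else look b lv (j' - size (enc a))
    | Next a => look a true j'
    | Until a b | Release a b =>
        if j' < size (enc a) then look a true j' else look b true (j' - size (enc a))
    end
  else if j is 0 then Some (g, lv) else None.

Lemma look0 g lv : look g lv 0 = Some (g, lv). Proof. by case: g. Qed.

Lemma size_enc_gt2 g : 2 < size (enc g). Proof. by case: g. Qed.

Lemma look_shift g lv j h lv' : look g lv j = Some (h, lv') ->
  j + size (enc h) <= size (enc g) /\ forall o, o < size (enc h) ->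
  look g lv (j + o) = look h lv' o /\ nth false (enc g) (j + o) = nth false (enc h) o.
Proof.
have two (a b : form) lva (LK : nat -> option (form * bool)) j' :
  (forall lv j, look a lv j = Some (h, lv') -> j + size (enc h) <= size (enc a) /\
    forall o, o < size (enc h) -> look a lv (j + o) = look h lv' o /\ nth false (enc a) (j + o) = nth false (enc h) o) ->
  (forall lv j, look b lv j = Some (h, lv') -> j + size (enc h) <= size (enc b) /\
    forall o, o < size (enc h) -> look b lv (j + o) = look h lv' o /\ nth false (enc b) (j + o) = nth false (enc h) o) ->
  (forall j, LK j = if j < size (enc a) then look a lva j else look b lva (j - size (enc a))) ->
  LK j' = Some (h, lv') -> j' + size (enc h) <= size (enc a ++ enc b) /\ forall o, o < size (enc h) ->
  LK (j' + o) = look h lv' o /\ nth false (enc a ++ enc b) (j' + o) = nth false (enc h) o.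
  move=> iha ihb LE; rewrite LE size_cat; case: ltnP => jl.
    move=> /iha[h1 h2]; split; first by lia.
    move=> o ho; rewrite LE nth_cat (_ : j' + o < size (enc a)); first exact: h2.
    by clear -ho h1; lia.
  move=> /ihb[h1 h2]; split; first by clear -jl h1; lia.
  move=> o ho; rewrite LE nth_cat ltnNge (leq_trans jl (leq_addr _ _)) /=.
  by rewrite (_ : j' + o - size (enc a) = j' - size (enc a) + o); [exact: h2 | clear -jl; lia].
elim: g lv j => [p||a iha b ihb|a iha b ihb|a iha b ihb|a ih|a iha b ihb|a iha b ihb] lv [|[|[|j]]] //;
  try by (move=> [<- <-]; split=> //; rewrite add0n).
- by apply: (@two a b lv (fun j => look (Or a b) lv j.+3) j iha ihb).
- by apply: (@two a b lv (fun j => look (And a b) lv j.+3) j iha ihb).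
- by apply: (@two a b lv (fun j => look (Imp a b) lv j.+3) j iha ihb).
- by apply: ih.
- by apply: (@two a b true (fun j => look (Until a b) lv j.+3) j iha ihb).
- by apply: (@two a b true (fun j => look (Release a b) lv j.+3) j iha ihb).
Qed.

Lemma look_theight g lv j h lv' : theight g <= ~~ lv -> look g lv j = Some (h, lv') ->
  theight h <= ~~ lv'.
Proof.
elim: g lv j => [p||a iha b ihb|a iha b ihb|a iha b ihb|a ih|a iha b ihb|a iha b ihb] lv [|[|[|j]]] //;
  try by move=> ? [<- <-].
- by move=> /theight_max[ha hb] /=; case: ltnP => _; [apply: iha | apply: ihb].
- by move=> /theight_max[ha hb] /=; case: ltnP => _; [apply: iha | apply: ihb].
- by move=> /theight_max[ha hb] /=; case: ltnP => _; [apply: iha | apply: ihb].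
- by move=> ha /=; apply: ih; case: (lv) ha.
- move=> hh /=; have /theight_max[ha hb] : maxn (theight a) (theight b) <= 0 by case: (lv) hh.
  by case: ltnP => _; [apply: iha | apply: ihb].
move=> hh /=; have /theight_max[ha hb] : maxn (theight a) (theight b) <= 0 by case: (lv) hh.
by case: ltnP => _; [apply: iha | apply: ihb].
Qed.

Lemma look_atoms g lv j p lv' : look g lv j = Some (Atom p, lv') -> p \in atoms g.
Proof.
elim: g lv j => [q||a iha b ihb|a iha b ihb|a iha b ihb|a ih|a iha b ihb|a iha b ihb] lv [|[|[|j]]] //=.
- by move=> [-> _]; rewrite mem_head.
- by rewrite mem_cat; case: ltnP => _ => [/iha ->|/ihb ->]; rewrite ?orbT.
- by rewrite mem_cat; case: ltnP => _ => [/iha ->|/ihb ->]; rewrite ?orbT.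
- by rewrite mem_cat; case: ltnP => _ => [/iha ->|/ihb ->]; rewrite ?orbT.
- exact: ih.
- by rewrite mem_cat; case: ltnP => _ => [/iha ->|/ihb ->]; rewrite ?orbT.
by rewrite mem_cat; case: ltnP => _ => [/iha ->|/ihb ->]; rewrite ?orbT.
Qed.

Lemma size_enc_atoms g : size (atoms g) + 3 <= size (enc g).
Proof. by elim: g => //= [p|a iha b ihb|a iha b ihb|a iha b ihb|a ih|a iha b ihb|a iha b ihb]; rewrite ?size_cat //=; lia. Qed.

Lemma bin_last n : last true (bin n).
Proof.
rewrite /bin; suff H fuel k : k <= fuel -> last true (binf fuel k) by apply: H.
elim: fuel k => [|fuel ih] [|k] // h.
have hd := odd_double_half k.+1; rewrite [binf _ _]/= -[uphalf k]/(k.+1./2).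
move: hd; move: (k.+1./2) => k' hd.
have kf : k' <= fuel by move: hd; rewrite -addnn; case: k' => //; lia.
have := ih _ kf; case: k' hd kf => [|k'] hd; last by case: (fuel).
by move: hd; rewrite /=; case: (odd k) => //= _; case: (fuel).
Qed.

Lemma size_encb s : size (encb s) = (size s).*2.+1.
Proof. by elim: s => //= b s; rewrite /encb /= => ->. Qed.

(** A row may stem from an infinite H, but over a finite alphabet only finitely many rows exist;
    they are selected classically among all words of length [m]. *)
Lemma listing (X : finType) (m : nat) (P : seq X -> Prop) : (forall s, P s -> size s = m) ->
  exists L : seq (seq X), (forall s, s \in L <-> P s) /\ size L <= #|X| ^ m.
Proof.
move=> hP; exists [seq val t | t <- enum {: m.-tuple X} & asb (P (val t))]; split=> [s|].
  split; first by case/mapP => t; rewrite mem_filter => /andP[/asbP h _] ->.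
  move=> h; have /eqP hs := hP s h; apply/mapP; exists (Tuple hs) => //.
  by rewrite mem_filter mem_enum andbT; apply/asbP.
rewrite size_map size_filter -card_tuple cardE; exact: count_size.
Qed.

Lemma nth_flatten_rows (X : Type) (x0 : X) (m : nat) (R : seq (seq X)) i j :
  (forall r, r < size R -> size (nth [::] R r) = m) -> i < size R -> j < m ->
  nth x0 (flatten R) (i * m + j) = nth x0 (nth [::] R i) j.
Proof.
elim: R i => //= r R ih [|i] h hi hj.
  by rewrite mul0n nth_cat (h 0 isT : size r = m) hj.
rewrite nth_cat (h 0 isT : size r = m) mulSn -addnA ltnNge leq_addr /= addKn.
by apply: ih => // k; apply: (h k.+1).
Qed.

Lemma size_flatten_rows (X : Type) (m : nat) (R : seq (seq X)) :
  (forall r, r < size R -> size (nth [::] R r) = m) -> size (flatten R) = size R * m.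
Proof.
elim: R => //= r R ih h; rewrite size_cat (h 0 isT : size r = m) ih // => k; exact: (h k.+1).
Qed.

(** Supplies the order demanded by [C_next]: each row of a later block occurs further right. *)
Lemma flatten_blocks (X : eqType) (x0 : X) (BL : nat -> seq X) n k a :
  a < size (flatten [seq BL i | i <- iota k n]) ->
  exists b, [/\ k <= b < k + n, nth x0 (flatten [seq BL i | i <- iota k n]) a \in BL b &
    forall b' r, b < b' -> b' < k + n -> r \in BL b' ->
    exists a', [/\ a < a', a' < size (flatten [seq BL i | i <- iota k n]) &
      nth x0 (flatten [seq BL i | i <- iota k n]) a' = r]].
Proof.
elim: n k a => //= n ih k a; rewrite size_cat nth_cat => hs; case: (ltnP a (size (BL k))) => ha.
  exists k; split; [lia | exact: mem_nth |] => b' r h1 h2 hr.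
  have hin : r \in flatten [seq BL i | i <- iota k.+1 n].
    by apply/flatten_mapP; exists b' => //; rewrite mem_iota; lia.
  exists (size (BL k) + index r (flatten [seq BL i | i <- iota k.+1 n])).
  split; first by lia.
    by rewrite ltn_add2l index_mem.
  by rewrite nth_cat ltnNge leq_addr /= addKn nth_index.
have [|b [hb1 hb2 hb3]] := ih k.+1 (a - size (BL k)); first by lia.
exists b; split=> //; first by lia.
move=> b' r h1 h2 hr; have [|a' [h3 h4 h5]] := hb3 b' r h1 _ hr; first by lia.
exists (size (BL k) + a'); split; [lia | by rewrite ltn_add2l|].
by rewrite nth_cat ltnNge leq_addr /= addKn.
Qed.

Lemma nth_encb s t : (nth false (encb s) t.*2 = (t < size s)) *
  (t < size s -> nth false (encb s) t.*2.+1 = nth false s t).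
Proof.
elim: s t => [|b s ih] [|t]; rewrite ?encb_cons //.
by rewrite doubleS /= ltnS; have [h1 h2] := ih t; split.
Qed.

Definition op (g : form) : nat :=
  match g with
  | Atom _ => 0 | Bot => 1 | Or _ _ => 2 | And _ _ => 3
  | Imp _ _ => 4 | Next _ => 5 | Until _ _ => 6 | Release _ _ => 7
  end.

(** Identifiers need only be injective, so the enumeration of all bit vectors replaces binary
    notation. *)
Definition binary_idx (m b : nat) : {ffun 'I_m.+1 -> bool} :=
  nth [ffun => false] (enum {: {ffun 'I_m.+1 -> bool}}) b.
Definition idb (m b j : nat) : bool := binary_idx m b (inord j).

Lemma idb_inj m b b' : b < 2 ^ m.+1 -> b' < 2 ^ m.+1 -> (forall j, j <= m -> idb m b j = idb m b' j) -> b = b'.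
Proof.
move=> hb hb' h.
have sz : size (enum {: {ffun 'I_m.+1 -> bool}}) = 2 ^ m.+1.
  by rewrite -cardE card_ffun card_bool card_ord.
apply/eqP; rewrite -(nth_uniq [ffun => false] _ _ (enum_uniq {: {ffun 'I_m.+1 -> bool}})) ?sz //.
apply/eqP/ffunP => i; have := h i; rewrite /idb inord_val; apply.
by rewrite -ltnS.
Qed.

Lemma input_shape c w k : map cin c = map Some w ++ nseq k None ->
  (forall j, isin (nth cell0 c j) = (j < size w)) /\
  (forall j, j < size w -> bit (nth cell0 c j) = nth false w j).
Proof.
move=> e.
have nc j : cin (nth cell0 c j) = if j < size w then Some (nth false w j) else None.
  case: (ltnP j (size c)) => hj; last first.
    rewrite nth_default //; case: ltnP => // jw.
    by have := congr1 size e; rewrite size_map size_cat size_map; lia.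
  rewrite -(nth_map _ None) // e nth_cat size_map; case: ltnP => jw; first by rewrite (nth_map false).
  by rewrite nth_nseq; case: ifP.
split=> j; first by have := nc j; rewrite /cin; case: isin; case: ltnP.
by move=> h; have := nc j; rewrite h /cin; case: isin => // -[].
Qed.

(** * The certificate of a small equilibrium model *)

Section Build.
Variables (f : form) (T : trace) (N : nat).
Hypothesis hf : THT1 f.
Hypothesis eqm : equilibrium_model T f.
Hypothesis N0 : 0 < N.
Hypothesis Tc : forall k, N <= k -> T k =1 T N.
Hypothesis Nb : N <= 2 ^ size (atoms f) + 2.
Notation w := (enc f).
Notation z := (size (enc f)).
Notation lk := (look f false).

Definition row0cell (j : nat) : cell :=
  Cell (j == 0) (j < z) (nth false w j) (isSome (lk j)) (if lk j is Some (_, lv) then lv else false)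
    false false false false false false false false wdata0 wdata0.
Definition treecell (a b j : nat) : cell :=
  Cell (j == 0) false false false false (j == a) (j == b) false false false false false false wdata0 wdata0.

Definition diff (H : trace) (i : nat) : bool :=
  has (fun k => has (fun p => H k p != T k p) (atoms f)) (iota 0 i).
Definition confw (H : trace) (i : nat) (v : bool) (j : nat) : wdata :=
  if lk j is Some (g, lv) then
    WData (if g is Atom p then tr H T v i p else false)
      (ev (if lv then lf1 H T i else lf0 H T i) v g) (stt H T v g i) (stt H T v g i.+1)
  else wdata0.
(** All positions from [N] on share one identifier, since T is constant there; [minn] thus makes
    finitely many identifiers serve all [i]. *)
Definition confcell (H : trace) (i j : nat) : cell :=
  Cell (j == 0) false false false false false false true (N <= i) (diff H i.+1) (diff H i)
    (idb z (minn i N) j) (idb z (minn i.+1 N) j) (confw H i false j) (confw H i true j).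

Lemma wd_conf H i j v : wd v (confcell H i j) = confw H i v j.
Proof. by case: v. Qed.

Definition mkrow (F : nat -> cell) : seq cell := mkseq F z.+1.

(* Spans of subformulas and of the suffixes of atom numbers. *)
Definition EP (j k : nat) := (exists g lv, lk j = Some (g, lv) /\ k = size (enc g) + j) \/
  (exists p lv j0 t, [/\ lk j0 = Some (Atom p, lv), t <= size (bin p),
     j = t.*2 + j0.+3 & k = size (enc (Atom p)) + j0]).

Definition tree_row s := exists a b, [/\ a <= z, b <= z, EP a b & s = mkrow (treecell a b)].
(** H ranges over all traces below T and [i] over all positions, so closure under toggling and
    succession holds by construction. *)
Definition conf_row b s := exists H i, [/\ subtrace H T, minn i N = b & s = mkrow (confcell H i)].

Lemma tree_listing : exists L : seq (seq cell), (forall s, s \in L <-> tree_row s) /\ size L <= #|cell : finType| ^ z.+1.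
Proof. by apply: listing => s [a [b [_ _ _ e]]]; rewrite e size_mkseq. Qed.
Lemma conf_listing b : exists L : seq (seq cell), (forall s, s \in L <-> conf_row b s) /\ size L <= #|cell : finType| ^ z.+1.
Proof. by apply: listing => s [H [i [_ _ e]]]; rewrite e size_mkseq. Qed.

Definition SL := proj1_sig (constructive_indefinite_description _ tree_listing).
Lemma SLP s : s \in SL <-> tree_row s.
Proof. exact: (proj1 (proj2_sig (constructive_indefinite_description _ tree_listing))). Qed.
Lemma SL_size : size SL <= #|cell : finType| ^ z.+1.
Proof. exact: (proj2 (proj2_sig (constructive_indefinite_description _ tree_listing))). Qed.
Definition BL b := proj1_sig (constructive_indefinite_description _ (conf_listing b)).
Lemma BLP b s : s \in BL b <-> conf_row b s.
Proof. exact: (proj1 (proj2_sig (constructive_indefinite_description _ (conf_listing b)))). Qed.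
Lemma BL_size b : size (BL b) <= #|cell : finType| ^ z.+1.
Proof. exact: (proj2 (proj2_sig (constructive_indefinite_description _ (conf_listing b)))). Qed.

Definition blocks := flatten [seq BL b | b <- iota 0 N.+1].
Definition pre := mkrow row0cell :: SL.
Definition Rows := pre ++ blocks.
Definition word := flatten Rows.
Notation cc := (nth cell0 word).
Notation B := (size word).

Lemma mem_blocks s : s \in blocks <-> exists H i, subtrace H T /\ s = mkrow (confcell H i).
Proof.
split=> [/flatten_mapP[b _ /BLP[H [i [h _ ->]]]]|[H [i [h ->]]]]; first by exists H, i.
apply/flatten_mapP; exists (minn i N); first by rewrite mem_iota; lia.
by apply/BLP; exists H, i.
Qed.

Lemma mem_Rows s : s \in Rows -> exists F, [/\ s = mkrow F & forall j, rs (F j) = (j == 0)].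
Proof.
rewrite /Rows /pre cat_cons inE mem_cat => /or3P[/eqP ->|/SLP[a [b [_ _ _ ->]]]|/mem_blocks[H [i [_ ->]]]].
- by exists row0cell.
- by exists (treecell a b).
by exists (confcell H i).
Qed.

Lemma row_size i : i < size Rows -> size (nth [::] Rows i) = z.+1.
Proof. by move=> /(mem_nth [::]) /mem_Rows[F [-> _]]; rewrite size_mkseq. Qed.

Lemma word_size : B = size Rows * z.+1.
Proof. exact: size_flatten_rows row_size. Qed.

Lemma ccE i j : i < size Rows -> j <= z -> cc (j + i * z.+1) = nth cell0 (nth [::] Rows i) j.
Proof. by move=> hi hj; rewrite addnC; apply: nth_flatten_rows row_size hi _. Qed.

Lemma row_of x : x < B -> rs (cc x) -> exists i, [/\ i < size Rows, x = i * z.+1 & forall j, j <= z ->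
  cc (j + x) = nth cell0 (nth [::] Rows i) j].
Proof.
move=> xB; have hi : x %/ z.+1 < size Rows by rewrite ltn_divLR // -word_size.
have hj : x %% z.+1 <= z by rewrite -ltnS ltn_mod.
rewrite {1}(divn_eq x z.+1) addnC ccE //.
have [F [-> h]] := mem_Rows (mem_nth [::] hi); rewrite nth_mkseq // h => /eqP e.
exists (x %/ z.+1); have ex : x = x %/ z.+1 * z.+1 by rewrite {1}(divn_eq x z.+1) e addn0.
by split=> // j jz; rewrite {1}ex ccE.
Qed.

Definition is_row (F : nat -> cell) (x : nat) := [/\ x < B, rs (cc x) & forall j, j <= z -> cc (j + x) = F j].

Lemma row_at i F : i < size Rows -> nth [::] Rows i = mkrow F -> rs (F 0) -> is_row F (i * z.+1).
Proof.
move=> hi e r; have H j : j <= z -> cc (j + i * z.+1) = F j.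
  by move=> hj; rewrite ccE // e nth_mkseq.
by split=> //; [rewrite word_size ltn_mul2r | rewrite -[i * _]add0n H].
Qed.

Lemma row_ex s F : s \in Rows -> s = mkrow F -> rs (F 0) -> exists x, is_row F x.
Proof.
move=> h e r; exists (index s Rows * z.+1); apply: row_at => //; first by rewrite index_mem.
by rewrite nth_index.
Qed.

Lemma row0 j : j <= z -> cc j = row0cell j.
Proof. by move=> hj; rewrite -[j in LHS]addn0 -[0](mul0n z.+1) ccE // nth_mkseq. Qed.

Lemma tree_row_ex a b : a <= z -> b <= z -> EP a b -> exists x, is_row (treecell a b) x.
Proof.
move=> ha hb e; apply: (row_ex (s := mkrow (treecell a b))) => //.
by rewrite /Rows /pre cat_cons inE mem_cat; apply/or3P/Or32/SLP; exists a, b.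
Qed.

Lemma conf_row_ex H i : subtrace H T -> exists x, is_row (confcell H i) x.
Proof.
move=> h; apply: (row_ex (s := mkrow (confcell H i))) => //.
by rewrite /Rows mem_cat; apply/orP; right; apply/mem_blocks; exists H, i.
Qed.

Lemma row_cases x : x < B -> rs (cc x) ->
  [\/ is_row row0cell x, exists a b, EP a b /\ is_row (treecell a b) x |
   exists H i, [/\ subtrace H T, is_row (confcell H i) x & forall H' i', subtrace H' T ->
     minn i N < minn i' N -> exists y, x < y /\ is_row (confcell H' i') y]].
Proof.
move=> xB r; have [i [hi ex h]] := row_of xB r.
have := hi; rewrite /Rows size_cat => hi2.
case: (ltnP i (size pre)) => ip.
  have := mem_nth [::] ip; rewrite inE => /orP[/eqP e|/SLP[a [b [_ _ E e]]]].
    apply: Or31; split=> // j jz; rewrite h // /Rows nth_cat ip e nth_mkseq //.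
  apply: Or32; exists a, b; split=> //; split=> // j jz; by rewrite h // /Rows nth_cat ip e nth_mkseq.
have [|b [bN /BLP[H [i1 [hs eb e]]] later]] := @flatten_blocks _ [::] BL N.+1 0 (i - size pre).
  by rewrite ltn_subLR // ; exact: hi2.
apply: Or33; exists H, i1; split=> //.
  by split=> // j jz; rewrite h // /Rows nth_cat ltnNge ip /= e nth_mkseq.
move=> H' i' hs' lt.
have [|||a' [h1 h2 h3]] := later (minn i' N) (mkrow (confcell H' i')).
- by rewrite -eb.
- by lia.
- by apply/BLP; exists H', i'.
exists ((size pre + a') * z.+1); split; first by rewrite ex ltn_mul2r /= -(ltn_subLR _ ip).
apply: row_at => //; first by rewrite size_cat ltn_add2l.
by rewrite /Rows nth_cat ltnNge leq_addr /= addKn.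
Qed.

Lemma crowP x : x < B -> crow cc z x ->
   exists H i, [/\ subtrace H T, is_row (confcell H i) x & forall H' i', subtrace H' T ->
     minn i N < minn i' N -> exists y, x < y /\ is_row (confcell H' i') y].
Proof.
move=> xB /andP[r cf]; case: (row_cases xB r) => // [[_ _ h]|[a [b [_ [_ _ h]]]]].
  by rewrite h in cf.
by rewrite h in cf.
Qed.

Lemma conf_crow H i x : is_row (confcell H i) x -> x < B /\ crow cc z x.
Proof. by move=> [xB r h]; split=> //; rewrite /crow r h. Qed.

Lemma ErelP j k : j <= z -> k <= z -> Erel cc B j k <-> EP j k.
Proof.
move=> hj hk; split.
  move=> [x [xB /and3P[r]]]; case: (row_cases xB r) => [[_ _ h]|[a [b [E [_ _ h]]]]|[H [i [_ [_ _ h] _]]]];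
    rewrite !h //= => /eqP -> /eqP -> //.
move=> E; have [x [xB r h]] := tree_row_ex hj hk E; exists x; split=> //.
by rewrite r !h //= ?eqxx.
Qed.

Lemma word_input : exists k, map cin word = map Some w ++ nseq k None.
Proof.
have others (R : seq (seq cell)) : (forall s, s \in R -> all (fun x => ~~ isin x) s) ->
  map cin (flatten R) = nseq (size (flatten R)) None.
  move=> h; have : all (fun x => ~~ isin x) (flatten R).
    by apply/allP => x /flattenP[s /h /allP]; apply.
  by elim: (flatten R) => //= x s ih /andP[nx /ih ->]; rewrite /cin (negbTE nx).
have rest s : s \in SL ++ blocks -> all (fun x => ~~ isin x) s.
  rewrite mem_cat => /orP[/SLP[a [b [_ _ _ ->]]]|/mem_blocks[H [i [_ ->]]]];
  by apply/allP => x /mapP[j _ ->].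
rewrite -[word]/(mkrow row0cell ++ flatten (SL ++ blocks)) map_cat (others _ rest).
exists (size (flatten (SL ++ blocks))).+1.
have -> : map cin (mkrow row0cell) = map Some w ++ [:: None].
  rewrite /mkrow /mkseq -addn1 iotaD !map_cat /= add0n /cin /= ltnn; congr (_ ++ _).
  rewrite -[in RHS](mkseq_nth false w) /mkseq -!map_comp; apply/eq_in_map => j.
  by rewrite mem_iota add0n /= /cin /= => ->.
by rewrite -catA.
Qed.

Lemma word_bound : B <= (1 + #|cell : finType| ^ z.+1 + N.+1 * #|cell : finType| ^ z.+1) * z.+1.
Proof.
rewrite word_size; apply: leq_mul => //; rewrite /Rows size_cat leq_add //.
  by rewrite /pre /= add1n ltnS SL_size.
rewrite /blocks -[X in _ <= X * _](size_iota 0 N.+1); elim: (iota 0 N.+1) => //= b s ih.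
by rewrite size_cat mulSn leq_add // BL_size.
Qed.

Lemma B_gt : z < B.
Proof. by rewrite word_size /Rows /pre /= mulSn; lia. Qed.
#[local] Opaque word.

Let inE : forall j, isin (cc j) = (j < z).
Proof. by have [k e] := word_input; case: (input_shape e). Qed.

Lemma look_tok j g lv : lk j = Some (g, lv) ->
  [/\ size (enc g) + j <= z, tok (cc j), lev (cc j) = lv, cd cc j = op g & theight g <= ~~ lv].
Proof.
move=> e; have [sz sh] := look_shift e; have s2 := size_enc_gt2 g.
have jz : j.+2 < z by clear -sz s2; lia.
have b o : o <= 2 -> nth false w (o + j) = nth false (enc g) o.
  by move=> ho; rewrite addnC; apply: (sh o (leq_ltn_trans ho s2)).2.
rewrite /cd !row0 ?(ltnW jz) ?(ltnW (ltnW jz)) //; last by clear -jz; lia.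
split=> //; rewrite /=; [by rewrite addnC | by rewrite e | by rewrite e | | exact: (look_theight (lv := false) hf e)].
rewrite /code /= e /= (b 0) // (b 1) // (b 2) //.
by case: (g).
Qed.

Lemma look_bits j g lv o : lk j = Some (g, lv) -> o < size (enc g) -> bit (cc (o + j)) = nth false (enc g) o.
Proof.
move=> e ho; have [sz sh] := look_shift e.
rewrite row0; last by clear -sz ho; lia.
by rewrite /= addnC (sh o ho).2.
Qed.

Definition args (g : form) (lv : bool) : option (form * form * bool) :=
  match g with
  | Or a b | And a b | Imp a b => Some (a, b, lv)
  | Until a b | Release a b => Some (a, b, true)
  | _ => None
  end.

Lemma look_args j g lv a b lv' : lk j = Some (g, lv) -> args g lv = Some (a, b, lv') ->
  [/\ lk j.+3 = Some (a, lv'), lk (size (enc a) + j.+3) = Some (b, lv') &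
   size (enc g) + j = size (enc b) + (size (enc a) + j.+3)].
Proof.
move=> e ha; have [sz sh] := look_shift e.
have sg : size (enc g) = 3 + size (enc a) + size (enc b).
  by case: g ha {e sz sh} => //= x y [<- <- _]; rewrite size_cat.
have sa := size_enc_gt2 a; have sb := size_enc_gt2 b.
have la3 : look g lv 3 = Some (a, lv').
  by case: g ha {e sz sh sg} => //= x y [-> -> ->]; rewrite (ltnW (ltnW sa)) look0.
have lb3 : look g lv (3 + size (enc a)) = Some (b, lv').
  by case: g ha {e sz sh sg la3} => //= x y [-> -> ->]; rewrite ltnn subnn look0.
split; last by clear -sg; lia.
  by rewrite -la3 -addn3; apply: (sh 3 _).1; rewrite sg; clear -sa; lia.
rewrite -lb3 (_ : size (enc a) + j.+3 = j + (3 + size (enc a))); last by clear; lia.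
by apply: (sh _ _).1; rewrite sg; clear -sb; lia.
Qed.

Lemma look_next j a lv : lk j = Some (Next a, lv) ->
  lk j.+3 = Some (a, true) /\ size (enc (Next a)) + j = size (enc a) + j.+3.
Proof.
move=> e; have [sz sh] := look_shift e; split; last by rewrite /= !addnS.
have sa := size_enc_gt2 a.
by rewrite -addn3 (sh 3 _).1 /= ?look0 //; clear -sa; lia.
Qed.

Lemma look_num j p lv t : lk j = Some (Atom p, lv) -> t <= size (bin p) ->
  [/\ lk (t.*2 + j.+3) = None, t.*2 + j.+3 < z, bit (cc (t.*2 + j.+3)) = (t < size (bin p)) &
   t < size (bin p) -> bit (cc (t.*2 + j.+3).+1) = nth false (bin p) t].
Proof.
move=> e ht; have [sz sh] := look_shift e.
have se : size (enc (Atom p)) = (size (bin p)).*2.+4 by rewrite /= size_encb.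
have lt : t.*2.+3 < size (enc (Atom p)) by rewrite se !ltnS leq_double.
have e3 : t.*2 + j.+3 = j + t.*2.+3 by rewrite !addnS addnC.
split.
- by rewrite e3 (sh _ lt).1.
- by rewrite e3; apply: leq_trans sz; rewrite ltn_add2l.
- by rewrite e3 addnC (look_bits e lt) /= -[enc_nat p]/(encb (bin p)) nth_encb.
move=> ht'; have lt' : t.*2.+4 < size (enc (Atom p)) by rewrite se !ltnS ltn_double.
rewrite e3 -addnS addnC (look_bits e lt') /= -[enc_nat p]/(encb (bin p)).
by rewrite (nth_encb (bin p) t).2.
Qed.

Lemma EP_tok j k g lv : EP j k -> lk j = Some (g, lv) -> k = size (enc g) + j.
Proof.
move=> [[h [lv' [-> ->]]] [-> _] //|[p [lv' [j0 [t [e ht -> _]]]]]].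
by have [-> _ _ _] := look_num e ht.
Qed.

Lemma EP_look j g lv : lk j = Some (g, lv) -> EP j (size (enc g) + j).
Proof. by move=> e; left; exists g, lv. Qed.

Lemma tokE j : j <= z -> tok (cc j) = isSome (lk j).
Proof. by move=> jz; rewrite row0. Qed.

Lemma cert_parse : C_parse cc B z.
Proof.
move=> j jB jz k kB kz /(ErelP jz kz) E; rewrite -/(cd cc j).
case: (E) => [[g [lv [e ek]]]|[p [lv [j0 [t [e ht ej ek]]]]]].
  have [sz tj lj cj hg] := look_tok e; have s2 := size_enc_gt2 g.
  have i2 : isin (cc j.+2) by rewrite inE; clear -sz s2; lia.
  have j3 : j.+3 <= z by clear -sz s2; lia.
  rewrite /parse_ok -/(cd cc j) cj i2 lj.
  have bin_ a b lv' : args g lv = Some (a, b, lv') ->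
    [/\ tok (cc j.+3), lev (cc j.+3) = lv' & exC B z (fun l => Erel cc B j.+3 l /\ (Erel cc B l k /\
      (tok (cc l) && (lev (cc l) == lev (cc j.+3)))))].
    move=> /(look_args e)[ea eb es]; have [sza ta la_ _ _] := look_tok ea.
    have [szb tb lb_ _ _] := look_tok eb.
    have lz : size (enc a) + j.+3 <= z by [].
    split=> //; exists (size (enc a) + j.+3); split; first by apply: leq_ltn_trans lz B_gt.
    split=> //; split; first by apply/ErelP => //; apply: EP_look ea.
    split; last by rewrite tb lb_ la_ eqxx.
    by apply/ErelP => //; rewrite ek es; apply: EP_look eb.
  case: g e ek sz cj hg bin_ {s2 E} => [p||a b|a b|a b|a|a b|a b] e ek sz cj hg bin_ /=.
  - have [l0 _ _ _] := look_num e (leq0n _); rewrite double0 add0n in l0.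
    rewrite (tokE j3) l0; split=> //; split=> // _; apply/ErelP => //.
    by right; exists p, lv, j, 0.
  - by split=> //; split=> //; split=> // _; rewrite ek.
  - by have [-> -> ?] := bin_ _ _ _ erefl; rewrite eqxx.
  - by have [-> -> ?] := bin_ _ _ _ erefl; rewrite eqxx.
  - by have [-> -> ?] := bin_ _ _ _ erefl; rewrite eqxx.
  - have [ea es] := look_next e; have [_ -> -> _ _] := look_tok ea.
    rewrite (_ : ~~ lv); last by case: (lv) hg.
    split=> //; split=> // _; apply/ErelP => //; rewrite ek es; exact: EP_look ea.
  - have [-> -> ?] := bin_ _ _ _ erefl.
    by rewrite (_ : ~~ lv); last by case: (lv) hg.
  have [-> -> ?] := bin_ _ _ _ erefl.
  by rewrite (_ : ~~ lv); last by case: (lv) hg.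
have [n0 lt b0 b1] := look_num e ht; rewrite -ej in n0 lt b0 b1.
have [sz _ _ _ _] := look_tok e.
have se : size (enc (Atom p)) = (size (bin p)).*2.+4 by rewrite /= size_encb.
have tj : tok (cc j) = false by rewrite tokE // n0.
rewrite /parse_ok -/(cd cc j).
case: (ltnP t (size (bin p))) => ht2.
  have cj : cd cc j = 9 by rewrite /cd /code tj b0 ht2.
  rewrite cj /=; have e2 : j.+2 = t.+1.*2 + j0.+3 by rewrite ej.
  have [n2 lt2 b2 _] := look_num e ht2; rewrite -e2 in n2 lt2 b2.
  rewrite !inE lt (ltnW lt2) (tokE (ltnW lt2)) n2 b2 b1 //=; split.
    rewrite orbC; case: ltnP => ht3; first by rewrite orbT.
    have et : t.+1 = size (bin p) by apply/eqP; rewrite eqn_leq ht2.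
    have := bin_last p; rewrite (last_nth true) -et /= => h.
    by rewrite orbF; move: h; rewrite (set_nth_default false) // -et.
  split=> //; split=> //; split=> //; split=> // _; apply/ErelP => //; first by exact: ltnW.
  by right; exists p, lv, j0, t.+1.
have cj : cd cc j = 8 by rewrite /cd /code tj b0 ltnNge ht2.
rewrite cj /= inE lt; split=> //; split=> //; split=> //; split=> // _.
by rewrite ek ej se; clear -ht ht2; lia.
Qed.

Let zB : z < B := B_gt.

Lemma look_le j g lv : lk j = Some (g, lv) -> j <= z.
Proof. by move=> /look_tok[sz _ _ _ _]; clear -sz; lia. Qed.

Lemma look_head j g lv : lk j = Some (g, lv) ->
  [/\ tok (cc j), lev (cc j) = lv, size (enc g) + j <= z & j < size (enc g) + j].
Proof.
move=> e; have [sz tj lj _ _] := look_tok e; have sg := size_enc_gt2 g.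
by split=> //; clear -sg; lia.
Qed.

Lemma look_node g lv j : lk j = Some (g, lv) -> node cc B z g lv j (size (enc g) + j).
Proof.
elim: g lv j => [p||a iha b ihb|a iha b ihb|a iha b ihb|a ih|a iha b ihb|a iha b ihb] lv j e;
  have [sz tj lj cj hg] := look_tok e; have jz := look_le e;
  split; try exact: look_head e; rewrite ?cj.
- split=> //; [|by rewrite /= !addnS|by apply/(ErelP jz sz); exact: EP_look e].
  move=> o ho; rewrite -[LHS]/(bit (cc (o + j.+3))) (_ : o + j.+3 = o.+3 + j); last by rewrite !addnS.
  exact: (look_bits (o := o.+3) e ho).
- by [].
- have [ea eb es] := look_args e erefl; split=> //; exists (size (enc a) + j.+3).
  by rewrite es; split; [apply/(ErelP (look_le ea) (look_le eb)); exact: EP_look ea|apply: iha|apply: ihb].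
- have [ea eb es] := look_args e erefl; split=> //; exists (size (enc a) + j.+3).
  by rewrite es; split; [apply/(ErelP (look_le ea) (look_le eb)); exact: EP_look ea|apply: iha|apply: ihb].
- have [ea eb es] := look_args e erefl; split=> //; exists (size (enc a) + j.+3).
  by rewrite es; split; [apply/(ErelP (look_le ea) (look_le eb)); exact: EP_look ea|apply: iha|apply: ihb].
- have [ea es] := look_next e; rewrite es; split=> //; last exact: ih.
  by case: (lv) hg.
- have [ea eb es] := look_args e erefl; split=> //; first by case: (lv) hg.
  exists (size (enc a) + j.+3).
  by rewrite es; split; [apply/(ErelP (look_le ea) (look_le eb)); exact: EP_look ea|apply: iha|apply: ihb].
have [ea eb es] := look_args e erefl; split=> //; first by case: (lv) hg.
exists (size (enc a) + j.+3).
by rewrite es; split; [apply/(ErelP (look_le ea) (look_le eb)); exact: EP_look ea|apply: iha|apply: ihb].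
Qed.

Lemma atom_look a : a <= z -> atom_at cc a -> exists p lv, lk a = Some (Atom p, lv).
Proof.
move=> az h; have : tok (cc a) by move: h; rewrite /atom_at /code; case: tok.
rewrite tokE //; case e: (lk a) => [[g lv]|] // _.
have [_ _ _ cj _] := look_tok e; move: h; rewrite /atom_at -/(cd cc a) cj.
by case: (g) e => // p e _; exists p, lv.
Qed.

Lemma sameid_look a b p q lv lv' : lk a = Some (Atom p, lv) -> lk b = Some (Atom q, lv') ->
  sameid cc B z a b <-> p = q.
Proof. by move=> ea eb; apply: (sameidP zB inE cert_parse (look_node ea) (look_node eb)). Qed.

Lemma cert_root : C_root cc B z.
Proof.
have e : lk 0 = Some (f, false) by rewrite look0.
have [sz t l _ _] := look_tok e; split; first by rewrite t l.
by apply/ErelP => //; have := EP_look e; rewrite addn0.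
Qed.

Lemma subTT : subtrace T T. Proof. by []. Qed.

Lemma cert_init : C_init cc B z.
Proof.
have [x h] := conf_row_ex 0 subTT; have [xB xr] := conf_crow h; exists x; split=> //; split=> // j jB jz.
case: h => _ _ h; rewrite h // /conf_start; apply/implyP => _; apply/allwP => v.
by rewrite wd_conf /confw; case: (lk j) => [[g lv]|].
Qed.

Lemma code_notok j n : tok (cc j) = false -> cd cc j = n -> n = 8 \/ n = 9.
Proof. by rewrite /cd /code => -> <-; case: bit; [right|left]. Qed.

Lemma cert_cond1 : C_cond1 cc B z.
Proof.
move=> x xB /crowP-/(_ xB) [H [i [sub [_ _ h] _]]] j jB jz; rewrite -/(cd cc j).
case e: (lk j) => [[g lv]|]; last first.
  by have [->|->] := code_notok (etrans (tokE jz) (congr1 isSome e)) erefl.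
have [sz tj lj cj hg] := look_tok e; rewrite cj lj h //.
case: g e hg {sz cj} => [p||a b|a b|a b|a|a b|a b] e hg //=.
- apply/andP; split; first by rewrite /confw e /=; apply/implyP; apply: sub.
  apply/allwP => v; rewrite wd_conf /confw e /=; case: lv {e lj hg} => //.
  by rewrite !eqxx.
- by apply/allwP => v; rewrite wd_conf /confw e.
have [ea _] := look_next e; apply/allwP => v; rewrite h ?(look_le ea) // !wd_conf /confw e ea /=.
by rewrite (_ : lv = false) /= ?eqxx //; case: (lv) hg.
Qed.

Lemma cert_cond2 : C_cond2 cc B z.
Proof.
move=> x xB /crowP-/(_ xB) [H [i [sub [_ _ h] _]]] j jB jz l lB lz E; rewrite -/(cd cc j).
case e: (lk j) => [[g lv]|]; last first.
  by have [->|->] := code_notok (etrans (tokE jz) (congr1 isSome e)) erefl.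
have [sz tj lj cj hg] := look_tok e; rewrite cj.
case ag: (args g lv) => [[[a b] lv']|]; last by case: (g) ag.
have [ea eb es] := look_args e ag.
have el : l = size (enc a) + j.+3.
  by apply: (EP_tok _ ea); apply/(ErelP (look_le ea) lz).
rewrite !h ?(look_le ea) //; apply/allwP => v.
rewrite -[wT _]/(wd true (confcell H i j.+3)) -[wT (confcell H i l)]/(wd true _) !wd_conf /confw e ea el eb /=.
case: g ag e hg {cj sz es} => //= a' b' [-> -> <-] e hg; rewrite ?eqxx //=.
- by rewrite (_ : lv = false) /= ?eqxx //; case: (lv) hg.
- by rewrite (_ : lv = false) /= ?eqxx //; case: (lv) hg.
Qed.

Lemma cert_toggle : C_toggle cc B z.
Proof.
move=> x xB /crowP-/(_ xB) [H [i [sub [_ _ h] _]]] a aB az /andP[/(atom_look az)[p [lv e]]].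
rewrite h // /= /confw e /= => Tp.
(* A change at the single place (i, p) leaves all statuses before [i] intact. *)
pose H' : trace := fun k q => if (k == i) && (q == p) then ~~ H k q else H k q.
have sub' : subtrace H' T.
  by move=> k q; rewrite /H'; case: ifP => [/andP[/eqP -> /eqP ->] //|_]; apply: sub.
have before k : k < i -> H k =1 H' k.
  by move=> ki q; rewrite /H' (ltn_eqF ki).
have [y hy] := conf_row_ex i sub'; have [yB yr] := conf_crow hy; case: hy => _ _ hy.
exists y; split=> //; split=> //; split.
  rewrite h // hy //= /diff; apply/eqP/eq_in_has => k; rewrite mem_iota add0n /= => ki.
  by apply: eq_has => q; rewrite before.
move=> j jB jz; rewrite h // hy //; split.
  rewrite /conf_same /= eqxx /=; apply/implyP => _; apply/allwP => v; rewrite !wd_conf /confw.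
  case: (lk j) => [[g lv']|] //=; apply/eqP/eq_stt => // k ki q.
  by rewrite before.
move=> /(atom_look jz)[q [lv' e']]; rewrite /= /confw e' /= /H' eqxx /=.
case: (@eqP _ q p) => [eq|ne]; [left|right]; split=> //.
  by apply/(sameid_look e e'); rewrite eq.
by move/(sameid_look e e') => eq; case: ne; rewrite eq.
Qed.

Lemma cert_next : C_next cc B z.
Proof.
move=> x xB /crowP-/(_ xB) [H [i [sub [_ _ h] later]]].
have [y [hxy hy]] : exists y, (N <= i \/ x < y) /\ is_row (confcell H i.+1) y.
  (* Before the tail the successor belongs to the next block, hence lies further right. *)
  case: (leqP N i) => iN.
    by have [y hy] := conf_row_ex i.+1 sub; exists y; split=> //; left.
  have [|y [lt hy]] := later H i.+1 sub; last by exists y; split=> //; right.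
  by clear -iN; lia.
have [yB yr] := conf_crow hy; case: hy => _ _ hy.
exists y; split=> //; split=> //; split.
  by rewrite h // hy //= eqxx andbT; apply/implyP; apply: leqW.
split; first by rewrite h //.
move=> j jB jz; rewrite h // hy // /conf_next /= eqxx /=; apply/implyP => _; apply/allwP => v.
by rewrite !wd_conf /confw; case: (lk j) => [[g lv']|] //=.
Qed.

(** The code exceeds the list of atoms by at least 3 bits, so the [z.+1] columns of a row offer
    enough bits for all identifiers. *)
Lemma N_lt : N < 2 ^ z.+1.
Proof.
apply: leq_ltn_trans Nb _; have := size_enc_atoms f; move: (size (atoms f)) => a ha.
apply: (@leq_trans (2 ^ (a + 3))); last by rewrite leq_exp2l //; clear -ha; lia.
rewrite expnD; have : 0 < 2 ^ a by rewrite expn_gt0.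
by move: (2 ^ a) => b hb; clear -hb; lia.
Qed.

Lemma cert_twin : C_twin cc B z.
Proof.
move=> x xB /crowP-/(_ xB) [H [i [sub [_ _ h] _]]] y yB /crowP-/(_ yB) [H' [i' [sub' [_ _ h'] _]]] same.
have ei : minn i' N = minn i N.
  apply: (@idb_inj z); try by apply: leq_ltn_trans N_lt; exact: geq_minr.
  move=> j jz; have jB : j < B by apply: leq_ltn_trans zB.
  by have := same j jB jz; rewrite h // h' // => /eqP.
have eN : (N <= i') = (N <= i) by clear -ei; lia.
have eS : minn i'.+1 N = minn i.+1 N by clear -ei; lia.
(* Equal identifiers mean equal positions or two positions in the tail. *)
have eT : T i' =1 T i.
  case: (leqP N i) eN => iN eN'; first by move=> p; rewrite (Tc eN') (Tc iN).
  by have -> : i' = i by clear -ei iN eN'; lia.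
split; first by rewrite h // h' //= eN.
move=> j jB jz; rewrite h // h' // /conf_twin /= eS eqxx /=; apply/implyP => _.
by rewrite /confw; case: (lk j) => [[[]]|] //= p lv'; rewrite eT.
Qed.

Lemma diffS H i : diff H i.+1 = diff H i || has (fun p => H i p != T i p) (atoms f).
Proof. by rewrite /diff -addn1 iotaD has_cat /= orbF add0n. Qed.

Lemma cert_diff : C_diff cc B z.
Proof.
move=> x xB /crowP-/(_ xB) [H [i [sub [_ _ h] _]]]; split.
  by rewrite h //= diffS; apply/implyP => ->.
move=> j jB jz; apply/implyP => /andP[/(atom_look jz)[p [lv e]]].
rewrite !h //= /confw e /= => ne; rewrite diffS; apply/orP; right.
by apply/hasP; exists p => //; exact: look_atoms e.
Qed.

Lemma cert_atoms : C_atoms cc B z.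
Proof.
move=> x xB /crowP-/(_ xB) [H [i [sub [_ _ h] _]]] a aB az b bB bz.
case/andP => /(atom_look az)[p [lv e]] /(atom_look bz)[q [lv' e']] /(sameid_look e e') pq.
by rewrite !h //= /confw e e' /= pq !eqxx.
Qed.

(** A row depends on H only up to position [i]. Freezing H there gives [G], still below T because T
    is constant from [i] on; [ev_const] identifies the value in the row with satisfaction by [G] and
    T, to which minimality of T applies. *)
Lemma cert_fin : C_fin cc B z.
Proof.
move=> x xB /crowP-/(_ xB) [H [i [sub [_ _ h] _]]].
rewrite !h //; apply/implyP => /= iN.
have e : lk 0 = Some (f, false) by rewrite look0.
rewrite /confw e /=.
pose G : trace := fun k => H (minn k i).
have i0 : 0 < i by apply: leq_trans iN.
have evG v : ev (lf0 H T i) v f = ev (lf0 G T i) v f.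
  apply: eq_ev => v' g; rewrite /lf0 (@eq_stt H T G T) // => k ki q.
  by rewrite /G (minn_idPl _).
have vE v : ev (lf0 H T i) v f <-> sat (tr G T v) T 0 f.
  rewrite evG; apply: ev_const => // k ki q; first by rewrite /G (minn_idPr ki) minnn.
  by rewrite (Tc (leq_trans iN ki)) (Tc iN).
apply/andP; split; first by apply/(vE true); case: eqm.
apply/implyP => /hasP[k]; rewrite mem_iota add0n /= => ki /hasP[p _ ne].
apply/negP => /(vE false); apply: eqm.2.
  move=> k' q; rewrite /= /G; case: (leqP k' i) => h' Hq; first exact: sub _ _ Hq.
  by rewrite (Tc (leq_trans iN (ltnW h'))) -(Tc iN); exact: sub _ _ Hq.
by exists k, p; rewrite /= /G (minn_idPl _) //; apply/eqP.
Qed.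

Lemma cert_word : Cert cc B z.
Proof.
split; first exact: cert_root.
split; first exact: cert_parse.
split; first exact: cert_init.
split; first exact: cert_cond1.
split; first exact: cert_cond2.
split; first exact: cert_toggle.
split; first exact: cert_next.
split; first exact: cert_twin.
split; first exact: cert_diff.
split; first exact: cert_atoms.
exact: cert_fin.
Qed.
End Build.

(** * The sentence, the language and the size of certificates *)

Lemma holds_main (w : seq bool) (c : seq cell) k : map cin c = map Some w ++ nseq k None ->
  holds cell0 c (fun _ => 0) f_main <-> size w < size c /\ Cert (nth cell0 c) (size c) (size w).
Proof.
move=> e; have [inE' _] := input_shape e; split.
  move=> [v0 [_ [h0 [v1 [v1B [h1 [h2 h3]]]]]]].
  have {h0} h0 : v0 = 0 by move: h0; rewrite /= /upd /=; lia.
  subst v0; have /= := h1; rewrite /upd /= inE' -leqNgt => w1.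
  have e1 : v1 = size w.
    apply/eqP; rewrite eqn_leq w1 andbT leqNgt; apply/negP => lt.
    have := h2 (size w) (ltn_trans lt v1B) lt.
    by rewrite /= inE' ltnn.
  by subst v1; split=> //; rewrite -certE.
move=> [sB ct]; exists 0; split; first by apply: leq_ltn_trans sB.
split=> //; exists (size w); split=> //; split; first by rewrite /= inE' ltnn.
split; first by move=> v vB /= vw; rewrite inE'.
by have := ct; rewrite -certE.
Qed.

Theorem mainTheorem6 : NEXPTIME CON_THT1.
Proof.
pose a0 := #|cell : finType|; pose a := 4 * a0 + 20.
have small w : CON_THT1 w -> 0 < size w /\ exists c k, [/\ map cin c = map Some w ++ nseq k None,
     holds cell0 c (fun _ => 0) f_main & size c <= 2 ^ (a * (size w) ^ a)].
  move=> [f [-> [hf ex]]]; split; first by apply: leq_trans (size_enc_gt2 f).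
  have [T [N [eqm N0 Tc Nb]]] := small_equilibrium hf ex.
  exists (word f T N); have [k ek] := word_input T N0 Nb; exists k; split=> //.
    apply/(holds_main ek); split; first exact: B_gt.
    exact: cert_word hf eqm N0 Tc Nb.
  apply: leq_trans (word_bound T N0 Nb) _.
  have := N_lt Nb; have := size_enc_gt2 f; move: (size (enc f)) => z z2 hN.
  apply: (@leq_trans (2 ^ (a * z))); last first.
    rewrite leq_exp2l // leq_mul2l; apply/orP; right.
    by rewrite -{1}[z]expn1 leq_pexp2l //; rewrite /a; lia.
  have hX : a0 ^ z.+1 <= 2 ^ (a0 * z.+1).
    by rewrite expnM; apply: leq_expnl2; apply: ltnW; apply: ltn_expl.
  have hm : z.+1 <= 2 ^ z.+1 by apply: ltnW; apply: ltn_expl.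
  (* The four terms account for a constant factor 4, the number of blocks, the rows in a block and
     the length of a row. *)
  apply: (@leq_trans (2 ^ (2 + z.+1 + a0 * z.+1 + z.+1))); last first.
    by rewrite leq_exp2l // /a; clear -z2; nia.
  rewrite expnD; apply: leq_mul => //.
  rewrite -/a0; rewrite !expnD.
  have p1 : 0 < 2 ^ z.+1 by rewrite expn_gt0.
  have p2 : 0 < 2 ^ (a0 * z.+1) by rewrite expn_gt0.
  move: hX hN p1 p2; move: (2 ^ z.+1) (2 ^ (a0 * z.+1)) (a0 ^ z.+1) => M X Y hX hN p1 p2.
  apply: (@leq_trans (1 + X + M * X)).
    by apply: leq_add; [rewrite leq_add2l | apply: leq_mul].
  by rewrite (_ : 2 ^ 2 = 4) //; nia.
apply: (NEXPTIME_of_fo (din := cin) (a := a) wf_main _ small) => w; split.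
  by move=> /small[w0 [c [k [h1 h2 _]]]]; exists c, k; split=> // c0; move: h1 w0; rewrite c0; case: (w).
move=> [c [k [h1 _ /(holds_main h1)[h2 h3]]]].
by have [i1 i2] := input_shape h1; apply: Cert_sound h3.
Qed.
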